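(* Let $\alpha_0\in(1/2,1)$. Then there is a strong Salem measure $\mu$ on $\mathbb{R}$ supported on a set of Hausdorff dimension $\alpha_0$, such that $\mu*\mu$ has a Hölder continuous density, and $$\|\widehat{f\,d\mu}\|_{L^p(\mathbb{R})}\le C_{p,q}\|f\|_{L^q(\mu)}$$ holds for all $p\ge4$ and $q\ge p/(p-2)$ (with $C_{p,q}<\infty$ independent of $f$).
   Context: A finite Borel measure $\mu$ whose support has Hausdorff dimension $\alpha_0$ is a strong Salem measure if for every $\alpha,\beta<\alpha_0$ (arbitrarily close to $\alpha_0$) there is $C$ with $\mu(B(x,r))\le Cr^\alpha$ for all $x,r$ and $|\widehat\mu(\xi)|\le C(1+|\xi|)^{-\beta/2}$ for all $\xi$, where $\widehat\mu(\xi)=\int e^{-2\pi i\xi y}d\mu(y)$ and $\widehat{f\,d\mu}(\xi)=\int f(y)e^{-2\pi i\xi y}d\mu(y)$. *)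

(* Defs.v *)
From HB Require Import structures.
From mathcomp Require Import all_boot all_order all_algebra.
From mathcomp Require Import all_classical all_reals all_analysis.
Set Implicit Arguments. Unset Strict Implicit. Unset Printing Implicit Defensive.
Import Order.TTheory GRing.Theory Num.Theory.
Import numFieldNormedType.Exports.
Local Open Scope classical_set_scope.
Local Open Scope ring_scope.

Section Defs.
Context {R : realType}.

(* Diameter of a subset of R (diam of the empty set is 0). *)
Definition diam (A : set R) : \bar R :=
  ereal_sup ([set 0%E] `|` [set (`|x - y|)%:E | x in A & y in A]).

Definition hausdorff_content_delta (s delta : R) (A : set R) : \bar R :=
  ereal_inf [set (\sum_(0 <= i <oo) ((fine (diam (U i))) `^ s)%:E)%E
            | U in [set U : nat -> set R |
                    A `<=` \bigcup_i U i /\ forall i, (diam (U i) <= delta%:E)%E]].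

Definition hausdorff_measure (s : R) (A : set R) : \bar R :=
  ereal_sup [set hausdorff_content_delta s delta A | delta in [set d : R | 0 < d]].

(* Hausdorff dimension: inf { s > 0 | H^s(A) = 0 } (equal to the usual
   inf over s >= 0, since H^0(A) > 0 for nonempty A). *)
Definition hausdorff_dim (A : set R) : \bar R :=
  ereal_inf [set s%:E | s in [set s : R | 0 < s /\ hausdorff_measure s A = 0%E]].

Definition msupport (mu : {measure set R -> \bar R}) : set R :=
  [set x | forall r : R, 0 < r -> (0 < mu (ball x r))%E].

(* Modulus of the Fourier transform of (fr + i fi) dmu at xi:
   \int (fr + i fi)(y) e^{-2 pi i xi y} dmu(y). *)
Definition ft_re (mu : {measure set R -> \bar R}) (fr fi : R -> R) (xi : R) : R :=
  Rintegral mu setT (fun y => fr y * cos (2 * pi * xi * y) + fi y * sin (2 * pi * xi * y)).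
Definition ft_im (mu : {measure set R -> \bar R}) (fr fi : R -> R) (xi : R) : R :=
  Rintegral mu setT (fun y => fi y * cos (2 * pi * xi * y) - fr y * sin (2 * pi * xi * y)).
Definition ft_abs (mu : {measure set R -> \bar R}) (fr fi : R -> R) (xi : R) : R :=
  Num.sqrt (ft_re mu fr fi xi ^+ 2 + ft_im mu fr fi xi ^+ 2).

Definition strong_salem (mu : {finite_measure set R -> \bar R}) : Prop :=
  exists alpha0 : R, hausdorff_dim (msupport mu) = alpha0%:E /\
  forall alpha beta : R, 0 < alpha < alpha0 -> 0 <= beta < alpha0 ->
    exists C : R,
      (forall x r : R, 0 < r -> (mu (ball x r) <= (C * r `^ alpha)%:E)%E) /\
      (forall xi : R, ft_abs mu (fun=> 1) (fun=> 0) xi <= C * (1 + `|xi|) `^ (- (beta / 2))).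

Definition holder_continuous (g : R -> R) : Prop :=
  exists gamma C : R, 0 < gamma <= 1 /\
    forall x y : R, `|g x - g y| <= C * `|x - y| `^ gamma.

End Defs.

(* Main.v *)
Require Import Defs.
From HB Require Import structures.
From mathcomp Require Import all_boot all_order all_algebra.
From mathcomp Require Import all_classical all_reals all_analysis.
From mathcomp Require Import ring lra.
From mathcomp Require Import zify measurable_realfun.
Import Order.TTheory GRing.Theory Num.Theory.
Import numFieldNormedType.Exports.
Local Open Scope classical_set_scope.
Local Open Scope ring_scope.

(** The measure is the weak limit of step densities [a_k] on grids of mesh [1 / N_k]. To pass
    from one grid to the next, each fine cell is kept, with its density multiplied by [1 / p] where
    [p = N ^ (alpha0 - 1)], or deleted. The choices are made greedily, so that the exponential
    moments of polynomially many linear and quadratic test sums stay bounded. These sums control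
    the number of cells, the mass of intervals, the Fourier transform and the self-convolution;
    the error in the self-convolution is of order [N ^ (1 / 2 - alpha0)] up to logarithms, hence
    [alpha0 > 1 / 2] makes the densities of [mu_k * mu_k] converge in a Hoelder norm.

    Restriction: let [F] be the Fourier transform of [f mu]. Then [F ^ 2] is the transform of
    [f mu * f mu]. Since [mu * mu] has a bounded density on [[0, 2]], duality and the orthogonality
    of the characters [e (u j / 2)] on [[0, 2]] bound [\sum_j |F (s + j / 2)| ^ 4] by a multiple of
    the fourth power of the [L^2] norm of [f], uniformly in [s]; integrating in [s] gives [p = 4],
    [q = 2]. For [p > 4] and [q = p / (p - 2)], on the set where [|F|] is about [t = T / 2 ^ i] the
    large values of [f] contribute at most [t / 4] to [F], so that there [|F| ^ p] is at most a
    multiple of [t ^ (p - 4) |F_i| ^ 4], with [F_i] the transform of the truncation of [f] to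
    small values; the [L^4] bounds for the [F_i] sum up by Cauchy-Schwarz. *)

(** A test coefficient may depend on the choices already made. This brings the self-convolution,
    quadratic in the choices, within reach: its sum is folded so that each product carries the
    earlier factor as a coefficient of the later one. That factor can be as large as [1 / p], while
    a coefficient must stay below [p]; after scaling this asks for [L <= p ^ 2 * N], with [L] the
    logarithmic size of the family of tests, so that [alpha0 > 1 / 2] is already needed to run the
    tests. Densities enter only through sums of increments of a primitive. Masses, Fourier integrals
    and self-convolutions of step densities are then finite sums that do not change when the grid is
    refined, and stages can be subtracted cell by cell. The error [e k] of stage [k] satisfies
    [e k * (N_ k) ^ 2 <= 1], hence stays negligible after summation over all cells; integrals
    against the limit measure become sums against [a_ k]. The density of [mu * mu] is identified at
    the end: the distribution function [t |-> \int F (t - y) dmu(y)] is shown to have the derivative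
    [g], the uniform limit of the discrete self-convolutions. *)

(** * Exponential moments and the greedy choice *)

(** From [exp (- x / 2) >= 1 - x / 2] follows [exp x * (1 - x / 2) ^ 2 <= 1], and the quadratic
    bound times the same square is [1] plus a nonnegative multiple of [x ^ 2]. *)
Lemma expR_le_quadratic {R : realType} (x : R) : `|x| <= 1 -> expR x <= 1 + x + 2 * x ^+ 2.
Proof.
rewrite ler_norml => /andP[x1 x2].
have h := expR_ge1Dx (- (x / 2)).
have h0 : 0 < 1 - x / 2 by lra.
have e2 : expR x = expR (x / 2) * expR (x / 2) by rewrite -expRD -splitr.
have h1 : expR (x / 2) * (1 - x / 2) <= 1.
  apply: (@le_trans _ _ (expR (x / 2) * expR (- (x / 2)))).
    by rewrite ler_wpM2l// expR_ge0.
  by rewrite -expRD subrr expR0.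
have h2 : expR x * (1 - x / 2) ^+ 2 <= 1.
  have -> : expR x * (1 - x / 2) ^+ 2 = (expR (x / 2) * (1 - x / 2)) ^+ 2 by rewrite exprMn e2 -expr2.
  by rewrite expr_le1// mulr_ge0// ?expR_ge0// ltW.
have h3 : 1 <= (1 + x + 2 * x ^+ 2) * (1 - x / 2) ^+ 2.
  have -> : (1 + x + 2 * x ^+ 2) * (1 - x / 2) ^+ 2
     = 1 + x ^+ 2 * ((1 - x) * (5 / 2 - x) / 2) by field.
  rewrite lerDl mulr_ge0 ?sqr_ge0// divr_ge0// mulr_ge0; lra.
rewrite -(ler_pM2r (_ : 0 < (1 - x / 2) ^+ 2)) ?exprn_gt0//.
exact: le_trans h2 h3.
Qed.

(* The centred Bernoulli variable with values 1/p - 1 (probability p) and -1 is sub-Gaussian with variance proxy 4/p. *)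
Lemma bernoulli_mgf {R : realType} (p c : R) : 0 < p < 1 -> `|c| <= p ->
  p * expR (c * (p^-1 - 1) - 2 / p * c ^+ 2) + (1 - p) * expR (- c - 2 / p * c ^+ 2) <= 1.
Proof.
move=> /andP[p0 p1] cp.
have pV1 : 1 <= p^-1 by rewrite invf_ge1// ltW.
have pp : p * p^-1 = 1 by rewrite divff// gt_eqF.
have c1 : `|c * (p^-1 - 1)| <= 1.
  rewrite normrM [X in _ * X]ger0_norm; last by lra.
  apply: (@le_trans _ _ (p * (p^-1 - 1))); first by rewrite ler_wpM2r//; lra.
  by rewrite mulrBr pp; lra.
have c2 : `|- c| <= 1 by rewrite normrN (le_trans cp)// ltW.
have e1 := expR_le_quadratic _ c1; have e2 := expR_le_quadratic _ c2.
set q := 2 / p * c ^+ 2.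
have -> : p * expR (c * (p^-1 - 1) - q) + (1 - p) * expR (- c - q)
  = (p * expR (c * (p^-1 - 1)) + (1 - p) * expR (- c)) * expR (- q) by rewrite !expRD; ring.
have m : p * expR (c * (p^-1 - 1)) + (1 - p) * expR (- c) <= 1 + q.
  apply: (@le_trans _ _ (p * (1 + c * (p^-1 - 1) + 2 * (c * (p^-1 - 1)) ^+ 2)
      + (1 - p) * (1 + - c + 2 * (- c) ^+ 2))).
    by apply: lerD; rewrite ler_wpM2l//; lra.
  (* Centring cancels the linear terms, and the variance is [1 / p - 1]. *)
  have -> : p * (1 + c * (p^-1 - 1) + 2 * (c * (p^-1 - 1)) ^+ 2) +
    (1 - p) * (1 + - c + 2 * (- c) ^+ 2) = 1 + 2 * c ^+ 2 * (p^-1 - 1).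
    by field; rewrite gt_eqF.
  rewrite lerD2l /q; have := sqr_ge0 c; nra.
have h := expR_ge1Dx q; have q0 := expR_ge0 (- q).
apply: (@le_trans _ _ (expR q * expR (- q))).
  by rewrite ler_wpM2r// (le_trans m).
by rewrite -expRD subrr expR0.
Qed.

(** Method of conditional expectations. As [c j t eta] depends only on [eta] before [t], averaging
    over the two values of [eta t] with weights [p] and [1 - p] does not increase the potential
    [\sum_j expR (\sum_t X j t eta)]; one of the two values keeps it below its initial value [#|J|].
    Each single exponential is then at most [expR L]. *)
Lemma greedy_concentration {R : realType} (J : finType) (p L : R)
    (c : J -> nat -> (nat -> R) -> R) (N : nat) :
  0 < p < 1 -> #|J|%:R <= expR L ->
  (forall j t eta eta', (forall s, (s < t)%N -> eta s = eta' s) -> c j t eta = c j t eta') ->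
  (forall j t eta, (forall s, eta s = p^-1 - 1 \/ eta s = -1) -> `|c j t eta| <= p) ->
  exists eta : nat -> R, (forall s, eta s = p^-1 - 1 \/ eta s = -1) /\
    forall j, \sum_(t < N) c j t eta * eta t <= L + 2 / p * \sum_(t < N) c j t eta ^+ 2.
Proof.
move=> p01 JL cpred cb; have /andP[p0 p1] := p01.
pose X j t eta := c j t eta * eta t - 2 / p * c j t eta ^+ 2.
suff [eta [eta2 H]] : exists eta : nat -> R, (forall s, eta s = p^-1 - 1 \/ eta s = -1) /\
    \sum_j expR (\sum_(t < N) X j t eta) <= #|J|%:R.
  exists eta; split => // j.
  rewrite mulr_sumr addrC -lerBlDl -sumrB.
  rewrite -ler_expR; apply: le_trans JL; apply: le_trans H.
  rewrite (bigD1 j)//= lerDl sumr_ge0// => i _; exact: expR_ge0.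
elim: N => [|N [eta [eta2 IH]]].
  exists (fun=> -1); split; first by move=> s; right.
  under eq_bigr do rewrite big_ord0 expR0.
  by rewrite sumr_const.
pose up v s := if s == N then v else eta s.
have upc v j t : (t <= N)%N -> c j t (up v) = c j t eta.
  by move=> tN; apply: cpred => s st; rewrite /up ltn_eqF// (leq_trans st).
have upX v : \sum_j expR (\sum_(t < N.+1) X j t (up v))
   = \sum_j expR (\sum_(t < N) X j t eta) * expR (c j N eta * v - 2 / p * c j N eta ^+ 2).
  apply: eq_bigr => j _; rewrite big_ord_recr/= [LHS]expRD.
  congr (expR _ * expR _); last by rewrite /X !upc// /up eqxx.
  apply: eq_bigr => t _; rewrite /X !upc ?(ltnW (ltn_ord t))//.
  by rewrite {1}/up ltn_eqF.
have upv v : v = p^-1 - 1 \/ v = -1 -> forall s, up v s = p^-1 - 1 \/ up v s = -1.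
  by move=> hv s; rewrite /up; case: eqP.
have avg : p * (\sum_j expR (\sum_(t < N.+1) X j t (up (p^-1 - 1))))
    + (1 - p) * (\sum_j expR (\sum_(t < N.+1) X j t (up (-1)))) <= #|J|%:R.
  apply: le_trans IH; rewrite !upX !mulr_sumr -big_split/=; apply: ler_sum => j _.
  have := bernoulli_mgf p (c j N eta) p01 (cb _ _ _ eta2).
  set E := expR (\sum_(t < N) _); have E0 : 0 <= E by exact: expR_ge0.
  rewrite mulrN1 => /(ler_wpM2l E0); rewrite mulr1; apply: le_trans.
  by rewrite le_eqVlt; apply/orP; left; apply/eqP; ring.
have [h|h] := leP (\sum_j expR (\sum_(t < N.+1) X j t (up (p^-1 - 1)))) #|J|%:R.
  by exists (up (p^-1 - 1)); split => //; apply: upv; left.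
exists (up (-1)); split; first by apply: upv; right.
by nra.
Qed.

(* [N] and [a] encode the step density with value [a s] between [s / N] and [(s + 1) / N] for [s < N]. Its integral
   against [psi'] is [stieltjes_sum N a psi], and [self_conv N a] is the density of its self-convolution. *)
Definition stieltjes_sum {R : realType} (N : nat) (a : nat -> R) (psi : R -> R) : R :=
  \sum_(s < N) a s * (psi (s.+1%:R / N%:R) - psi (s%:R / N%:R)).

(** As a function of [y], [Num.min y x] is a primitive of the indicator of [y <= x]. In the same way
    [- cdf N a (x - y)] is a primitive of the density taken at [x - y]. *)
Definition cdf {R : realType} (N : nat) (a : nat -> R) (x : R) : R :=
  stieltjes_sum N a (fun y => Num.min y x).

Definition self_conv {R : realType} (N : nat) (a : nat -> R) (x : R) : R :=
  stieltjes_sum N a (fun y => - cdf N a (x - y)).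

(** * Step densities and their self-convolution *)

Section step_densities.
Context {R : realType}.
Implicit Types (N : nat) (a b c : nat -> R) (psi : R -> R).

Lemma sum_divn N K (F : nat -> R) : (0 < K)%N ->
  \sum_(s < N * K) F s = \sum_(i < N) \sum_(j < K) F (i * K + j)%N.
Proof.
move=> K0; elim: N => [|N IH]; first by rewrite mul0n !big_ord0.
rewrite big_ord_recr/= -IH -!(big_mkord xpredT F) mulSn addnC.
rewrite (big_cat_nat _ (leq_addr K (N * K)%N))//=; congr (_ + _).
rewrite -{1}[(N * K)%N]add0n big_addn addKn big_mkord.
by apply: eq_bigr => j _; rewrite addnC.
Qed.

(** The density is constant on a coarse cell, so the increments of [psi] over its fine cells
    telescope. Two stages can thus be compared on the finer grid. *)
Lemma stieltjes_sum_refine N K a psi : (0 < N)%N -> (0 < K)%N ->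
  stieltjes_sum (N * K) (fun s => a (s %/ K)%N) psi = stieltjes_sum N a psi.
Proof.
move=> N0 K0; rewrite /stieltjes_sum
  (sum_divn N K (fun s => a (s %/ K)%N * (psi (s.+1%:R / (N * K)%:R) - psi (s%:R / (N * K)%:R))))//.
apply: eq_bigr => i _.
have K0' : K%:R != 0 :> R by rewrite pnatr_eq0 -lt0n.
have N0' : N%:R != 0 :> R by rewrite pnatr_eq0 -lt0n.
under eq_bigr => j _ do rewrite divnMDl// divn_small// addn0.
rewrite -mulr_sumr; congr (_ * _).
pose u j : R := psi ((i * K + j)%:R / (N * K)%:R).
under eq_bigr => j _ do rewrite -addnS -/(u _) -/(u _).
rewrite -(big_mkord xpredT (fun j => u j.+1 - u j)) telescope_sumr// /u addn0.
congr (psi _ - psi _).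
  rewrite -mulSnr !natrM; field; exact/andP.
by rewrite !natrM; field; exact/andP.
Qed.

Lemma cdf_refine N K a x : (0 < N)%N -> (0 < K)%N ->
  cdf (N * K) (fun s => a (s %/ K)%N) x = cdf N a x.
Proof. exact: stieltjes_sum_refine. Qed.

Lemma self_conv_refine N K a x : (0 < N)%N -> (0 < K)%N ->
  self_conv (N * K) (fun s => a (s %/ K)%N) x = self_conv N a x.
Proof.
move=> N0 K0; rewrite /self_conv stieltjes_sum_refine//.
by congr stieltjes_sum; apply/funext => y; rewrite cdf_refine.
Qed.

Lemma stieltjes_sumBl N a b psi :
  stieltjes_sum N (fun s => a s - b s) psi = stieltjes_sum N a psi - stieltjes_sum N b psi.
Proof. by rewrite -sumrB/=; apply: eq_bigr => s _; rewrite mulrBl. Qed.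

Lemma stieltjes_sumBr N a psi psi' :
  stieltjes_sum N a (fun y => psi y - psi' y) = stieltjes_sum N a psi - stieltjes_sum N a psi'.
Proof. by rewrite -sumrB/=; apply: eq_bigr => s _; rewrite -mulrBr; congr (_ * _); ring. Qed.

Lemma telescope_grid N psi : (0 < N)%N ->
  \sum_(s < N) (psi (s.+1%:R / N%:R) - psi (s%:R / N%:R)) = psi 1 - psi 0.
Proof.
move=> N0; rewrite -(big_mkord xpredT
  (fun s => psi (s.+1%:R / N%:R) - psi (s%:R / N%:R))).
rewrite (@telescope_sumr _ 0 N (fun s => psi (s%:R / N%:R)))//.
by rewrite mul0r divff// pnatr_eq0 -lt0n.
Qed.

Lemma norm_stieltjes_sum N a (C : R) psi : (0 < N)%N ->
  (forall s, (s < N)%N -> `|a s| <= C) -> {homo psi : x y / x <= y} ->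
  `|stieltjes_sum N a psi| <= C * (psi 1 - psi 0).
Proof.
move=> N0 aC hpsi; apply: le_trans (ler_norm_sum _ _ _) _.
rewrite -(telescope_grid N)// mulr_sumr; apply: ler_sum => s _.
have h : 0 <= psi (s.+1%:R / N%:R) - psi (s%:R / N%:R).
  by rewrite subr_ge0 hpsi// ler_wpM2r// ler_nat.
by rewrite normrM (ger0_norm h) ler_wpM2r// aC.
Qed.

Lemma stieltjes_sum_ge0 N a psi : (forall s, (s < N)%N -> 0 <= a s) ->
  {homo psi : x y / x <= y} -> 0 <= stieltjes_sum N a psi.
Proof.
move=> a0 hpsi; apply: sumr_ge0 => s _; rewrite mulr_ge0 ?a0//.
by rewrite subr_ge0 hpsi// ler_wpM2r// ler_nat.
Qed.

(** The function is the length of the part of []x, y]] to the left of [z]; pairing it with a density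
    gives the mass of []x, y]]. *)
Lemma homo_minB (x y : R) : x <= y -> {homo (fun z : R => Num.min z y - Num.min z x) : u v / u <= v}.
Proof. by move=> xy u v uv; rewrite /Num.min; do 4 case: ifPn; rewrite -?leNgt => *; lra. Qed.

Lemma minB_le (x y : R) : x <= y ->
  (Num.min 1 y - Num.min 1 x) - (Num.min 0 y - Num.min 0 x) <= y - x.
Proof. by move=> xy; rewrite /Num.min; do 4 case: ifPn; rewrite -?leNgt => *; lra. Qed.

Lemma cdfBE N a x y : cdf N a y - cdf N a x =
  stieltjes_sum N a (fun z => Num.min z y - Num.min z x).
Proof. by rewrite stieltjes_sumBr. Qed.

Lemma cdf_lipschitz N a (C : R) x y : (0 < N)%N -> (forall s, (s < N)%N -> `|a s| <= C) ->
  x <= y -> `|cdf N a y - cdf N a x| <= C * (y - x).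
Proof.
move=> N0 aC xy; rewrite cdfBE.
apply: le_trans (norm_stieltjes_sum _ _ _ _ N0 aC (homo_minB _ _ xy)) _.
rewrite ler_wpM2l ?minB_le//.
by apply: le_trans (aC 0%N N0).
Qed.

Lemma cdf_homo N a : (forall s, (s < N)%N -> 0 <= a s) -> {homo cdf N a : x y / x <= y}.
Proof.
by move=> a0 x y xy; rewrite -subr_ge0 cdfBE stieltjes_sum_ge0//; exact: homo_minB.
Qed.

Lemma cdf_le_compat N a b (k : R) x y : (forall s, (s < N)%N -> a s <= k * b s) -> x <= y ->
  cdf N a y - cdf N a x <= k * (cdf N b y - cdf N b x).
Proof.
move=> ab xy; rewrite !cdfBE /stieltjes_sum mulr_sumr; apply: ler_sum => s _.
rewrite mulrA ler_wpM2r ?ab//.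
by rewrite subr_ge0 (homo_minB _ _ xy)// ler_wpM2r// ler_nat.
Qed.

Lemma cdf_le0 N a x : x <= 0 -> cdf N a x = 0.
Proof.
move=> x0; rewrite /cdf /stieltjes_sum big1// => s _.
have h (n : nat) : x <= n%:R / N%:R by rewrite (le_trans x0)// divr_ge0.
by rewrite !min_r// subrr mulr0.
Qed.

Lemma cdf_ge1 N a x : (0 < N)%N -> 1 <= x -> cdf N a x = (\sum_(s < N) a s) / N%:R.
Proof.
move=> N0 x1; rewrite /cdf /stieltjes_sum mulr_suml; apply: eq_bigr => s _.
have h (n : nat) : (n <= N)%N -> n%:R / N%:R <= x.
  by move=> nN; rewrite (le_trans _ x1)// ler_pdivrMr ?ltr0n// mul1r ler_nat.
rewrite !min_l ?h//; last exact: ltnW.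
by rewrite -mulrBl -natrB// subSnn mul1r.
Qed.

Lemma sum_ord_widen (f : nat -> R) n M : (n <= M)%N -> (forall s, (n <= s)%N -> f s = 0) ->
  \sum_(s < n) f s = \sum_(s < M) f s.
Proof.
move=> nM f0; rewrite (big_ord_widen_cond M xpredT f nM) big_mkcond.
by apply: eq_bigr => s _; rewrite /=; case: ltnP => // /f0 ->.
Qed.

Lemma cdf_grid N a n : (0 < N)%N -> (forall s, (N <= s)%N -> a s = 0) ->
  cdf N a (n%:R / N%:R) = (\sum_(s < n) a s) / N%:R.
Proof.
move=> N0 aN; have Npos : 0 < N%:R^-1 :> R by rewrite invr_gt0 ltr0n.
rewrite /cdf /stieltjes_sum.
have -> : \sum_(s < N) a s * (Num.min (s.+1%:R / N%:R) (n%:R / N%:R) -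
    Num.min (s%:R / N%:R) (n%:R / N%:R)) = \sum_(s < N) (if (s < n)%N then a s / N%:R else 0).
  apply: eq_bigr => s _; case: ltnP => sn.
    rewrite !min_l ?ler_pM2r// ?ler_nat//; last exact: ltnW.
    by rewrite -mulrBl -natrB// subSnn mul1r.
  rewrite !min_r ?ler_pM2r// ?ler_nat//; last exact: leqW.
  by rewrite subrr mulr0.
pose f s := if (s < n)%N then a s / N%:R else 0.
rewrite (sum_ord_widen f N (N + n)%N) ?leq_addr//; last first.
  by move=> s Ns; rewrite /f aN// mul0r if_same.
rewrite -(sum_ord_widen f n (N + n)%N) ?leq_addl//; last first.
  by move=> s ns; rewrite /f ltnNge ns.
by rewrite mulr_suml; apply: eq_bigr => s _; rewrite /f ltn_ord.
Qed.

(** The indicators of the cells [s] and [m - s] convolve to a tent of height [1 / N] with its peak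
    at [(m + 1) / N], zero at all other grid points. This explains the shift between the point and
    the index. *)
Lemma self_conv_grid N a m : (0 < N)%N -> (forall s, (N <= s)%N -> a s = 0) ->
  self_conv N a (m.+1%:R / N%:R) = (\sum_(s < m.+1) a s * a (m - s)%N) / N%:R.
Proof.
move=> N0 aN; rewrite /self_conv /stieltjes_sum.
have N0' : N%:R != 0 :> R by rewrite pnatr_eq0 -lt0n.
pose f s := a s * (if (s <= m)%N then a (m - s)%N / N%:R else 0).
have -> : \sum_(s < N) a s * (- cdf N a (m.+1%:R / N%:R - s.+1%:R / N%:R) -
    - cdf N a (m.+1%:R / N%:R - s%:R / N%:R)) = \sum_(s < N) f s.
  apply: eq_bigr => s _; rewrite /f; congr (_ * _).
  rewrite opprK addrC -!mulrBl; case: leqP => sm.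
    rewrite -!natrB ?(leqW sm)//.
    rewrite !cdf_grid// subSn// big_ord_recr/= subSS -mulrBl addrAC subrr add0r//.
  rewrite !cdf_le0 ?subrr//.
  - by rewrite pmulr_lle0 ?invr_gt0 ?ltr0n// subr_le0 ler_nat ltnS ltnW.
  - by rewrite pmulr_lle0 ?invr_gt0 ?ltr0n// subr_le0 ler_nat.
have fN s : (N <= s)%N -> f s = 0 by move=> Ns; rewrite /f aN// mul0r.
have fm s : (m < s)%N -> f s = 0 by move=> ms; rewrite /f leqNgt ms/= mulr0.
rewrite (sum_ord_widen f N (N + m.+1)%N) ?leq_addr// -(sum_ord_widen f m.+1 (N + m.+1)%N) ?leq_addl//.
rewrite mulr_suml; apply: eq_bigr => s _.
by rewrite /f -ltnS ltn_ord mulrA.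
Qed.

Lemma self_conv_le0 N a x : (0 < N)%N -> x <= 0 -> self_conv N a x = 0.
Proof.
move=> N0 x0; rewrite /self_conv /stieltjes_sum big1// => s _.
have h (n : nat) : x - n%:R / N%:R <= 0.
  by rewrite subr_le0 (le_trans x0)// divr_ge0.
by rewrite !cdf_le0// subrr mulr0.
Qed.

(** Cells are indexed by all integers, so that the property covers the whole line. Self-convolutions
    of step densities have it, and their grid values then control them everywhere. *)
Definition piecewise_affine N (f : R -> R) := forall (n : int) (t : R), 0 <= t <= 1 ->
  f ((n%:~R + t) / N%:R) = (1 - t) * f (n%:~R / N%:R) + t * f ((n + 1)%:~R / N%:R).

Lemma piecewise_affine_min N (s : nat) : (0 < N)%N ->
  piecewise_affine N (fun x => Num.min (s%:R / N%:R) x).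
Proof.
move=> N0 n t /andP[t0 t1]; have Npos : 0 < N%:R^-1 :> R by rewrite invr_gt0 ltr0n.
rewrite -!minr_pMl ?(ltW Npos)// !mulrA -mulrDl; congr (_ * _).
have sE : s%:R = (s%:Z)%:~R :> R by [].
have [sn|ns] := lerP s%:Z n.
  have h : s%:R <= n%:~R :> R by rewrite sE ler_int.
  rewrite !min_l//; first by ring.
  - by rewrite intrD; lra.
  - lra.
have h : (n + 1)%:~R <= s%:R :> R by rewrite sE ler_int lezD1.
rewrite intrD in h *.
by rewrite !min_r//; [ring|lra|lra].
Qed.

Lemma piecewise_affine_sum N (I : finType) (f : I -> R -> R) :
  (forall i, piecewise_affine N (f i)) -> piecewise_affine N (fun x => \sum_i f i x).
Proof.
move=> hf n t t01; rewrite !mulr_sumr -big_split/=.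
by apply: eq_bigr => i _; exact: hf.
Qed.

Lemma piecewise_affine_shift N f (s : nat) :
  piecewise_affine N f -> piecewise_affine N (fun x => f (x - s%:R / N%:R)).
Proof.
move=> hf n t t01; rewrite -!mulrBl.
have := hf (n - s%:Z) t t01; rewrite !intrD !intrN.
by rewrite [_ + t]addrAC [_ + 1%:~R]addrAC.
Qed.

Lemma piecewise_affineZ N k f : piecewise_affine N f -> piecewise_affine N (fun x => k * f x).
Proof. by move=> hf n t t01; rewrite hf//; ring. Qed.

Lemma piecewise_affineN N f : piecewise_affine N f -> piecewise_affine N (fun x => - f x).
Proof. by move=> hf n t t01; rewrite hf//; ring. Qed.

Lemma piecewise_affineB N f g : piecewise_affine N f -> piecewise_affine N g ->
  piecewise_affine N (fun x => f x - g x).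
Proof. by move=> hf hg n t t01; rewrite hf// hg//; ring. Qed.

Lemma piecewise_affine_cdf N a : (0 < N)%N -> piecewise_affine N (cdf N a).
Proof.
move=> N0; apply: piecewise_affine_sum => s; apply: piecewise_affineZ.
by apply: piecewise_affineB; exact: piecewise_affine_min.
Qed.

Lemma piecewise_affine_self_conv N a : (0 < N)%N -> piecewise_affine N (self_conv N a).
Proof.
move=> N0; apply: piecewise_affine_sum => s; apply: piecewise_affineZ.
have h (m : nat) : piecewise_affine N (fun x => - cdf N a (x - m%:R / N%:R)).
  have := piecewise_affine_shift _ _ m (piecewise_affine_cdf _ a N0).
  exact: piecewise_affineN.
by apply: piecewise_affineB; exact: h.
Qed.

Lemma grid_cell N (x : R) : (0 < N)%N ->
  exists (n : int) (t : R), 0 <= t < 1 /\ x = (n%:~R + t) / N%:R.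
Proof.
move=> N0; exists (Num.floor (x * N%:R)), (x * N%:R - (Num.floor (x * N%:R))%:~R); split.
  have := floor_le (x * N%:R); have := floorD1_gt (x * N%:R); rewrite intrD => h1 h2.
  by apply/andP; split; lra.
by rewrite addrC subrK mulfK// pnatr_eq0 -lt0n.
Qed.

Lemma piecewise_affine_bound N f (E : R) : (0 < N)%N -> piecewise_affine N f ->
  (forall n : int, `|f (n%:~R / N%:R)| <= E) -> forall x, `|f x| <= E.
Proof.
move=> N0 hf fE x; have [n [t [/andP[t0 t1] ->]]] := grid_cell _ x N0.
rewrite hf; last by rewrite t0 ltW.
apply: le_trans (ler_normD _ _) _; rewrite !normrM.
rewrite (ger0_norm t0) (@ger0_norm _ (1 - t)); last by rewrite subr_ge0 ltW.
have t1' : 0 <= 1 - t by rewrite subr_ge0 ltW.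
have := ler_wpM2l t0 (fE (n + 1)); have := ler_wpM2l t1' (fE n). lra.
Qed.

(** At most one grid point lies strictly between [x] and [y], and the slope on each cell is at most
    [2 * E * N]. *)
Lemma piecewise_affine_lip N f (E : R) x y : (0 < N)%N -> piecewise_affine N f ->
  (forall n : int, `|f (n%:~R / N%:R)| <= E) -> x <= y ->
  y - x <= N%:R^-1 -> `|f y - f x| <= 2 * E * N%:R * (y - x).
Proof.
move=> N0 hf fE xy yx; have Npos : 0 < N%:R :> R by rewrite ltr0n.
have cell (n : int) (t u : R) : 0 <= t -> t <= u -> u <= 1 ->
    `|f ((n%:~R + u) / N%:R) - f ((n%:~R + t) / N%:R)| <= 2 * E * (u - t).
  move=> t0 tu u1.
  rewrite !hf; last 2 first.
    by apply/andP; split; lra.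
    by apply/andP; split; lra.
  rewrite [X in `|X|](_ : _ = (u - t) * (f ((n + 1)%:~R / N%:R) - f (n%:~R / N%:R))); last by ring.
  rewrite normrM (@ger0_norm _ (u - t)) ?subr_ge0// mulrC ler_wpM2r ?subr_ge0//.
  apply: le_trans (ler_normB _ _) _; have := fE n; have := fE (n + 1); lra.
have [n [t [/andP[t0 t1] xE]]] := grid_cell _ x N0.
pose u := y * N%:R - n%:~R.
have yE : y = (n%:~R + u) / N%:R by rewrite /u addrC subrK mulfK// gt_eqF.
have xN : x * N%:R = n%:~R + t by rewrite xE mulfVK// gt_eqF.
have tu : t <= u.
  by have := ler_wpM2r (ltW Npos) xy; rewrite xN /u; lra.
have ut : u - t <= 1.
  have := ler_wpM2r (ltW Npos) yx; rewrite mulVf ?gt_eqF// mulrBl xN /u; lra.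
have -> : 2 * E * N%:R * (y - x) = 2 * E * (u - t).
  by rewrite /u -(mulrA _ N%:R) (mulrC N%:R) mulrBl xN; ring.
have [u1|u1] := lerP u 1; first by rewrite xE yE cell.
have yE' : y = ((n + 1)%:~R + (u - 1)) / N%:R by rewrite yE intrD; congr (_ / _); ring.
rewrite -(subrK (f ((n + 1)%:~R / N%:R)) (f y)) -addrA.
apply: le_trans (ler_normD _ _) _.
have := cell n t 1 t0 (ltW t1) (lexx _); rewrite -xE -(intrD _ n 1) => h1.
have := cell (n + 1) 0 (u - 1) (lexx _); rewrite -yE' addr0 => h2.
have := h2 _ _; rewrite subr_ge0 (ltW u1) => /(_ isT) h3.

have u11 : u - 1 <= 1 by lra.
by have := h3 u11; lra.
Qed.

End step_densities.

(** * The tests of one refinement step *)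

Section random_step.
Context {R : realType}.

Lemma sqrt_le_sqr (x y : R) : 0 <= y -> x <= y ^+ 2 -> Num.sqrt x <= y.
Proof. by move=> y0 xy; rewrite -[leRHS]ger0_norm// -sqrtr_sqr ler_wsqrtr. Qed.

(** Both signs of a test together bound an absolute value. In use, [th] is the scale that keeps the
    coefficients below [p] and balances [L / th] against the variance term, which grows linearly in
    [th]. *)
Lemma two_sided_test (th p L A : R) N (x eta : nat -> R) : 0 < th -> 0 < p ->
  (forall sg : bool, \sum_(t < N) ((-1) ^+ sg * (th * x t)) * eta t <=
     L + 2 / p * \sum_(t < N) ((-1) ^+ sg * (th * x t)) ^+ 2) ->
  \sum_(t < N) (th * x t) ^+ 2 <= A ->
  `|\sum_(t < N) x t * eta t| <= (L + 2 / p * A) / th.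
Proof.
move=> th0 p0 H HA; rewrite ler_pdivlMr// -[X in _ * X](gtr0_norm th0) -normrM ler_norml.
have p2 : 0 <= 2 / p by rewrite divr_ge0// ltW.
have sq (sg : bool) : \sum_(t < N) ((-1) ^+ sg * (th * x t)) ^+ 2 = \sum_(t < N) (th * x t) ^+ 2.
  by apply: eq_bigr => t _; rewrite exprMn sqrr_sign mul1r.
have lin (sg : bool) : \sum_(t < N) ((-1) ^+ sg * (th * x t)) * eta t
    = (-1) ^+ sg * (\sum_(t < N) x t * eta t * th).
  by rewrite mulr_sumr; apply: eq_bigr => t _; ring.
have := H true; have := H false; rewrite !sq !lin expr0 expr1 mul1r mulN1r mulr_suml.
have h := ler_wpM2l p2 HA.
by move=> h1 h2; apply/andP; split; lra.
Qed.

Lemma sum_ord_itv (F : nat -> R) i j N : (i <= j <= N)%N ->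
  \sum_(s < N) (if (i <= s < j)%N then F s else 0) = \sum_(i <= s < j) F s.
Proof.
move=> /andP[ij jN].
rewrite -(big_mkord xpredT (fun s => if (i <= s < j)%N then F s else 0)).
rewrite (big_cat_nat (leq0n i) (leq_trans ij jN))/= (big_cat_nat ij jN)/=.
rewrite big_nat_cond big1 ?add0r; last first.
  by move=> s; rewrite andbT leq0n/= => si; rewrite leqNgt si.
rewrite [X in _ + X]big_nat_cond [X in _ + X]big1 ?addr0; last first.
  by move=> s; rewrite andbT => /andP[js _]; rewrite (ltnNge s) js andbF.
by apply: eq_big_nat => s ->.
Qed.

(** The map [t |-> m - t] is injective on [t <= m], and the condition [m - t < t] keeps its values
    below [N]. This bounds the variance of the quadratic tests. *)
Lemma sum_reflect_le N m (f : nat -> R) : (forall s, 0 <= f s) ->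
  \sum_(t < N) (if (m - t < t)%N && (t <= m)%N then f (m - t)%N else 0) <= \sum_(s < N) f s.
Proof.
move=> f0.
pose g s := if (s < N)%N then f s else 0.
have g0 s : 0 <= g s by rewrite /g; case: ifP.
pose F t := if (t <= m)%N && (t < N)%N then g (m - t)%N else 0.
have gN s : (N <= s)%N -> g s = 0 by move=> Ns; rewrite /g ltnNge Ns.
apply: (@le_trans _ _ (\sum_(t < N) F t)).
  apply: ler_sum => t _; rewrite /F ltn_ord andbT; case: (leqP t m) => tm; last by rewrite andbF.
  rewrite andbT; case: ifP => // mt; rewrite /g ifT//.
  exact: ltn_trans mt (ltn_ord t).
have -> : \sum_(s < N) f s = \sum_(s < N) g s.
  by apply: eq_bigr => s _; rewrite /g ltn_ord.
rewrite (sum_ord_widen g N (m.+1 + N)%N) ?leq_addl//.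
rewrite (sum_ord_widen F N (m.+1 + N)%N) ?leq_addl//; last first.
  by move=> s Ns; rewrite /F (ltnNge s) Ns andbF.
rewrite -(sum_ord_widen F m.+1 (m.+1 + N)%N) ?leq_addr//; last first.
  by move=> s ms; rewrite /F leqNgt ms.
apply: (@le_trans _ _ (\sum_(t < m.+1) g t)).
  rewrite [leRHS](reindex_inj rev_ord_inj)/=; apply: ler_sum => t _.
  rewrite /F -ltnS ltn_ord/= subSS; case: ifP => // _.
rewrite big_split_ord/= lerDl sumr_ge0//.
Qed.

(* Folding the sum along the involution [s |-> m - s]; only the fixed point [m / 2] is not paired. *)
Lemma sum_symmetric_le m (x : nat -> R) C : (forall s, (s <= m)%N -> x (m - s)%N = x s) ->
  (forall s, `|x s| <= C) ->
  `|\sum_(s < m.+1) x s| <= 2 * `|\sum_(s < m.+1) (if (m - s < s)%N then x s else 0)| + C.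
Proof.
move=> xs xC.
pose u s := if (m - s < s)%N then x s else 0.
pose v s := if (s < m - s)%N then x s else 0.
pose w s := if (s == m - s)%N then x s else 0.
have -> : \sum_(s < m.+1) x s = \sum_(s < m.+1) u s + \sum_(s < m.+1) v s + \sum_(s < m.+1) w s.
  rewrite -!big_split/=; apply: eq_bigr => s _; rewrite /u /v /w.
  by case: (ltngtP s (m - s)%N) => _; rewrite ?addr0 ?add0r.
have -> : \sum_(s < m.+1) v s = \sum_(s < m.+1) u s.
  rewrite (reindex_inj rev_ord_inj)/=; apply: eq_bigr => s _.
  have sm : (s <= m)%N by rewrite -ltnS.
  by rewrite /v /u subSS subKn// xs.
apply: le_trans (ler_normD _ _) _; apply: lerD.
  by rewrite mulr_natl mulr2n; exact: ler_normD.
apply: le_trans (ler_norm_sum _ _ _) _.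
have C0 : 0 <= C := le_trans (normr_ge0 _) (xC 0%N).
have hm : (m./2 < m.+1)%N by rewrite ltnS -{2}[m]odd_double_half -addnn addnA leq_addl.
rewrite (bigD1 (Ordinal hm))//= big1 ?addr0; last first.
  move=> s sm; rewrite /w; case: eqP => [e|]; last by rewrite normr0.
  case/negP: sm; apply/eqP/val_inj => /=.
  have sm : (s <= m)%N by rewrite -ltnS.
  have e' : (s + s)%N = m by rewrite {2}e subnKC.
  by rewrite -[X in _ = X./2]e' addnn doubleK.
by rewrite /w; case: ifP; rewrite ?normr0.
Qed.

(** The summands count, with both signs, the cosine and sine sums at [N ^ 3] frequencies, the pairs
    of grid points, the linear and the quadratic part of [2 N] convolution values, and finally the
    single test for the number of kept cells. *)
Lemma test_count N : (0 < N)%N ->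
  (2 * 2 * N ^ 3 + 2 * N.+1 * N.+1 + 2 * (2 * N) + 2 * (2 * N) + 1 <= 30 * N ^ 3)%N.
Proof.
move=> N0; have h2 : (N * N <= N ^ 3)%N by rewrite mulnn leq_pexp2l.
have h1 : (N <= N * N)%N by rewrite leq_pmulr.
by move: h2 h1; move: (N ^ 3)%N => M; lia.
Qed.

(** [1 + eta s] is [1 / p] for a kept cell and [0] for a deleted one. In the convolution,
    [(1 + eta s) * (1 + eta (m - s)) - 1] gives two equal linear sums and a quadratic one. The
    parameter [k] of the interval bound trades a constant error for one proportional to the
    length. *)
Lemma random_step (N : nat) (b : nat -> R) (B p L k : R) :
  (0 < N)%N -> (forall s, 0 <= b s <= B) -> (forall s, (N <= s)%N -> b s = 0) ->
  1 <= B -> 0 < p < 1 -> 1 <= L -> L <= p ^+ 2 * N%:R -> 0 < k <= 1 ->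
  (30 * N ^ 3)%:R <= expR L ->
  exists eta : nat -> R, (forall s, eta s = p^-1 - 1 \/ eta s = -1) /\ [/\
    forall i : nat, (i < N ^ 3)%N ->
      `|\sum_(s < N) b s * cos (s%:R * (2 * pi * i%:R / (N ^ 3)%:R)) * eta s|
        <= 3 * B * Num.sqrt (N%:R * L / p) /\
      `|\sum_(s < N) b s * sin (s%:R * (2 * pi * i%:R / (N ^ 3)%:R)) * eta s|
        <= 3 * B * Num.sqrt (N%:R * L / p),
    forall i j : nat, (i <= j <= N)%N ->
      `|\sum_(s < N) (if (i <= s < j)%N then b s else 0) * eta s|
       <= B * L / (p * k) + 2 * k * B * (j - i)%:R,
    \sum_(s < N) eta s <= 3 * N%:R &
    forall m : nat,
      `|\sum_(s < m.+1) b s * (1 + eta s) * (b (m - s)%N * (1 + eta (m - s)%N))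
        - \sum_(s < m.+1) b s * b (m - s)%N| <= 29 * B ^+ 2 * (Num.sqrt (N%:R * L) / p)].
Proof.
move=> N0 bB bN B1 p01 L1 LpN /andP[k0 k1] JL; have /andP[p0 p1] := p01.
have Npos : 0 < N%:R :> R by rewrite ltr0n.
have B0 : 0 < B by lra. have L0 : 0 < L by lra.
have LpN' : L <= p * N%:R.
  apply: (le_trans LpN); rewrite ler_wpM2r ?ltW// expr2; nra.
(* For [th1] and [th4] the coefficients are at most [sqrt (p L / N) <= p] and their squares sum to
   at most [p L], which gives [3 L / th]. The scale [th5] is smaller than [th4] by the factor
   [sqrt p], to compensate for the extra factor [eta (m - s)]. *)
pose th1 := Num.sqrt (p * L / N%:R) / B.
pose th4 := Num.sqrt (p * L / N%:R) / B ^+ 2.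
pose th2 := p * k / B.
pose th5 := p * Num.sqrt (L / N%:R) / B ^+ 2.
have q0 : 0 < p * L / N%:R by rewrite divr_gt0// mulr_gt0.
have q5 : 0 < L / N%:R by rewrite divr_gt0.
have s0 : 0 < Num.sqrt (p * L / N%:R) by rewrite sqrtr_gt0.
have s5 : 0 < Num.sqrt (L / N%:R) by rewrite sqrtr_gt0.
have B20 : 0 < B ^+ 2 by rewrite exprn_gt0.
have th10 : 0 < th1 by rewrite divr_gt0.
have th40 : 0 < th4 by rewrite divr_gt0.
have th20 : 0 < th2 by rewrite divr_gt0// mulr_gt0.
have th50 : 0 < th5 by rewrite divr_gt0// mulr_gt0.
have sp : Num.sqrt (p * L / N%:R) <= p.
  by apply: sqrt_le_sqr; rewrite ?(ltW p0)// ler_pdivrMr// expr2 -mulrA ler_pM2l.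
have sp5 : Num.sqrt (L / N%:R) <= p.
  by apply: sqrt_le_sqr; rewrite ?(ltW p0)// ler_pdivrMr.
have bn s : `|b s| <= B by rewrite ger0_norm; case/andP: (bB s).
pose J := (bool * bool * 'I_(N ^ 3) + bool * 'I_N.+1 * 'I_N.+1 + bool * 'I_(2 * N)
   + bool * 'I_(2 * N) + unit)%type.
pose x1 cs (i s : nat) := b s * (if cs then cos else sin) (s%:R * (2 * pi * i%:R / (N ^ 3)%:R)).
pose x2 (i j s : nat) := if (i <= s < j)%N then b s else 0.
pose x4 (m s : nat) := if (s <= m)%N then b s * b (m - s)%N else 0.
(* The condition [m - s < s] makes the coefficient predictable: [eta (m - s)] is chosen before
   [eta s]. *)
pose x5 (m : nat) (eta : nat -> R) (s : nat) :=
  if (m - s < s)%N && (s <= m)%N then b s * b (m - s)%N * eta (m - s)%N else 0.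
pose c (j : J) (t : nat) (eta : nat -> R) : R := match j with
 | inl (inl (inl (inl (sg, cs, i)))) => (-1) ^+ sg * (th1 * x1 cs i t)
 | inl (inl (inl (inr (sg, i, j)))) => (-1) ^+ sg * (th2 * x2 i j t)
 | inl (inl (inr (sg, m))) => (-1) ^+ sg * (th4 * x4 m t)
 | inl (inr (sg, m)) => (-1) ^+ sg * (th5 * x5 m eta t)
 | inr tt => p
 end.
have x1b cs i s : `|x1 cs i s| <= B.
  rewrite /x1 normrM -[leRHS]mulr1 ler_pM//.
  by case: cs; [exact: cos_max|exact: sin_max].
have x2b i j s : `|x2 i j s| <= B by rewrite /x2; case: ifP => // _; rewrite normr0 ltW.
have x4b m s : `|x4 m s| <= B ^+ 2.
  by rewrite /x4; case: ifP => _; [rewrite normrM expr2 ler_pM|rewrite normr0 ltW].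
have sqb (x y : R) : `|x| <= y -> x ^+ 2 <= y ^+ 2.
  by move=> xy; rewrite -real_normK ?num_real// lerXn2r// nnegrE// (le_trans _ xy).
have etab (eta : nat -> R) s : (forall s, eta s = p^-1 - 1 \/ eta s = -1) -> `|eta s| <= p^-1.
  have pV : 1 <= p^-1 by rewrite invf_ge1// ltW.
  move=> /(_ s)[] ->; first by rewrite ger0_norm ?subr_ge0// lerBlDr lerDl.
  by rewrite normrN1.
have x5b m eta s : (forall s, eta s = p^-1 - 1 \/ eta s = -1) -> `|x5 m eta s| <= B ^+ 2 / p.
  move=> eta2; rewrite /x5; case: ifP => _; last by rewrite normr0 divr_ge0// ltW.
  by rewrite !normrM ler_pM//; [rewrite expr2 ler_pM|exact: etab].
have [|||eta [eta2 H]] := greedy_concentration J p L c N p01.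
- apply: le_trans JL; rewrite ler_nat /J !card_sum !card_prod !card_bool !card_ord card_unit.
  exact: test_count.
- move=> [[[[[[sg cs] i]|[[sg i] j]]|[sg m]]|[sg m]]|[]] t eta eta' e//=.
  by rewrite /x5; case: ifP => // /andP[mt _]; rewrite e.
- move=> j t eta eta2; have sgn (sg : bool) (z : R) : `|(-1) ^+ sg * z| = `|z|.
    by rewrite normrM normrX normrN1 expr1n mul1r.
  case: j => [[[[[[sg cs] i]|[[sg i] j]]|[sg m]]|[sg m]]|[]] /=; rewrite ?sgn.
  + rewrite (normrM th1) (gtr0_norm th10); apply: le_trans sp; rewrite /th1 -(mulrA (Num.sqrt _)) ger_pMr//.
    by rewrite mulrC ler_pdivrMr// mul1r.
  + rewrite (normrM th2) (gtr0_norm th20) /th2; apply: (@le_trans _ _ (p * k)); last by nra.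
    rewrite -(mulrA (p * k)) ger_pMr ?mulr_gt0//.
    by rewrite mulrC ler_pdivrMr// mul1r.
  + rewrite (normrM th4) (gtr0_norm th40); apply: le_trans sp; rewrite /th4 -(mulrA (Num.sqrt _)) ger_pMr//.
    by rewrite mulrC ler_pdivrMr// mul1r.
  + rewrite (normrM th5) (gtr0_norm th50); apply: le_trans sp5; rewrite /th5.
    apply: (@le_trans _ _ (p * Num.sqrt (L / N%:R) / B ^+ 2 * (B ^+ 2 / p))).
      by rewrite ler_wpM2l ?x5b// ltW.
    by rewrite le_eqVlt; apply/orP; left; apply/eqP; field; rewrite !gt_eqF.
  + by rewrite gtr0_norm.
exists eta; split => //.
have thsq1 : (th1 * B) ^+ 2 = p * L / N%:R.
  by rewrite /th1 mulfVK ?gt_eqF// sqr_sqrtr// ltW.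
have thsq4 : (th4 * B ^+ 2) ^+ 2 = p * L / N%:R.
  by rewrite /th4 mulfVK ?gt_eqF// sqr_sqrtr// ltW.
have NpL : \sum_(t < N) (p * L / N%:R) = p * L.
  by rewrite sumr_const card_ord -[X in X = _]mulr_natr mulfVK ?gt_eqF.
have sq3 : Num.sqrt (p * L / N%:R) * Num.sqrt (N%:R * L / p) = L.
  rewrite -sqrtrM ?(ltW q0)// [X in Num.sqrt X](_ : _ = L ^+ 2); last first.
    by field; rewrite !gt_eqF.
  by rewrite sqrtr_sqr ger0_norm// ltW.
have fin1 : (L + 2 / p * (p * L)) / th1 = 3 * B * Num.sqrt (N%:R * L / p).
  apply: (@mulIf _ th1); rewrite ?gt_eqF// mulfVK ?gt_eqF// /th1.
  rewrite [RHS](_ : _ = 3 * (Num.sqrt (p * L / N%:R) * Num.sqrt (N%:R * L / p))); last first.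
    by field; rewrite gt_eqF.
  by rewrite sq3; field; rewrite gt_eqF.
have fin4 : (L + 2 / p * (p * L)) / th4 = 3 * B ^+ 2 * Num.sqrt (N%:R * L / p).
  apply: (@mulIf _ th4); rewrite ?gt_eqF// mulfVK ?gt_eqF// /th4.
  rewrite [RHS](_ : _ = 3 * (Num.sqrt (p * L / N%:R) * Num.sqrt (N%:R * L / p))); last first.
    by field; rewrite gt_eqF.
  by rewrite sq3; field; rewrite gt_eqF.
have H1 cs i : (i < N ^ 3)%N -> `|\sum_(s < N) x1 cs i s * eta s| <= 3 * B * Num.sqrt (N%:R * L / p).
  move=> iN; rewrite -fin1; apply: two_sided_test => // [sg|].
    exact: (H (inl (inl (inl (inl (sg, cs, Ordinal iN)))))).
  rewrite -NpL -thsq1; apply: ler_sum => t _; apply: sqb.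
  by rewrite (normrM th1) (gtr0_norm th10) ler_wpM2l// ltW.
(* The test with constant coefficient [p] gives [p * \sum eta <= L + 2 p N <= 3 p N]. *)
have H3 : \sum_(s < N) eta s <= 3 * N%:R.
  have h := H (inr tt); rewrite /= -mulr_sumr sumr_const card_ord -(mulr_natr (p ^+ 2)) in h.
  have e : 2 / p * (p ^+ 2 * N%:R) = 2 * (p * N%:R) by field; rewrite gt_eqF.
  by rewrite -(ler_pM2l p0); rewrite e in h; lra.
split => //.
- by move=> i iN; split; [exact: (H1 true)|exact: (H1 false)].
- move=> i j /andP[ij jN].
  have iN1 : (i < N.+1)%N by rewrite ltnS (leq_trans ij).
  have jN1 : (j < N.+1)%N by rewrite ltnS.
  apply: (@le_trans _ _ ((L + 2 / p * (th2 ^+ 2 * B ^+ 2 * (j - i)%:R)) / th2)).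
    apply: (two_sided_test _ _ _ _ N (x2 i j)) => // [sg|].
      exact: (H (inl (inl (inl (inr (sg, Ordinal iN1, Ordinal jN1)))))).
    rewrite mulr_natr -sumr_const_nat -(@sum_ord_itv (fun=> th2 ^+ 2 * B ^+ 2) i j N) ?ij//.
    apply: ler_sum => t _; rewrite exprMn /x2.
    case: ifP => _; last by rewrite expr0n mulr0.
    by rewrite ler_wpM2l ?sqr_ge0// sqb.
  rewrite le_eqVlt; apply/orP; left; apply/eqP; rewrite /th2; field.
  by rewrite !gt_eqF.
- have W0 : 0 <= Num.sqrt (N%:R * L) / p by rewrite divr_ge0// ltW.
  have sNL : Num.sqrt (N%:R * L / p) <= Num.sqrt (N%:R * L) / p.
    apply: sqrt_le_sqr => //; rewrite exprMn sqr_sqrtr ?mulr_ge0 ?ler0n ?(ltW L0)//.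
    rewrite ler_wpM2l ?mulr_ge0 ?ler0n ?(ltW L0)// expr2 ler_peMr ?invr_ge0 ?(ltW p0)//.
    by rewrite invf_ge1// ltW.
  (* The unpaired term [s = m / 2], of size [p ^ (-2)], is absorbed because [1 <= p ^ 2 * N * L]. *)
  have pW : p^-1 ^+ 2 <= Num.sqrt (N%:R * L) / p.
    rewrite expr2 ler_wpM2r ?invr_ge0 ?(ltW p0)// -[leLHS]ger0_norm ?invr_ge0 ?(ltW p0)//.
    rewrite -sqrtr_sqr ler_wsqrtr// exprVn -div1r ler_pdivrMr ?exprn_gt0//; nra.
  move=> m; set W := Num.sqrt (N%:R * L) / p in W0 sNL pW *.
  have BW : 0 <= B ^+ 2 * W by rewrite mulr_ge0// ltW.
  have bb0 s : (2 * N <= m)%N -> b s * b (m - s)%N = 0.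
    move=> Nm; have [sN|Ns] := ltnP s N; last by rewrite bN ?mul0r.
    have Nms : (N <= m - s)%N by clear -Nm sN; lia.
    by rewrite (bN _ Nms) mulr0.
  have lin : `|\sum_(s < m.+1) b s * b (m - s)%N * eta s| <= 3 * B ^+ 2 * W.
    have [mN|Nm] := ltnP m (2 * N); last first.
      rewrite big1 ?normr0 => [|s _]; first by rewrite -mulrA mulr_ge0.
      by rewrite bb0// mul0r.
    have -> : \sum_(s < m.+1) b s * b (m - s)%N * eta s = \sum_(s < N) x4 m s * eta s.
      pose F s := x4 m s * eta s.
      rewrite (sum_ord_widen F N (m.+1 + N)%N) ?leq_addl//; last first.
        by move=> s Ns; rewrite /F /x4 bN// !mul0r if_same mul0r.
      rewrite -(sum_ord_widen F m.+1 (m.+1 + N)%N) ?leq_addr//; last first.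
        by move=> s ms; rewrite /F /x4 (leqNgt s) ms mul0r.
      by apply: eq_bigr => s _; rewrite /F /x4 -(ltnS s) ltn_ord.
    apply: (@le_trans _ _ (3 * B ^+ 2 * Num.sqrt (N%:R * L / p))); last first.
      by rewrite ler_wpM2l// mulr_ge0// ltW.
    rewrite -fin4; apply: two_sided_test => // [sg|].
      exact: (H (inl (inl (inr (sg, Ordinal mN))))).
    rewrite -NpL -thsq4; apply: ler_sum => t _; apply: sqb.
    by rewrite (normrM th4) (gtr0_norm th40) ler_wpM2l// ltW.
  have quad : `|\sum_(s < m.+1) (if (m - s < s)%N then b s * b (m - s)%N * eta (m - s)%N * eta s else 0)|
      <= 11 * B ^+ 2 * W.
    have [mN|Nm] := ltnP m (2 * N); last first.
      rewrite big1 ?normr0 => [|s _]; first by rewrite -mulrA mulr_ge0.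
      by case: ifP => // _; rewrite bb0// !mul0r.
    (* The variance of the quadratic test depends on the choices through the squares of [eta]. These
       are bounded by an affine function of [eta], hence by the counting test [H3]. *)
    have eta5 : \sum_(t < N) eta t ^+ 2 <= 5 * N%:R / p.
      have h s : eta s ^+ 2 <= (eta s + 1) / p + 1.
        case: (eta2 s) => ->; last by rewrite addNr mul0r add0r sqrrN expr1n.
        rewrite subrK; have : 1 <= p^-1 by rewrite invf_ge1// ltW.
        by move: (p^-1) => q q1; rewrite expr2; nra.
      apply: (@le_trans _ _ (\sum_(t < N) ((eta t + 1) / p + 1))).
        by apply: ler_sum => t _; exact: h.
      rewrite big_split/= -mulr_suml big_split/= !sumr_const card_ord.
      have h2 : N%:R <= N%:R / p by rewrite ler_peMr ?invf_ge1 ?ler0n// ltW.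
      have h1 : (\sum_(t < N) eta t + N%:R) / p <= (4 * N%:R) / p.
        by rewrite ler_wpM2r ?invr_ge0 ?(ltW p0)//; lra.
      by move: h1 h2; clear; lra.
    have -> : \sum_(s < m.+1) (if (m - s < s)%N then b s * b (m - s)%N * eta (m - s)%N * eta s else 0)
        = \sum_(s < N) x5 m eta s * eta s.
      pose F s := x5 m eta s * eta s.
      rewrite (sum_ord_widen F N (m.+1 + N)%N) ?leq_addl//; last first.
        by move=> s Ns; rewrite /F /x5 bN// !mul0r if_same mul0r.
      rewrite -(sum_ord_widen F m.+1 (m.+1 + N)%N) ?leq_addr//; last first.
        by move=> s ms; rewrite /F /x5 (leqNgt s) ms andbF mul0r.
      apply: eq_bigr => s _; rewrite /F /x5 -(ltnS s) ltn_ord andbT.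
      by case: ifP => // _; rewrite mul0r.
    have -> : 11 * B ^+ 2 * W = (L + 2 / p * (5 * p * L)) / th5.
      apply: (@mulIf _ th5); rewrite ?gt_eqF// divfK ?gt_eqF// /th5 /W.
      have e5 : Num.sqrt (N%:R * L) * Num.sqrt (L / N%:R) = L.
        rewrite -sqrtrM ?mulr_ge0 ?ler0n ?(ltW L0)//.
        rewrite [X in Num.sqrt X](_ : _ = L ^+ 2); last by field; rewrite gt_eqF.
        by rewrite sqrtr_sqr ger0_norm// ltW.
      rewrite [LHS](_ : _ = 11 * (Num.sqrt (N%:R * L) * Num.sqrt (L / N%:R))); last first.
        by field; rewrite !gt_eqF.
      by rewrite e5; field; rewrite gt_eqF.
    apply: (two_sided_test _ _ _ _ N (x5 m eta)) => // [sg|].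
      exact: (H (inl (inr (sg, Ordinal mN)))).
    apply: (@le_trans _ _ (p ^+ 2 * (L / N%:R) * (5 * N%:R / p))); last first.
      by rewrite le_eqVlt; apply/orP; left; apply/eqP; field; rewrite !gt_eqF.
    have -> : p ^+ 2 * (L / N%:R) = (th5 * B ^+ 2) ^+ 2.
      by rewrite /th5 divfK ?gt_eqF// exprMn sqr_sqrtr// ltW.
    apply: (@le_trans _ _ ((th5 * B ^+ 2) ^+ 2 * \sum_(t < N) eta t ^+ 2)); last first.
      by rewrite ler_wpM2l ?sqr_ge0.
    have := sum_reflect_le N m (fun s => eta s ^+ 2) (fun s => sqr_ge0 _).
    move=> /(ler_wpM2l (sqr_ge0 (th5 * B ^+ 2))); apply: le_trans.
    rewrite mulr_sumr; apply: ler_sum => t _; rewrite /x5; case: ifP => _; last first.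
      by rewrite !mulr0 expr0n.
    rewrite mulrA [leLHS]exprMn ler_wpM2r ?sqr_ge0// sqb//.
    rewrite (normrM th5) (gtr0_norm th50) ler_wpM2l ?(ltW th50)// normrM expr2.
    by rewrite ler_pM.
  pose x s := b s * b (m - s)%N * eta (m - s)%N * eta s.
  have xs s : (s <= m)%N -> x (m - s)%N = x s by move=> sm; rewrite /x subKn//; ring.
  have xC s : `|x s| <= B ^+ 2 * p^-1 ^+ 2.
    rewrite /x -mulrA normrM ler_pM// ?normrM; first by rewrite expr2 ler_pM.
    by rewrite expr2 ler_pM ?etab.
  have := sum_symmetric_le m x _ xs xC => hx.
  have lin' : \sum_(s < m.+1) b s * b (m - s)%N * eta (m - s)%N
      = \sum_(s < m.+1) b s * b (m - s)%N * eta s.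
    rewrite (reindex_inj rev_ord_inj)/=; apply: eq_bigr => s _.
    have sm : (s <= m)%N by rewrite -ltnS.
    by rewrite subSS subKn//; ring.
  rewrite -sumrB [X in `|X|](_ : _ = 2 * (\sum_(s < m.+1) b s * b (m - s)%N * eta s)
      + \sum_(s < m.+1) x s); last first.
    rewrite mulr2n mulrDl mul1r -{2}lin' -!big_split/=.
    by apply: eq_bigr => s _; rewrite /x; ring.
  apply: le_trans (ler_normD _ _) _; rewrite normrM ger0_norm//.
  (* The constant [29] is twice [3] from the linear part, twice [11] from the folded quadratic part,
     and [1] from the unpaired term. *)
  have := ler_wpM2l (ltW B20) pW; move: hx quad lin; rewrite /x; lra.
Qed.

End random_step.

(** * Trigonometric sums and Fourier integrals of step densities *)

Section trig_sums.
Context {R : realType}.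
Implicit Types x y u : R.

Lemma cos_lip x y : `|cos x - cos y| <= `|x - y|.
Proof.
wlog xy : x y / x < y.
  move=> H; have [xy|yx|->] := ltgtP x y; first exact: H.
    by rewrite distrC (distrC x); exact: H.
  by rewrite !subrr.
have [|c _ E] := @MVT R cos (fun z => - sin z) x y xy.
  by apply: continuous_subspaceT => z; exact: continuous_cos.
by rewrite distrC E (distrC x) normrM normrN ler_piMl// sin_max.
Qed.

Lemma sin_lip x y : `|sin x - sin y| <= `|x - y|.
Proof.
rewrite -!cosBpihalf (le_trans (cos_lip _ _))// le_eqVlt; apply/orP; left.
by apply/eqP; congr (`|_|); ring.
Qed.

Lemma cos_periodz x (z : int) : cos (x + z%:~R * (2 * pi)) = cos x.
Proof.
have h y (n : nat) : cos (y + n%:R * (2 * pi)) = cos y.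
  by rewrite mulr_natl [in X in _ + X]mulr_natl (periodicn (@cosD2pi R)).
case: z => n; first exact: h.
by rewrite NegzE mulrNz mulNr -[LHS](h _ n.+1) subrK.
Qed.

Lemma sin_periodz x (z : int) : sin (x + z%:~R * (2 * pi)) = sin x.
Proof. by rewrite -!cosBpihalf addrAC cos_periodz. Qed.

(** A period is at most [8] long and the sums have Lipschitz constant at most [C * N ^ 2] in [u], so
    replacing [u], modulo the period, by the nearest of the [N ^ 3] frequencies below it costs at
    most [8 * C / N]. *)
Lemma trig_sum_bound (N : nat) (c : nat -> R) (A C : R) : (0 < N)%N ->
  (forall s, `|c s| <= C) ->
  (forall i : nat, (i < N ^ 3)%N ->
    `|\sum_(s < N) c s * cos (s%:R * (2 * pi * i%:R / (N ^ 3)%:R))| <= A /\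
    `|\sum_(s < N) c s * sin (s%:R * (2 * pi * i%:R / (N ^ 3)%:R))| <= A) ->
  forall u, `|\sum_(s < N) c s * cos (s%:R * u)| <= A + 8 * C / N%:R /\
    `|\sum_(s < N) c s * sin (s%:R * u)| <= A + 8 * C / N%:R.
Proof.
move=> N0 cC HA u; have Npos : 0 < N%:R :> R by rewrite ltr0n.
have C0 : 0 <= C := le_trans (normr_ge0 _) (cC 0%N).
have pi0 : 0 < pi :> R by exact: pi_gt0.
have pi4 : 2 * pi <= 8 :> R by have := @pihalf_lt2 R; lra.
have M0 : (0 < N ^ 3)%N by rewrite expn_gt0 N0.
set M := (N ^ 3)%N in M0 HA *.
have Mpos : 0 < M%:R :> R by rewrite ltr0n.
pose v := u / (2 * pi); pose z := Num.floor v; pose f := v - z%:~R.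
have f0 : 0 <= f by rewrite subr_ge0 floor_le.
have f1 : f < 1 by have := floorD1_gt v; rewrite intrD /f; lra.
pose i := Num.truncn (f * M%:R).
have fM0 : 0 <= f * M%:R by rewrite mulr_ge0// ltW.
have /andP[i1 i2] := truncn_itv fM0; rewrite -/i in i1 i2.
have iM : (i < M)%N by rewrite -(ltr_nat R) (le_lt_trans i1)// gtr_pMl.
have uE : u = 2 * pi * f + z%:~R * (2 * pi).
  have vE : v * (2 * pi) = u by rewrite /v divfK// gt_eqF// mulr_gt0.
  by rewrite -{1}vE /f; ring.
have close : `|2 * pi * f - 2 * pi * i%:R / M%:R| <= 8 / M%:R.
  have ff : `|f - i%:R / M%:R| <= M%:R^-1.
    rewrite ger0_norm; last by rewrite subr_ge0 ler_pdivrMr.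
    rewrite lerBlDr -(ler_pM2r Mpos) [leRHS]mulrDl mulVf ?gt_eqF// divfK ?gt_eqF//.
    by rewrite addrC -(natrD _ i 1) addn1 ltW.
  rewrite [X in `|X|](_ : _ = 2 * pi * (f - i%:R / M%:R)); last by ring.
  by rewrite normrM ler_pM// ger0_norm// mulr_ge0// ltW.
have su s : s%:R * u = s%:R * (2 * pi * f) + (s%:Z * z)%:~R * (2 * pi).
  by rewrite {1}uE mulrDr intrM -(mulrA (s%:Z)%:~R).
have err (g : R -> R) : (forall x y, `|g x - g y| <= `|x - y|) ->
   `|\sum_(s < N) c s * g (s%:R * (2 * pi * f)) - \sum_(s < N) c s * g (s%:R * (2 * pi * i%:R / M%:R))|
     <= 8 * C / N%:R.
  move=> glip; rewrite -sumrB; apply: le_trans (ler_norm_sum _ _ _) _.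
  apply: (@le_trans _ _ (\sum_(s < N) C * (N%:R * (8 / M%:R)))).
    apply: ler_sum => s _; rewrite -mulrBr normrM ler_pM//.
    apply: le_trans (glip _ _) _; rewrite -mulrBr normrM ler_pM//.
    by rewrite ger0_norm// ler_nat ltnW.
  rewrite sumr_const card_ord -[X in X <= _]mulr_natr /M natrX le_eqVlt; apply/orP; left.
  by apply/eqP; field; rewrite gt_eqF.
have [Ac As] := HA i iM; split.
- under eq_bigr => s _ do rewrite su cos_periodz.
  have := err _ cos_lip; set X := \sum_(s < N) _; set Y := \sum_(s < N) _ in Ac *.
  move=> h; rewrite -(subrK Y X) addrC; apply: le_trans (ler_normD _ _) _.
  exact: lerD.
- under eq_bigr => s _ do rewrite su sin_periodz.
  have := err _ sin_lip; set X := \sum_(s < N) _; set Y := \sum_(s < N) _ in As *.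
  move=> h; rewrite -(subrK Y X) addrC; apply: le_trans (ler_normD _ _) _.
  exact: lerD.
Qed.

(* [sin (2 pi xi x) / (2 pi xi)] and [- cos (2 pi xi x) / (2 pi xi)] are primitives of the two
   components of the character, so these are the Fourier integrals of the step function [c]. *)
Lemma fourier_step_bound (N : nat) (c : nat -> R) (A xi : R) : (0 < N)%N -> xi != 0 ->
  (forall u, `|\sum_(s < N) c s * cos (s%:R * u)| <= A /\
             `|\sum_(s < N) c s * sin (s%:R * u)| <= A) ->
  `|stieltjes_sum N c (fun x => sin (2 * pi * xi * x) / (2 * pi * xi))|
     <= 2 * A * Num.min N%:R^-1 `|xi|^-1 /\
  `|stieltjes_sum N c (fun x => - cos (2 * pi * xi * x) / (2 * pi * xi))|
     <= 2 * A * Num.min N%:R^-1 `|xi|^-1.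
Proof.
move=> N0 xi0 HA; have Npos : 0 < N%:R :> R by rewrite ltr0n.
have pi0 : 0 < pi :> R by exact: pi_gt0.
have pi2 : 2 <= pi :> R by exact: pi_ge2.
have axi : 0 < `|xi| by rewrite normr_gt0.
pose w := 2 * pi * xi; have w0 : w != 0 by rewrite /w !mulf_neq0// gt_eqF.
pose u := w / N%:R.
have [Ac As] := HA u.
have A0 : 0 <= A := le_trans (normr_ge0 _) Ac.
set C := \sum_(s < N) c s * cos _ in Ac; set S := \sum_(s < N) c s * sin _ in As.
have wn : `|w| = 2 * pi * `|xi| by rewrite /w normrM ger0_norm// mulr_ge0// ltW.
(* Up to sign, [P] and [Q] are the real and imaginary parts of [exp (i u) - 1], the factor that
   integration over one cell produces. Bounding them by [|u|] gives the term [1 / N], bounding them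
   by [2] gives [1 / |xi|]. *)
have key (P Q : R) : `|P| <= 2 -> `|P| <= `|u| -> `|Q| <= 2 -> `|Q| <= `|u| ->
    forall X Y : R, `|X| <= A -> `|Y| <= A ->
    `|(P * X + Q * Y) / w| <= 2 * A * Num.min N%:R^-1 `|xi|^-1.
  move=> P2 Pu Q2 Qu X Y XA YA; rewrite normrM normfV wn.
  rewrite ler_pdivrMr ?mulr_gt0// minr_pMr ?mulr_ge0// minr_pMl ?mulr_ge0 ?(ltW axi) ?(ltW pi0)//.
  have PX m : 0 <= m -> `|P| <= m -> `|Q| <= m -> `|P * X + Q * Y| <= 2 * A * m.
    move=> m0 Pm Qm; apply: le_trans (ler_normD _ _) _; rewrite !normrM.
    rewrite [leRHS](_ : _ = m * A + m * A); last by ring.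
    by apply: lerD; apply: ler_pM.
  rewrite le_min; apply/andP; split.
    rewrite -(mulrA (2 * A)) PX//.
    - by rewrite mulr_ge0 ?invr_ge0 ?ler0n// mulr_ge0// mulr_ge0// ltW.
    - by rewrite (le_trans Pu)// /u normrM wn normfV (gtr0_norm Npos) mulrC.
    - by rewrite (le_trans Qu)// /u normrM wn normfV (gtr0_norm Npos) mulrC.
  have e : `|xi|^-1 * (2 * pi * `|xi|) = 2 * pi by field; rewrite gt_eqF.
  by rewrite -(mulrA (2 * A)) e PX//; lra.
have h2 (x y : R) : `|x| <= 1 -> `|y| <= 1 -> `|x - y| <= 2.
  by move=> x1 y1; apply: le_trans (ler_normB _ _) _; lra.
have P1 : `|cos u - 1| <= 2 by rewrite h2 ?cos_max// normr1.
have P1' : `|cos u - 1| <= `|u| by have := cos_lip u 0; rewrite cos0 subr0.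
have Q1 : `|sin u| <= 2 by rewrite (le_trans (sin_max _))//; lra.
have Q1' : `|sin u| <= `|u| by have := sin_lip u 0; rewrite sin0 !subr0.
have arg s : w * (s%:R / N%:R) = s%:R * u by rewrite /u; ring.
have argS (s : nat) : w * (s.+1%:R / N%:R) = s%:R * u + u by rewrite /u -natr1; ring.
rewrite -/w; split.
- have -> : stieltjes_sum N c (fun x => sin (w * x) / w) = ((cos u - 1) * S + sin u * C) / w.
    rewrite /stieltjes_sum mulr_sumr mulr_sumr -big_split/= mulr_suml.
    apply: eq_bigr => s _; rewrite argS arg sinD; ring.
  exact: key.
- have -> : stieltjes_sum N c (fun x => - cos (w * x) / w) = ((- (cos u - 1)) * C + sin u * S) / w.
    rewrite /stieltjes_sum mulr_sumr mulr_sumr -big_split/= mulr_suml.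
    apply: eq_bigr => s _; rewrite argS arg cosD; ring.
  by apply: key; rewrite // normrN.
Qed.

End trig_sums.

(** * Growth comparisons *)

Section eventually.
Context {R : realType}.

Lemma powR_unbounded (C s : R) : 0 < s -> exists n0, forall n, (n0 <= n)%N -> C <= n%:R `^ s.
Proof.
move=> s0; set D := Num.max 1 C.
have D0 : 0 <= D by rewrite le_max ler01.
exists (Num.truncn (D `^ s^-1)).+1 => n hn.
apply: (@le_trans _ _ D); first by rewrite le_max lexx orbT.
have -> : D = (D `^ s^-1) `^ s by rewrite -powRrM mulVf ?gt_eqF// powRr1.
rewrite ge0_ler_powR ?nnegrE ?powR_ge0// ?(ltW s0)//.
apply: (@le_trans _ _ (Num.truncn (D `^ s^-1)).+1%:R); last by rewrite ler_nat.
by have := truncn_itv (powR_ge0 D s^-1); case/andP => _ /ltW.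
Qed.

(** The exponential exceeds its Taylor term of an order [k] with [s * k >= d + 1], and the spare
    power of [n] beats the constant [c * k!]. *)
Lemma expR_powR_unbounded (c s : R) (d : nat) : 0 < s ->
  exists n0, forall n, (n0 <= n)%N -> c * n%:R ^+ d <= expR (n%:R `^ s).
Proof.
move=> s0.
pose k := (Num.truncn (d.+1%:R / s)).+1.
have ks : d.+1%:R <= s * k%:R.
  rewrite mulrC -ler_pdivrMr//.
  have : 0 <= d.+1%:R / s by rewrite divr_ge0// ltW.
  by move=> /truncn_itv /andP[_ /ltW].
have [n0 hn0] := powR_unbounded (c * k`!%:R) 1 ltr01.
exists n0.+1 => n hn.
have n1 : 1 <= n%:R :> R by rewrite ler1n (leq_ltn_trans _ hn).
have e := @expR_ge1Dxn R (n%:R `^ s) k.-1 (powR_ge0 _ _).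
apply: le_trans e; rewrite (_ : k.-1.+1 = k)//.
apply: (@le_trans _ _ ((n%:R `^ s) ^+ k / k`!%:R)); last by rewrite lerDr.
rewrite ler_pdivlMr ?ltr0n ?fact_gt0// mulrAC.
rewrite -[leRHS]powR_mulrn ?powR_ge0// -powRrM.
apply: (@le_trans _ _ (n%:R `^ d.+1%:R)); last by rewrite ler_powR.
rewrite powR_mulrn// exprS ler_wpM2r ?exprn_ge0//.
by rewrite -[leRHS]powRr1// hn0// ltnW.
Qed.

End eventually.

(** * One refinement step with prescribed accuracy *)

Section salem_step.
Context {R : realType}.

Definition density_state (N : nat) (a : nat -> R) :=
  [/\ (0 < N)%N, forall s, 0 <= a s & forall s, (N <= s)%N -> a s = 0].

(** The number [e] is at once the size of the change and the loss in the exponents. Fourier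
    integrals are expressed by primitives of the characters, which excludes [xi = 0]. By
    [refine_nested], an interval of mass zero keeps mass zero. *)
Record salem_refinement (alpha e : R) (N0 : nat) (a0 : nat -> R) (N : nat) (a : nat -> R) : Prop :=
  SalemRefinement {
  refine_state : density_state N a;
  refine_size : (N0 < N)%N;
  refine_count : #|[pred s : 'I_N | a s != 0]|%:R <= 4 * N%:R `^ alpha;
  refine_cdf : forall x y : R, x <= y -> y - x <= 1 ->
    `|(cdf N a y - cdf N a x) - (cdf N0 a0 y - cdf N0 a0 x)| <= e * (y - x) `^ (alpha - e);
  refine_fourier_re : forall xi : R, xi != 0 ->
    `|stieltjes_sum N a (fun x => sin (2 * pi * xi * x) / (2 * pi * xi)) -
      stieltjes_sum N0 a0 (fun x => sin (2 * pi * xi * x) / (2 * pi * xi))|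
     <= e * (1 + `|xi|) `^ (- ((alpha - e) / 2));
  refine_fourier_im : forall xi : R, xi != 0 ->
    `|stieltjes_sum N a (fun x => - cos (2 * pi * xi * x) / (2 * pi * xi)) -
      stieltjes_sum N0 a0 (fun x => - cos (2 * pi * xi * x) / (2 * pi * xi))|
     <= e * (1 + `|xi|) `^ (- ((alpha - e) / 2));
  refine_conv : forall x, `|self_conv N a x - self_conv N0 a0 x| <= e;
  refine_conv_holder : forall x y : R,
    `|(self_conv N a x - self_conv N0 a0 x) - (self_conv N a y - self_conv N0 a0 y)|
     <= e * `|x - y| `^ ((alpha - 1 / 2) / 2);
  refine_nested : exists k : R, forall x y : R, x <= y ->
    cdf N a y - cdf N a x <= k * (cdf N0 a0 y - cdf N0 a0 x) }.

Lemma sqrt_powR (a x : R) : 0 <= a -> Num.sqrt (a `^ x) = a `^ (x / 2).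
Proof. by move=> a0; rewrite -powR12_sqrt ?powR_ge0// -powRrM. Qed.

(** The minimum [m] is written as [m ^ (1 - t) * m ^ t]; the first factor is bounded through
    [m <= 1 / n], the second through [m <= 2 / (1 + |z|)]. *)
Lemma min_interp (n : nat) (z t : R) : (0 < n)%N -> z != 0 -> 0 <= t <= 1 ->
  Num.min n%:R^-1 `|z|^-1 <= 2 * n%:R `^ (t - 1) * (1 + `|z|) `^ (- t).
Proof.
move=> n0 z0 /andP[t0 t1]; set m := Num.min _ _.
have Npos : 0 < n%:R :> R by rewrite ltr0n.
have zpos : 0 < `|z| by rewrite normr_gt0.
have m0 : 0 < m by rewrite lt_min !invr_gt0 Npos zpos.
have mn : m <= n%:R^-1 by rewrite ge_min lexx.
have mz : m <= 2 * (1 + `|z|)^-1.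
  rewrite -div1r mulrA mulr1 ler_pdivlMr ?addr_gt0//.
  have n1 : 1 <= n%:R :> R by rewrite ler1n.
  have h1 : m <= 1 by rewrite (le_trans mn)// invf_le1.
  have h2 : m * `|z| <= 1 by rewrite -ler_pdivlMr// div1r ge_min lexx orbT.
  by rewrite mulrDr mulr1; lra.
have -> : m = m `^ (1 - t) * m `^ t.
  rewrite -powRD; first by rewrite subrK powRr1 // ltW.
  by rewrite subrK oner_eq0.
rewrite [leRHS](_ : _ = n%:R `^ (t - 1) * (2 * (1 + `|z|) `^ (- t))); last by ring.
apply: ler_pM; rewrite ?powR_ge0//.
  have -> : n%:R `^ (t - 1) = n%:R^-1 `^ (1 - t) :> R.
    by rewrite -(powR_inv1 (ltW Npos)) -powRrM mulN1r opprB.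
  by rewrite ge0_ler_powR ?nnegrE ?invr_ge0 ?ler0n ?subr_ge0 ?(ltW m0).
apply: (@le_trans _ _ ((2 * (1 + `|z|)^-1) `^ t)).
  by rewrite ge0_ler_powR ?nnegrE ?(ltW m0)// mulr_ge0// invr_ge0 addr_ge0.
rewrite powRM ?invr_ge0 ?addr_ge0// powRN -(powR_inv1 (_ : 0 <= 1 + `|z|)) ?addr_ge0//.
rewrite -powRrM mulN1r powRN ler_wpM2r ?invr_ge0 ?powR_ge0//.
by rewrite ler1_powR// ler1n.
Qed.

Lemma clip_cases (x : R) : let y : R := Num.max 0 (Num.min 1 x) in
  [\/ x <= 0 /\ y = 0, 0 <= x <= 1 /\ y = x | 1 <= x /\ y = 1].
Proof.
move=> y; rewrite /y; have [x0|x0] := lerP x 0.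
  by constructor 1; rewrite (min_r (le_trans x0 ler01)) max_l.
have [x1|x1] := lerP 1 x; first by constructor 3; rewrite max_r.
by constructor 2; split; [rewrite (ltW x0) (ltW x1)|rewrite max_r// ltW].
Qed.

Lemma cdf_clip N (c : nat -> R) x : (0 < N)%N ->
  cdf N c x = cdf N c (Num.max 0 (Num.min 1 x)).
Proof.
move=> N0; case: (clip_cases x) => [] [h ->] //.
  by rewrite !cdf_le0.
by rewrite !cdf_ge1.
Qed.

(** After clipping to [[0, 1]], rounding [x] and [y] down to the grid costs [C / N] each; at most
    [1 + (y - x) * N] cells lie between the rounded points. *)
Lemma cdf_oscillation N (c : nat -> R) (C G1 G2 x y : R) : (0 < N)%N ->
  (forall s, (N <= s)%N -> c s = 0) -> (forall s, `|c s| <= C) -> 0 <= G2 ->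
  (forall i j : nat, (i <= j <= N)%N -> `|\sum_(i <= s < j) c s| <= G1 + G2 * (j - i)%:R) ->
  x <= y -> `|cdf N c y - cdf N c x| <= (G1 + G2 + 2 * C) / N%:R + G2 * (y - x).
Proof.
move=> N0 cN cC G20 HG xy.
have Npos : 0 < N%:R :> R by rewrite ltr0n.
wlog [x0 y1] : x y xy / 0 <= x /\ y <= 1.
  move=> H; rewrite (cdf_clip _ _ x)// (cdf_clip _ _ y)//.
  set y' : R := Num.max _ _; set x' : R := Num.max _ _.
  have xy' : x' <= y'.
    move: xy; rewrite /x' /y'; clear -x y.
    case: (clip_cases x) => [[h1 ->]|[/andP[h1 h2] ->]|[h1 ->]];
      case: (clip_cases y) => [[h3 ->]|[/andP[h3 h4] ->]|[h3 ->]]; by lra.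
  apply: (le_trans (H x' y' xy' _)).
    by rewrite /x' /y' le_max lexx/= ge_max ler01 ge_min lexx.
  rewrite lerD2l ler_wpM2l// /x' /y'; move: xy.
  clear -x y.
  case: (clip_cases x) => [[h1 ->]|[/andP[h1 h2] ->]|[h1 ->]];
    case: (clip_cases y) => [[h3 ->]|[/andP[h3 h4] ->]|[h3 ->]]; by lra.
pose i := Num.truncn (x * N%:R); pose j := Num.truncn (y * N%:R).
have xN0 : 0 <= x * N%:R by rewrite mulr_ge0// ltW.
have yN0 : 0 <= y * N%:R by rewrite mulr_ge0// ?(le_trans x0)// ltW.
have /andP[i1 i2] := truncn_itv xN0; have /andP[j1 j2] := truncn_itv yN0.
rewrite -/i in i1 i2; rewrite -/j in j1 j2.
have ij : (i <= j)%N.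
  rewrite -ltnS -(ltr_nat R); apply: le_lt_trans j2; apply: le_trans i1 _.
  by rewrite ler_wpM2r// ltW.
have jN : (j <= N)%N.
  rewrite -(ler_nat R); apply: le_trans j1 _.
  by rewrite ger_pMl.
have near z k : k%:R <= z * N%:R -> z * N%:R < k.+1%:R ->
    `|cdf N c z - cdf N c (k%:R / N%:R)| <= C / N%:R.
  move=> k1 k2; have C0 : 0 <= C := le_trans (normr_ge0 _) (cC 0%N).
  apply: (le_trans (cdf_lipschitz N c C _ _ N0 (fun s _ => cC s) _)).
    by rewrite ler_pdivrMr.
  rewrite ler_wpM2l// -(ler_pM2r Npos) mulVf ?gt_eqF// mulrBl divfK ?gt_eqF//.
  by move: k2; rewrite -natr1; clear; lra.
have hx := near x i i1 i2; have hy := near y j j1 j2.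
have hij : `|cdf N c (j%:R / N%:R) - cdf N c (i%:R / N%:R)| <= (G1 + G2) / N%:R + G2 * (y - x).
  rewrite !cdf_grid// -mulrBl -!(big_mkord xpredT c) (big_cat_nat (leq0n i) ij)/=.
  rewrite addrAC subrr add0r normrM (gtr0_norm (_ : 0 < N%:R^-1)) ?invr_gt0//.
  rewrite ler_pdivrMr// mulrDl divfK ?gt_eqF//.
  apply: le_trans (HG i j _) _; first by rewrite ij jN.
  have h : (j - i)%:R <= 1 + (y - x) * N%:R.
    by rewrite natrB// mulrBl; move: i2 j1; rewrite -natr1; clear; lra.
  by have := ler_wpM2l G20 h; clear; lra.
rewrite (_ : cdf N c y - cdf N c x = (cdf N c y - cdf N c (j%:R / N%:R)) +
   ((cdf N c (j%:R / N%:R) - cdf N c (i%:R / N%:R)) - (cdf N c x - cdf N c (i%:R / N%:R)))); last by ring.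
apply: le_trans (ler_normD _ _) _.
have := ler_normB (cdf N c (j%:R / N%:R) - cdf N c (i%:R / N%:R)) (cdf N c x - cdf N c (i%:R / N%:R)).
move: hx hy hij; rewrite !mulrDl -!mulrA; clear; lra.
Qed.

(** If [N * |x - y| <= 1], the Lipschitz bound applies and the power [g <= 1] only increases it;
    otherwise the bound of the supremum is enough. *)
Lemma piecewise_affine_holder N (d : R -> R) (E g x y : R) : (0 < N)%N -> piecewise_affine N d ->
  (forall n : int, `|d (n%:~R / N%:R)| <= E) -> 0 <= g <= 1 ->
  `|d x - d y| <= 2 * E * (N%:R * `|x - y|) `^ g.
Proof.
move=> N0 aff dE /andP[g0 g1]; have Npos : 0 < N%:R :> R by rewrite ltr0n.
have E0 : 0 <= E := le_trans (normr_ge0 _) (dE 0).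
have dB := piecewise_affine_bound N d E N0 aff dE.
have [xyN|xyN] := lerP `|x - y| N%:R^-1.
  apply: (@le_trans _ _ (2 * E * (N%:R * `|x - y|))).
    have lip (u v : R) : u <= v -> `|u - v| <= N%:R^-1 ->
        `|d u - d v| <= 2 * E * (N%:R * `|u - v|).
      move=> uv; rewrite (distrC (d u)) (distrC u) (ger0_norm (_ : 0 <= v - u)) ?subr_ge0// mulrA.
      exact: (piecewise_affine_lip N d E _ _ N0 aff dE uv).
    case/orP: (le_total x y) => [xy|yx]; first exact: lip.
    by rewrite (distrC (d x)) (distrC x) lip// distrC.
  apply: ler_wpM2l; first by rewrite mulr_ge0.
  have [->|z0] := eqVneq (N%:R * `|x - y|) 0; first exact: powR_ge0.
  by rewrite ger1_powR// lt_neqAle eq_sym z0 mulr_ge0//= -ler_pdivlMl// mulr1.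
apply: (@le_trans _ _ (2 * E)).
  by apply: le_trans (ler_normB _ _) _; have := dB x; have := dB y; lra.
apply: ler_peMr; first by rewrite mulr_ge0.
by rewrite -[leLHS](powRr0 (N%:R * `|x - y|)) ler_powR// -ler_pdivrMl// mulr1 ltW.
Qed.

Lemma salem_step (alpha e : R) (N0 : nat) (a0 : nat -> R) :
  1 / 2 < alpha < 1 -> 0 < e <= 1 / 4 -> density_state N0 a0 ->
  exists N a, salem_refinement alpha e N0 a0 N a.
Proof.
move=> /andP[al1 al2] /andP[e0 e4] [N00 a00 a0N].
pose B : R := 1 + \sum_(s < N0) a0 s.
have S0 : 0 <= \sum_(s < N0) a0 s by apply: sumr_ge0.
have B1 : 1 <= B by rewrite lerDl.
have a0B s : 0 <= a0 s <= B.
  rewrite a00/=; have [sN|Ns] := ltnP s N0; last by rewrite a0N// (le_trans _ B1).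
  by rewrite /B (bigD1 (Ordinal sN))//= addrCA lerDl addr_ge0// sumr_ge0.
(* [sg] is small against both the permitted loss [e] and the gain [alpha - 1 / 2]. For large [N],
   [L = N ^ sg] exceeds the logarithm of the number of tests, while
   [L <= p ^ 2 * N = N ^ (2 * alpha - 1)]. *)
pose sg := Num.min e (alpha - 1 / 2) / 2.
have sge : 2 * sg <= e by rewrite /sg mulrCA divff// mulr1 ge_min lexx.
have sgd : 2 * sg <= alpha - 1 / 2 by rewrite /sg mulrCA divff// mulr1 ge_min lexx orbT.
have sg0 : 0 < sg by rewrite divr_gt0// lt_min e0 subr_gt0.
have sg20 : 0 < sg / 2 by rewrite divr_gt0.
pose C0 := 100 * B ^+ 2 / e ^+ 2.
have [n1 hn1] := powR_unbounded C0 (sg / 2) sg20.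
have [n2 hn2] := expR_powR_unbounded 30 sg 3 sg0.
(* The new mesh divides the old one evenly; the summand [2] makes it strictly finer and gives
   [N >= 2], hence [p < 1]. *)
pose K := (n1 + n2 + 2)%N; pose N := (N0 * K)%N.
have K0 : (0 < K)%N by rewrite /K addn2.
have KN : (K <= N)%N by rewrite /N leq_pmull.
have N0' : (0 < N)%N by rewrite muln_gt0 N00.
have N2 : (2 <= N)%N by rewrite (leq_trans _ KN)// leq_addl.
have /hn1 : (n1 <= N)%N by rewrite (leq_trans _ KN)// /K -addnA leq_addr.
have /hn2 : (n2 <= N)%N by rewrite (leq_trans _ KN)// /K -addnA addnCA leq_addr.
have NN0 : (N0 < N)%N by rewrite /N -[X in (X < _)%N]muln1 ltn_pmul2l// /K addn2.
have Npos : 0 < N%:R :> R by rewrite ltr0n.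
have N1 : 1 <= N%:R :> R by rewrite ler1n.
have bN s : (N <= s)%N -> a0 (s %/ K)%N = 0 by move=> Ns; rewrite a0N// leq_divRL.
have PD x y : N%:R `^ x * N%:R `^ y = N%:R `^ (x + y) :> R.
  by rewrite powRD// (gt_eqF Npos) implybT.
have P1 : N%:R `^ 1 = N%:R :> R by rewrite powRr1// ltW.
have Pge0 x : 0 <= N%:R `^ x :> R := powR_ge0 _ _.
have Ple (x y : R) : x <= y -> N%:R `^ x <= N%:R `^ y :> R by move=> xy; rewrite ler_powR.
have PV x : (N%:R `^ x)^-1 = N%:R `^ (- x) :> R by rewrite powRN.
have nV : N%:R^-1 = N%:R `^ (- 1) :> R by rewrite -{1}P1 PV.
have b0B s : 0 <= a0 (s %/ K)%N <= B by [].
have B0 : 0 < B by rewrite (lt_le_trans ltr01).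
move=> hexp hC0; have NE : N = (N0 * K)%N by [].
clearbody N K.
pose b s := a0 (s %/ K)%N; set p : R := N%:R `^ (alpha - 1); set L : R := N%:R `^ sg.
have p0 : 0 < p by rewrite powR_gt0.
have p1 : p < 1.
  rewrite /p /powR gt_eqF// expR_lt1 pmulr_llt0 ?subr_lt0// ln_gt0//.
  by rewrite ltr1n.
have pV : p^-1 = N%:R `^ (1 - alpha) by rewrite PV opprB.
have L1 : 1 <= L by rewrite -(powRr0 N%:R); apply: Ple; apply: ltW.
have LpN : L <= p ^+ 2 * N%:R.
  rewrite expr2 -{1}P1 !PD; apply: Ple; move: sgd sg0; clear; lra.
(* With [k = e / (8 * B)], the factor [2 * k * B] of the length in the interval test is [e / 4]. *)
have k01 : 0 < e / (8 * B) <= 1.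
  rewrite divr_gt0 ?mulr_gt0//= ler_pdivrMr ?mulr_gt0// mul1r; move: e4 B1; clear; lra.
have cnt : (30 * N ^ 3)%:R <= expR L by rewrite natrM natrX.
have p01 : 0 < p < 1 by rewrite p0 p1.
have [eta [eta2 [H1 H2 H3 H4]]] := random_step N b B p L _ N0' b0B bN B1 p01 L1 LpN k01 cnt.
pose a s := b s * (1 + eta s); pose c s := b s * eta s.
have eta1 s : 0 <= 1 + eta s <= p^-1.
  have pV1 : 0 <= p^-1 by rewrite invr_ge0 ltW.
  by case: (eta2 s) => ->; rewrite ?subrr ?lexx// addrC subrK lexx pV1.
have etan s : `|eta s| <= p^-1.
  have pV1 : 1 <= p^-1 by rewrite invf_ge1// ltW.
  by case: (eta2 s) => ->; rewrite ?normrN1// ger0_norm ?subr_ge0// lerBlDr lerDl.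
have cB s : `|c s| <= B / p.
  by rewrite normrM ler_pM//; case/andP: (b0B s) => b0 bB; rewrite ger0_norm.
have stE psi : stieltjes_sum N a psi - stieltjes_sum N0 a0 psi = stieltjes_sum N c psi.
  rewrite -(stieltjes_sum_refine N0 K a0 psi N00 K0) -NE -stieltjes_sumBl.
  by apply: eq_bigr => s _; congr (_ * _); rewrite /a /c /b; ring.
(* [Q] absorbs all the constants: it is at most [e ^ 2 / (100 B ^ 2)]. *)
set Q := N%:R `^ (- (sg / 2)).
have Q0 : 0 <= Q by exact: Pge0.
have hQ : 100 * B ^+ 2 * Q <= e ^+ 2.
  have := ler_wpM2r Q0 hC0; rewrite PD subrr powRr0 /C0.
  rewrite (_ : 100 * B ^+ 2 / e ^+ 2 * Q = (100 * B ^+ 2 * Q) / e ^+ 2); last by ring.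
  by rewrite ler_pdivrMr ?exprn_gt0// mul1r.
have BB : B <= B ^+ 2 by rewrite expr2 ler_peMl// ltW.
have QB : 100 * B * Q <= e ^+ 2.
  by apply: le_trans hQ; rewrite ler_wpM2r// ler_wpM2l.
have ee : e ^+ 2 <= e / 4 by rewrite expr2 ler_wpM2l ?(ltW e0)//; move: e4; clear; lra.
have trig := trig_sum_bound N c (3 * B * Num.sqrt (N%:R * L / p)) (B / p) N0' cB.
have fourier (xi : R) : xi != 0 ->
  `|stieltjes_sum N c (fun x => sin (2 * pi * xi * x) / (2 * pi * xi))|
     <= e * (1 + `|xi|) `^ (- ((alpha - e) / 2)) /\
  `|stieltjes_sum N c (fun x => - cos (2 * pi * xi * x) / (2 * pi * xi))|
     <= e * (1 + `|xi|) `^ (- ((alpha - e) / 2)).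
  (* [E] is [sqrt (N * L / p)]. Combined with [min_interp] at [t = (alpha - e) / 2] it leaves
     [N ^ ((sg - e) / 2)], which is at most [Q]. *)
  move=> xi0; pose E := N%:R `^ (1 - alpha / 2 + sg / 2).
  have E0 : 0 <= E by exact: Pge0.
  have AE u : `|\sum_(s < N) c s * cos (s%:R * u)| <= 11 * B * E /\
              `|\sum_(s < N) c s * sin (s%:R * u)| <= 11 * B * E.
    have h : 3 * B * Num.sqrt (N%:R * L / p) + 8 * (B / p) / N%:R <= 11 * B * E.
      have -> : Num.sqrt (N%:R * L / p) = E.
        by rewrite pV -{1}P1 /L !PD sqrt_powR// /E; congr (_ `^ _); field.
      have h : p^-1 / N%:R <= E.
        by rewrite pV nV PD; apply: Ple; move: al1 al2 sg0; clear; lra.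
      have := ler_wpM2l (ltW B0) h.
      rewrite (_ : 8 * (B / p) / N%:R = 8 * (B * (p^-1 / N%:R))); last by ring.
      by move: (B * (p^-1 / N%:R)) => z; clear; lra.
    have [|h1 h2] := trig _ u; last by split; exact: le_trans h.
    move=> i iN; have [h1 h2] := H1 i iN.
    by split; [under eq_bigr do rewrite /c mulrAC|under eq_bigr do rewrite /c mulrAC].
  have [f1 f2] := fourier_step_bound N c _ xi N0' xi0 AE.
  suff h : 2 * (11 * B * E) * Num.min N%:R^-1 `|xi|^-1 <= e * (1 + `|xi|) `^ (- ((alpha - e) / 2)).
    by split; [exact: le_trans f1 h|exact: le_trans f2 h].
  have t01 : 0 <= (alpha - e) / 2 <= 1.
    by apply/andP; split; move: al1 al2 e0 e4; clear; lra.
  apply: (@le_trans _ _ (2 * (11 * B * E) * (2 * N%:R `^ ((alpha - e) / 2 - 1) *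
      (1 + `|xi|) `^ (- ((alpha - e) / 2))))).
    by rewrite ler_wpM2l ?min_interp// !mulr_ge0// ltW.
  rewrite mulrA ler_wpM2r ?powR_ge0//.
  have hE : E * N%:R `^ ((alpha - e) / 2 - 1) <= Q.
    by rewrite PD; apply: Ple; move: sge; clear; lra.
  have := ler_wpM2l (ltW B0) hE.
  rewrite (_ : 2 * (11 * B * E) * (2 * N%:R `^ ((alpha - e) / 2 - 1)) =
    44 * (B * (E * N%:R `^ ((alpha - e) / 2 - 1)))); last by ring.
  have : 0 <= B * Q by rewrite mulr_ge0// ltW.
  by move: (B * (E * _)) ee QB e0; rewrite -mulrA; move: (B * Q) => q z; clear; lra.
have convE x : self_conv N a x - self_conv N0 a0 x = self_conv N a x - self_conv N b x.
  by rewrite -(self_conv_refine N0 K a0 x N00 K0) -NE.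
pose d x := self_conv N a x - self_conv N b x.
have aff : piecewise_affine N d.
  by apply: piecewise_affineB; exact: piecewise_affine_self_conv.
(* This is the convolution error of [random_step] divided by [N], since [sqrt (N * L) / (p * N) = N
   ^ (sg / 2 + 1 / 2 - alpha)]. *)
pose E := 29 * B ^+ 2 * N%:R `^ (sg / 2 - (alpha - 1 / 2)).
have E0 : 0 <= E by rewrite /E mulr_ge0 ?Pge0// mulr_ge0// sqr_ge0.
have dgrid (n : int) : `|d (n%:~R / N%:R)| <= E.
  case: n => [[|m]|m].
  - by rewrite /d mul0r !self_conv_le0// subrr normr0.
  - rewrite /d !self_conv_grid//; last by move=> s Ns; rewrite /a /b bN// mul0r.
    rewrite -mulrBl normrM (gtr0_norm (_ : 0 < N%:R^-1)) ?invr_gt0//.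
    rewrite ler_pdivrMr//; apply: le_trans (H4 m) _.
    have -> : Num.sqrt (N%:R * L) / p = N%:R `^ (sg / 2 - (alpha - 1 / 2)) * N%:R.
      rewrite -{1}P1 /L PD sqrt_powR// pV PD -[X in _ = _ * X]P1 PD; congr (_ `^ _); by field.
    by rewrite /E mulrA.
  - have h : (Negz m)%:~R / N%:R <= 0 :> R.
      by rewrite NegzE mulrNz mulNr oppr_le0 divr_ge0.
    by rewrite /d !self_conv_le0// subrr normr0.
have convB x : `|d x| <= E by exact: (piecewise_affine_bound N d E N0' aff dgrid).
exists N, a; split => //.
- split => // s; first by rewrite mulr_ge0//; [case/andP: (b0B s)|case/andP: (eta1 s)].
  by move=> Ns; rewrite /a /b bN// mul0r.
(* Each kept cell contributes [1 / p] to the sum of [1 + eta], so their number is at most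
   [p * 4 N = 4 * N ^ alpha]. *)
- have anz s : a s != 0 -> 1 + eta s = p^-1.
    rewrite /a; case: (eta2 s) => ->; first by rewrite addrC subrK.
    by rewrite subrr mulr0 eqxx.
  have h : \sum_(s < N) (1 + eta s) <= 4 * N%:R.
    rewrite big_split/= sumr_const card_ord; move: H3; clear; lra.
  rewrite -sum1_card natr_sum.
  have -> : 4 * N%:R `^ alpha = p * (4 * N%:R).
    by rewrite [RHS]mulrCA -[X in _ = _ * (_ * X)]P1 PD; congr (_ * _ `^ _); ring.
  apply: le_trans (ler_wpM2l (ltW p0) h).
  rewrite mulr_sumr [leLHS]big_mkcond; apply: ler_sum => s _; rewrite inE; case: ifP => [/anz ->|_].
    by rewrite divff// gt_eqF.
  by rewrite mulr_ge0// ?(ltW p0)//; case/andP: (eta1 s).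
- move=> x y xy xy1.
  have cdfE z : cdf N a z - cdf N0 a0 z = cdf N c z by exact: stE.
  rewrite [X in `|X|](_ : _ = cdf N c y - cdf N c x); last by rewrite -!cdfE; ring.
  set r := y - x in xy1 *; have r0 : 0 <= r by rewrite subr_ge0.
  (* Lengths of at least [1 / N] are governed by the interval tests. Below that the density bound
     [B / p] suffices, because [N ^ (1 - alpha) * r ^ (1 - alpha + e) <= N ^ (- e)]. *)
  have [rN|rN] := lerP N%:R^-1 r.
    have hN : N%:R `^ (- (alpha - e)) <= r `^ (alpha - e).
      rewrite powRN -powR_inv1 ?powR_ge0// -powRrM mulrC powRrM powR_inv1 ?(ltW Npos)//.
      rewrite ge0_ler_powR ?nnegrE ?invr_ge0 ?ler0n//.
      by move: al1 e4; clear; lra.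
    pose G1 := B * L / (p * (e / (8 * B))); pose G2 := 2 * (e / (8 * B)) * B.
    have G2E : G2 = e / 4 by rewrite /G2; field; rewrite gt_eqF.
    have cN s : (N <= s)%N -> c s = 0 by move=> Ns; rewrite /c /b bN// mul0r.
    have G20 : 0 <= G2 by rewrite G2E divr_ge0// ltW.
    have HG (i j : nat) : (i <= j <= N)%N -> `|\sum_(i <= s < j) c s| <= G1 + G2 * (j - i)%:R.
      move=> ijN; rewrite -(sum_ord_itv _ _ _ _ ijN); apply: le_trans (H2 i j ijN).
      by rewrite le_eqVlt; apply/orP; left; apply/eqP; congr (`|_|); apply: eq_bigr => s _; case: ifP; rewrite ?mul0r.
    apply: le_trans (cdf_oscillation N c _ G1 G2 x y N0' cN cB G20 HG xy) _.
    rewrite G2E -/r.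
    have rr : r <= r `^ (alpha - e).
      have [->|r00] := eqVneq r 0; first exact: powR_ge0.
      rewrite ger1_powR// ?lt_neqAle ?(eq_sym 0) ?r00 ?r0 ?xy1//.
      by move: al2 e0; clear; lra.
    have big : (G1 + e / 4 + 2 * (B / p)) / N%:R <= 11 * B ^+ 2 / e * N%:R `^ (sg - alpha).
      have h1 : p^-1 / N%:R * L = N%:R `^ (sg - alpha).
        by rewrite pV nV !PD; congr (_ `^ _); ring.
      have h2 : N%:R^-1 <= N%:R `^ (sg - alpha).
        by rewrite nV; apply: Ple; move: al2 sg0; clear; lra.
      have h3 : p^-1 / N%:R <= N%:R `^ (sg - alpha).
        by rewrite pV nV PD; apply: Ple; move: al2 sg0; clear; lra.
      have Be : B ^+ 2 <= B ^+ 2 / e by rewrite ler_peMr ?sqr_ge0// invf_ge1//; move: e4; clear; lra.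
      have Be1 : e <= B ^+ 2 / e.
        by apply: le_trans Be; move: e4 B1 BB; clear; lra.
      rewrite (_ : (G1 + e / 4 + 2 * (B / p)) / N%:R =
        8 * (B ^+ 2 / e * (p^-1 / N%:R * L)) + e * N%:R^-1 / 4 + 2 * (B * (p^-1 / N%:R))); last first.
        by rewrite /G1; field; rewrite !gt_eqF.
      rewrite h1; set W := N%:R `^ (sg - alpha) in h2 h3 *.
      have W0 : 0 <= W by exact: Pge0.
      have w1 : e * N%:R^-1 <= B ^+ 2 / e * W.
        by rewrite ler_pM// ?(ltW e0)// invr_ge0 ltW.
      have w2 : B * (p^-1 / N%:R) <= B ^+ 2 / e * W.
        rewrite ler_pM ?(ltW B0)//; last by apply: le_trans Be.
        by rewrite divr_ge0// ?invr_ge0 ltW.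
      rewrite (_ : 11 * B ^+ 2 / e * W = 11 * (B ^+ 2 / e * W)); last by ring.
      have : 0 <= B ^+ 2 / e * W by rewrite mulr_ge0// divr_ge0 ?sqr_ge0// ltW.
      by move: w1 w2; clear; lra.
    have big2 : 11 * B ^+ 2 / e * N%:R `^ (sg - alpha) <= e / 4 * r `^ (alpha - e).
      apply: (@le_trans _ _ (11 * B ^+ 2 / e * Q * r `^ (alpha - e))).
        have K11 : 0 <= 11 * B ^+ 2 / e by rewrite divr_ge0 ?(ltW e0)// mulr_ge0// sqr_ge0.
        rewrite -[leRHS]mulrA; apply: (ler_wpM2l K11).
        apply: (@le_trans _ _ (Q * N%:R `^ (- (alpha - e)))).
          by rewrite /Q PD; apply: Ple; move: sge sg0; clear; lra.
        exact: ler_wpM2l.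
      rewrite ler_wpM2r ?powR_ge0//.
      rewrite (_ : 11 * B ^+ 2 / e * Q = (11 / 100) * (100 * B ^+ 2 * Q) / e); last by field; rewrite gt_eqF.
      rewrite ler_pdivrMr// (_ : e / 4 * e = e ^+ 2 / 4); last by ring.
      by have := sqr_ge0 e; move: hQ; clear; lra.
    have hz := powR_ge0 r (alpha - e); have her := ler_wpM2l (ltW e0) rr.
    have hez : 0 <= e * r `^ (alpha - e) by rewrite mulr_ge0// ltW.
    apply: (@le_trans _ _ (e / 4 * r `^ (alpha - e) + e / 4 * r)).
      by rewrite lerD2r (le_trans big).
    by move: her hez; clear; lra.
  apply: (le_trans (cdf_lipschitz N c (B / p) _ _ N0' (fun s _ => cB s) xy)).
  rewrite -/r; have [r00|r00] := eqVneq r 0.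
    by rewrite r00 mulr0 mulr_ge0 ?powR_ge0// ltW.
  have rpos : 0 < r by rewrite lt_neqAle eq_sym r00.
  have -> : B / p * r = (B * (p^-1 * r `^ (1 - alpha + e))) * r `^ (alpha - e).
    have rE : r = r `^ (1 - alpha + e) * r `^ (alpha - e).
      rewrite -powRD ?r00 ?implybT// (_ : 1 - alpha + e + (alpha - e) = 1) ?powRr1//.
      by ring.
    by rewrite {1}rE; ring.
  rewrite ler_wpM2r ?powR_ge0//.
  have h : p^-1 * r `^ (1 - alpha + e) <= Q.
    apply: (@le_trans _ _ (p^-1 * N%:R `^ (- (1 - alpha + e)))).
      rewrite ler_wpM2l ?invr_ge0 ?(ltW p0)// powRN -powR_inv1 ?powR_ge0// -powRrM mulrC powRrM powR_inv1 ?(ltW Npos)//.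
      rewrite ge0_ler_powR ?nnegrE ?invr_ge0 ?ler0n ?(ltW rN)//.
      by move: al2 e0; clear; lra.
    by rewrite pV PD; apply: Ple; move: sge sg0; clear; lra.
  have := ler_wpM2l (ltW B0) h; have : 0 <= B * Q by rewrite mulr_ge0// ltW.
  by move: (B * (_ * _)) ee QB e0; rewrite -mulrA; move: (B * Q) => q z; clear; lra.
- by move=> xi xi0; rewrite stE; apply: (fourier xi xi0).1.
- by move=> xi xi0; rewrite stE; apply: (fourier xi xi0).2.
- move=> x; rewrite convE; apply: le_trans (convB _) _.
  rewrite /E; apply: (@le_trans _ _ (29 * (B ^+ 2 * Q))).
    rewrite -(mulrA 29) ler_wpM2l// ler_wpM2l ?sqr_ge0//; apply: Ple.
    by move: sgd sg0; clear; lra.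
  have : 0 <= B ^+ 2 * Q by rewrite mulr_ge0// sqr_ge0.
  by move: hQ ee e0; rewrite -mulrA; move: (B ^+ 2 * Q) => q; clear; lra.
- move=> x y; rewrite !convE -/(d x) -/(d y); set g := (alpha - 1 / 2) / 2.
  have g01 : 0 <= g <= 1 by apply/andP; split; rewrite /g; move: al1 al2; clear; lra.
  apply: le_trans (piecewise_affine_holder N d E g x y N0' aff dgrid g01) _.
  rewrite powRM// mulrA ler_wpM2r ?powR_ge0//.
  rewrite /E (_ : 2 * _ * _ = 58 * (B ^+ 2 * (N%:R `^ (sg / 2 - (alpha - 1 / 2)) * N%:R `^ g))); last by ring.
  (* The factor [N ^ g] spends half of the gain [alpha - 1 / 2]; the other half is still at least
     [sg]. *)
  apply: (@le_trans _ _ (58 * (B ^+ 2 * Q))).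
    rewrite ler_wpM2l// ler_wpM2l ?sqr_ge0// PD; apply: Ple.
    by rewrite /g; move: sgd sg0; clear; lra.
  have : 0 <= B ^+ 2 * Q by rewrite mulr_ge0// sqr_ge0.
  by move: hQ ee e0; rewrite -mulrA; move: (B ^+ 2 * Q) => q; clear; lra.
- exists p^-1 => x y xy; rewrite -!(cdf_refine N0 K a0 _ N00 K0) -NE.
  apply: cdf_le_compat => // s _; rewrite /a mulrC ler_wpM2r//; first by case/andP: (b0B s).
  by case/andP: (eta1 s).
Qed.

End salem_step.

(** * Limits under geometrically decreasing errors *)

Section geometric_sequences.
Context {R : realType}.

(** The numbers [u k - 2 * e k] do not decrease and the numbers [u k + 2 * e k] do not increase; the
    supremum of the former lies between them. *)
Lemma geometric_limit (u e : nat -> R) : (forall k, `|u k.+1 - u k| <= e k) ->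
  (forall k, 2 * e k.+1 <= e k) -> exists l, forall k, `|l - u k| <= 2 * e k.
Proof.
move=> ue eh.
have e0 k : 0 <= e k := le_trans (normr_ge0 _) (ue k).
have lo k m : u k - 2 * e k <= u (k + m)%N - 2 * e (k + m)%N.
  elim: m => [|m IH]; first by rewrite addn0.
  apply: le_trans IH _; rewrite addnS.
  by have := ue (k + m)%N; have := eh (k + m)%N; rewrite ler_norml => h /andP[h1 h2]; lra.
have hi k m : u (k + m)%N + 2 * e (k + m)%N <= u k + 2 * e k.
  elim: m => [|m IH]; first by rewrite addn0.
  apply: le_trans IH; rewrite addnS.
  by have := ue (k + m)%N; have := eh (k + m)%N; rewrite ler_norml => h /andP[h1 h2]; lra.
pose S := [set x | exists k, x = u k - 2 * e k].
have ub k : ubound S (u k + 2 * e k).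
  move=> _ [j ->]; apply: (@le_trans _ _ (u (maxn j k) - 2 * e (maxn j k))).
    by have := lo j (k - j)%N; rewrite -maxnE.
  apply: (@le_trans _ _ (u (maxn j k) + 2 * e (maxn j k))).
    by have := e0 (maxn j k); lra.
  by rewrite maxnC; have := hi k (j - k)%N; rewrite -maxnE.
exists (sup S) => k; rewrite ler_norml; apply/andP; split; [rewrite lerBrDl|rewrite lerBlDl].
  apply: ub_le_sup; first by exists (u 0%N + 2 * e 0%N); exact: ub.
  by exists k.
by apply: ge_sup; [exists (u 0%N - 2 * e 0%N), 0%N|exact: ub].
Qed.

(** The increments from stage [K] on add up to at most [2 * e K] times [w]. The weight [w] serves
    Hoelder bounds (a power of a length) and Fourier bounds (a power of the frequency) alike. *)
Lemma geometric_bound (u e : nat -> R) (C w : R) K : 0 <= w -> (forall k, 2 * e k.+1 <= e k) ->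
  (forall k, 0 <= e k) ->
  (forall k, (K <= k)%N -> `|u k.+1 - u k| <= e k * w) -> `|u K| <= C * w ->
  forall k, (K <= k)%N -> `|u k| <= (C + 2 * e K) * w.
Proof.
move=> w0 eh e0 ue uK k Kk.
suff h m : `|u (K + m)%N| <= (C + 2 * e K - 2 * e (K + m)%N) * w.
  rewrite -(subnKC Kk); apply: le_trans (h _) _.
  by rewrite ler_wpM2r// gerBl mulr_ge0.
elim: m => [|m IH]; first by rewrite addn0 addrK.
rewrite addnS -(subrK (u (K + m)%N) (u _.+1)).
apply: le_trans (ler_normD _ _) _.
have := ue (K + m)%N (leq_addr _ _).
have := ler_wpM2r w0 (eh (K + m)%N); move: IH.
lra.
Qed.

Lemma le_of_geometric (x y : R) (e : nat -> R) (c : R) : (forall k, 2 * e k.+1 <= e k) ->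
  (forall k, 0 <= e k) -> (forall k, x <= y + c * e k) -> x <= y.
Proof.
move=> eh e0 h.
have ek k : e k * 2 ^+ k <= e 0%N.
  elim: k => [|k IH]; first by rewrite expr0 mulr1.
  by apply: le_trans IH; rewrite exprS mulrA ler_wpM2r ?exprn_ge0// mulrC.
rewrite leNgt; apply/negP => yx.
pose D := `|c| * e 0%N / (x - y).
have xy0 : 0 < x - y by rewrite subr_gt0.
have := truncn_itv (_ : 0 <= D); rewrite divr_ge0 ?mulr_ge0 ?(ltW xy0)// => /(_ isT).
set k := Num.truncn D => /andP[_ Dk].
have k2 : k.+1%:R <= 2 ^+ k.+1 :> R by rewrite -natrX ler_nat ltnW// ltn_expl.
have := h k.+1; rewrite -lerBlDl leNgt => /negP; apply.
rewrite ltr_pdivrMr// in Dk.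
have p2 : 0 < 2 ^+ k.+1 :> R by rewrite exprn_gt0.
rewrite -(ltr_pM2r p2) -mulrA; apply: (@le_lt_trans _ _ (`|c| * e 0%N)).
  apply: le_trans (ler_norm _) _; rewrite normrM ler_wpM2l// ger0_norm// mulr_ge0// ltW.
apply: (lt_le_trans Dk); rewrite mulrC ler_pM2l//.
Qed.

End geometric_sequences.

(** * The sequence of refinements and its limit *)

Section salem_limit.
Context {R : realType}.

(** The factor [8] keeps the errors small enough for a step and the limit mass positive, [2 ^ k]
    makes them summable, and [N ^ 2] keeps them negligible after summation over [N] cells. *)
Definition step_eps (k N : nat) : R := (8 * 2 ^+ k * N%:R ^+ 2)^-1.

(** The state of the recursion carries its stage, on which the permitted error depends. The start is
    the uniform density on [[0, 1]]. *)
Lemma salem_sequence (alpha : R) : 1 / 2 < alpha < 1 ->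
  exists (N_ : nat -> nat) (a_ : nat -> nat -> R), [/\ N_ 0%N = 1%N, a_ 0%N = (fun s => (s == 0%N)%:R),
    forall k, density_state (N_ k) (a_ k) &
    forall k, salem_refinement alpha (step_eps k (N_ k)) (N_ k) (a_ k) (N_ k.+1) (a_ k.+1)].
Proof.
move=> al; pose X := {x : nat * (nat * (nat -> R)) | density_state x.2.1 x.2.2}.
pose next (x y : X) := (sval y).1 = (sval x).1.+1 /\
  salem_refinement alpha (step_eps (sval x).1 (sval x).2.1) (sval x).2.1 (sval x).2.2
    (sval y).2.1 (sval y).2.2.
have st0 : density_state 1 (fun s => (s == 0%N)%:R : R) by split => // -[].
have [x|f [f0 fS]] := @dependent_choice X next _
  (exist (fun x => density_state x.2.1 x.2.2) (0%N, (1%N, fun s => (s == 0%N)%:R)) st0).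
- apply/cid; case: x => -[k [N a]] /= st.
  have [N0 _ _] := st.
  have [|N' [a' r]] := salem_step alpha (step_eps k N) N a al _ st.
    have h : 4 <= 8 * 2 ^+ k * N%:R ^+ 2 :> R.
      rewrite -natrX -natrX -!natrM ler_nat.
      by rewrite -mulnA (@leq_trans (8 * 1))// leq_pmul2l// muln_gt0 !expn_gt0 N0.
    have h0 : 0 < 8 * 2 ^+ k * N%:R ^+ 2 :> R by exact: lt_le_trans h.
    by rewrite /step_eps invr_gt0 h0 mul1r lef_pV2 ?posrE.
  by exists (exist (fun x => density_state x.2.1 x.2.2) (k.+1, (N', a')) (refine_state _ _ _ _ _ _ r)).
- have fk k : (sval (f k)).1 = k.
    by elim: k => [|k IH]; [rewrite f0|rewrite (fS k).1 IH].
  exists (fun k => (sval (f k)).2.1), (fun k => (sval (f k)).2.2); rewrite f0; split => // k.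
    exact: (svalP (f k)).
  by have := (fS k).2; rewrite fk.
Qed.

(** [F] is the distribution function of the limit measure and [g] the density of its
    self-convolution, both uniform limits. Fourier decay is stated for the approximations from some
    stage on, because stage [k] only reaches the exponent [alpha - e k]; [lim_count] starts after
    the first refinement. *)
Record salem_limit (alpha : R) (N_ : nat -> nat) (a_ : nat -> nat -> R) (e : nat -> R)
    (F g : R -> R) : Prop := SalemLimit {
  lim_state : forall k, density_state (N_ k) (a_ k);
  lim_e_gt0 : forall k, 0 < e k;
  lim_e_N : forall k, e k * (N_ k)%:R ^+ 2 <= 1;
  lim_size : forall k, (k < N_ k)%N;
  lim_cdf : forall k x, `|F x - cdf (N_ k) (a_ k) x| <= 2 * e k;
  lim_conv : forall k x, `|g x - self_conv (N_ k) (a_ k) x| <= 2 * e k;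
  lim_homo : {homo F : x y / x <= y};
  lim_F0 : forall x, x <= 0 -> F x = 0;
  lim_F1 : forall x, 1 <= x -> F x = F 1;
  lim_F1_gt0 : 0 < F 1;
  lim_F_holder : forall a, 0 < a < alpha ->
    exists C : R, 0 <= C /\ forall x y, x <= y -> F y - F x <= C * (y - x) `^ a;
  lim_fourier : forall b, 0 <= b < alpha -> exists (C : R) (K : nat), forall k, (K <= k)%N ->
    forall xi : R, xi != 0 ->
    `|stieltjes_sum (N_ k) (a_ k) (fun x => sin (2 * pi * xi * x) / (2 * pi * xi))|
       <= C * (1 + `|xi|) `^ (- (b / 2)) /\
    `|stieltjes_sum (N_ k) (a_ k) (fun x => - cos (2 * pi * xi * x) / (2 * pi * xi))|
       <= C * (1 + `|xi|) `^ (- (b / 2));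
  lim_g_holder : holder_continuous g;
  lim_g_ge0 : forall x, 0 <= g x;
  lim_count : forall k, #|[pred s : 'I_(N_ k.+1) | a_ k.+1 s != 0]|%:R <= 4 * (N_ k.+1)%:R `^ alpha;
  lim_gap : forall k s, (s < N_ k)%N -> a_ k s = 0 ->
    F (s.+1%:R / (N_ k)%:R) = F (s%:R / (N_ k)%:R) }.

Lemma salem_limit_exists (alpha : R) : 1 / 2 < alpha < 1 ->
  exists N_ a_ e F g, salem_limit alpha N_ a_ e F g.
Proof.
move=> al; have /andP[al1 al2] := al.
have [N_ [a_ [N0E a0E st ref]]] := salem_sequence alpha al.
pose e k := step_eps k (N_ k).
have Npos k : 0 < (N_ k)%:R :> R by have [h _ _] := st k; rewrite ltr0n.
have Nlt k : (N_ k < N_ k.+1)%N := refine_size _ _ _ _ _ _ (ref k).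
have size k : (k < N_ k)%N.
  by elim: k => [|k IH]; [rewrite N0E|exact: leq_ltn_trans IH (Nlt k)].
have e0 k : 0 < e k by rewrite invr_gt0 mulr_gt0 ?exprn_gt0// mulr_gt0// exprn_gt0.
have e0' k : 0 <= e k by exact: ltW.
have eh k : 2 * e k.+1 <= e k.
  have d0 j M : 0 < M -> 0 < 8 * 2 ^+ j * M ^+ 2 :> R.
    by move=> M0; rewrite mulr_gt0 ?exprn_gt0// mulr_gt0// exprn_gt0.
  rewrite /e /step_eps ler_pdivrMr ?d0// mulrC ler_pdivlMr ?d0//.
  rewrite (exprS 2 k) [leRHS](_ : _ = 2 * (8 * 2 ^+ k * (N_ k.+1)%:R ^+ 2)); last by ring.
  rewrite ler_wpM2l// ler_wpM2l ?mulr_ge0 ?exprn_ge0//.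
  by rewrite lerXn2r ?nnegrE ?ler0n// ler_nat ltnW.
have eN k : e k * (N_ k)%:R ^+ 2 <= 1.
  rewrite /e /step_eps mulrC ler_pdivrMr ?mulr_gt0 ?exprn_gt0// mul1r.
  rewrite ler_peMl ?sqr_ge0//.
  by rewrite -natrX -natrM ler1n muln_gt0 expn_gt0.
have e8 k : e k <= 1 / 8.
  rewrite /e /step_eps -div1r ler_pdivrMr ?mulr_gt0 ?exprn_gt0// -mulrA mul1r mulKf//.
  by rewrite -!natrX -natrM ler1n muln_gt0 !expn_gt0/=; have [-> _ _] := st k.
have [F hF] : exists F, forall k x, `|F x - cdf (N_ k) (a_ k) x| <= 2 * e k.
  have h x : exists l, forall k, `|l - cdf (N_ k) (a_ k) x| <= 2 * e k.
    apply: geometric_limit eh => k.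
    have [Nk0 _ _] := st k; have [Nk1 _ _] := st k.+1.
    rewrite (cdf_clip (N_ k.+1) _ x Nk1) (cdf_clip (N_ k) _ x Nk0).
    set z : R := Num.max 0 _.
    have z01 : 0 <= z <= 1 by rewrite /z le_max lexx ge_max ler01 ge_min lexx.
    have /andP[z0 z1] := z01.
    have := refine_cdf _ _ _ _ _ _ (ref k) 0 z z0; rewrite subr0 => /(_ z1).
    rewrite !(cdf_le0 _ _ _ (lexx 0)) !subr0 => h; apply: (le_trans h).
    have ek : 0 <= alpha - step_eps k (N_ k) by have := e8 k; rewrite /e; lra.
    rewrite ger_pMr ?e0//; apply: (@le_trans _ _ (1 `^ (alpha - step_eps k (N_ k)))).
      by rewrite ge0_ler_powR// nnegrE.
    by rewrite powR1.
  by have [F hF] := choice h; exists F => k x; exact: hF.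
have [g hg] : exists g, forall k x, `|g x - self_conv (N_ k) (a_ k) x| <= 2 * e k.
  have h x : exists l, forall k, `|l - self_conv (N_ k) (a_ k) x| <= 2 * e k.
    by apply: geometric_limit eh => k; exact: (refine_conv _ _ _ _ _ _ (ref k)).
  by have [g hg] := choice h; exists g => k x; exact: hg.
have homo k : {homo cdf (N_ k) (a_ k) : x y / x <= y}.
  by apply: cdf_homo => s _; have [_ h _] := st k.
have hFB k x y : `|(F y - F x) - (cdf (N_ k) (a_ k) y - cdf (N_ k) (a_ k) x)| <= 4 * e k.
  rewrite [X in `|X|](_ : _ = (F y - cdf (N_ k) (a_ k) y) - (F x - cdf (N_ k) (a_ k) x)); last by ring.
  by apply: le_trans (ler_normB _ _) _; have := hF k x; have := hF k y; lra.
(* From stage [K] on, every step respects the exponent [a]; what happens before enters only through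
   a crude bound on the density of stage [K]. *)
have holderK (a : R) : a < alpha -> exists (K : nat), forall k, (K <= k)%N -> e k <= alpha - a.
  move=> aal; exists (Num.truncn (alpha - a)^-1) => k Kk.
  have aa0 : 0 < alpha - a by rewrite subr_gt0.
  have := truncn_itv (_ : 0 <= (alpha - a)^-1); rewrite invr_ge0 (ltW aa0) => /(_ isT)/andP[_ h].
  have N1 : 1 <= (N_ k)%:R :> R by rewrite ler1n (leq_ltn_trans _ (size k)).
  apply: (@le_trans _ _ (N_ k)%:R^-1).
    rewrite -[leRHS]mul1r ler_pdivlMr ?Npos//; apply: le_trans (eN k).
    by rewrite expr2 ler_wpM2l// ler_peMr// ltW.
  rewrite -[leRHS]invrK lef_pV2 ?posrE ?invr_gt0 ?Npos//.
  apply: le_trans (ltW h) _; rewrite ler_nat; exact: leq_ltn_trans (size k).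
have sumB k s : 0 <= a_ k s <= \sum_(s < N_ k) a_ k s.
  have [_ p aN] := st k; rewrite p/=; case: (ltnP s (N_ k)) => [sN|Ns].
    by rewrite (bigD1 (Ordinal sN))//= lerDl sumr_ge0.
  by rewrite aN// sumr_ge0.
have sumB' k s : `|a_ k s| <= \sum_(s < N_ k) a_ k s by have /andP[p q] := sumB k s; rewrite ger0_norm.
have F0 x : x <= 0 -> F x = 0.
  move=> x0; apply/eqP; rewrite -normr_le0; apply: (le_of_geometric _ _ e 2 eh e0') => k.
  by have := hF k x; rewrite cdf_le0// subr0 add0r.
have F1 x : 1 <= x -> F x = F 1.
  move=> x1; apply/eqP; rewrite -subr_eq0 -normr_le0; apply: (le_of_geometric _ _ e 4 eh e0') => k.
  have [Nk0 _ _] := st k.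
  by have := hFB k 1 x; rewrite !(cdf_ge1 _ _ _ Nk0)// subrr subr0 add0r.
have Fh : {homo F : x y / x <= y}.
  move=> x y xy; apply: (le_of_geometric _ _ e 4 eh e0') => k.
  have := homo k _ _ xy; have := hFB k x y; rewrite ler_norml => /andP[h1 h2]; lra.
have FB x : 0 <= F x <= F 1.
  case/orP: (le_total x 0) => x0; first by rewrite F0// lexx -(F0 0)// Fh.
  by case/orP: (le_total x 1) => x1; [rewrite -{1}(F0 0)// !Fh|rewrite (F1 x)// lexx -{1}(F0 0)// Fh].
exists N_, a_, e, F, g; split => //.
- have := hF 0%N 1; rewrite N0E a0E cdf_ge1// big_ord1/= divr1 ler_norml => /andP[h _].
  by have := e8 0%N; lra.
- move=> a /andP[a0 aal]; have [K hK] := holderK a aal.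
  pose C := \sum_(s < N_ K) a_ K s.
  have C0 : 0 <= C := le_trans (normr_ge0 _) (sumB' K 0%N).
  have C1 : 0 <= C + 2 * e K by rewrite addr_ge0// mulr_ge0.
  have F10 : 0 <= F 1 by have /andP[] := FB 1.
  exists (C + 2 * e K + F 1); split; first exact: addr_ge0.
  move=> x y xy; rewrite mulrDl.
  have r0 : 0 <= y - x by rewrite subr_ge0.
  have [r1|r1] := lerP (y - x) 1; last first.
    apply: (@le_trans _ _ (F 1)).
      by have := FB x; have := FB y; move=> /andP[p1 p2] /andP[p3 p4]; lra.
    apply: (@le_trans _ _ (F 1 * (y - x) `^ a)); last by rewrite lerDr mulr_ge0// powR_ge0.
    by rewrite ler_peMr// -(powRr0 (y - x)) ler_powR// ltW.
  have [/eqP|rn0] := eqVneq (y - x) 0.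
    by rewrite subr_eq0 => /eqP ->; rewrite !subrr addr_ge0// mulr_ge0// powR_ge0.
  have rpos : 0 < y - x <= 1 by rewrite lt_neqAle eq_sym rn0 r0.
  apply: (@le_trans _ _ ((C + 2 * e K) * (y - x) `^ a)); last first.
    by rewrite lerDl mulr_ge0// powR_ge0.
  apply: (le_of_geometric _ _ (fun k => e (K + k)%N) 4) => [k|k|k]; rewrite ?addnS//.
  have hb : `|cdf (N_ (K + k)%N) (a_ (K + k)%N) y - cdf (N_ (K + k)%N) (a_ (K + k)%N) x|
      <= (C + 2 * e K) * (y - x) `^ a.
    apply: (geometric_bound (fun k => cdf (N_ k) (a_ k) y - cdf (N_ k) (a_ k) x) e _ _ K) => //.
    + exact: powR_ge0.
    + move=> j Kj; apply: le_trans (refine_cdf _ _ _ _ _ _ (ref j) x y xy r1) _.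
      apply: ler_wpM2l; first exact: (e0' j).
      by rewrite ger_powR//; have := hK j Kj; rewrite /e; lra.
    + have [NK0 _ _] := st K.
      apply: le_trans (cdf_lipschitz (N_ K) (a_ K) C x y NK0 (fun s _ => sumB' K s) xy) _.
      rewrite ler_wpM2l// ger1_powR//; lra.
    + exact: leq_addr.
  have := hFB (K + k)%N x y; move: hb; rewrite !ler_norml => /andP[_ h1] /andP[_ h2]; lra.
- move=> b /andP[b0 bal]; have [K hK] := holderK b bal.
  pose A := \sum_(s < N_ K) a_ K s; pose t := b / 2.
  have t01 : 0 <= t <= 1 by apply/andP; split; rewrite /t; lra.
  exists (2 * A * (2 * (N_ K)%:R `^ (t - 1)) + 2 * e K), K => k Kk xi xi0.
  have [NK0 ak0 _] := st K.
  have A0 : 0 <= A by apply: sumr_ge0.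
  have trig u : `|\sum_(s < N_ K) a_ K s * cos (s%:R * u)| <= A /\
      `|\sum_(s < N_ K) a_ K s * sin (s%:R * u)| <= A.
    have tb (f : R -> R) : (forall x, `|f x| <= 1) -> `|\sum_(s < N_ K) a_ K s * f (s%:R * u)| <= A.
      move=> f1; apply: le_trans (ler_norm_sum _ _ _) _; apply: ler_sum => s _.
      by rewrite normrM (ger0_norm (ak0 s)) ler_piMr.
    by split; apply: tb => x; [exact: cos_max|exact: sin_max].
  have [t1 t2] := fourier_step_bound (N_ K) (a_ K) A xi NK0 xi0 trig.
  have w0 : 0 <= (1 + `|xi|) `^ (- t) := powR_ge0 _ _.
  have hm : 2 * A * Num.min (N_ K)%:R^-1 `|xi|^-1 <=
      2 * A * (2 * (N_ K)%:R `^ (t - 1)) * (1 + `|xi|) `^ (- t).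
    by rewrite -[leRHS]mulrA; apply: ler_wpM2l; [rewrite mulr_ge0|exact: min_interp].
  have step j : (K <= j)%N -> e j * (1 + `|xi|) `^ (- ((alpha - e j) / 2)) <= e j * (1 + `|xi|) `^ (- t).
    move=> Kj; apply: ler_wpM2l => //; rewrite ler_powR ?lerDl// /t lerN2.
    by have := hK j Kj; lra.
  split.
  + apply: (geometric_bound (fun k => stieltjes_sum (N_ k) (a_ k)
      (fun x => sin (2 * pi * xi * x) / (2 * pi * xi))) e _ _ K) => //.
      by move=> j Kj; apply: le_trans (step j Kj); exact: (refine_fourier_re _ _ _ _ _ _ (ref j) xi xi0).
    exact: le_trans t1 hm.
  + apply: (geometric_bound (fun k => stieltjes_sum (N_ k) (a_ k)
      (fun x => - cos (2 * pi * xi * x) / (2 * pi * xi))) e _ _ K) => //.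
      by move=> j Kj; apply: le_trans (step j Kj); exact: (refine_fourier_im _ _ _ _ _ _ (ref j) xi xi0).
    exact: le_trans t2 hm.
- pose c : R := (alpha - 1 / 2) / 2.
  have c01 : 0 < c <= 1 by apply/andP; split; rewrite /c; lra.
  exists c, (2 + 2 * e 0%N); split => // x y.
  apply: (le_of_geometric _ _ e 4 eh e0') => k.
  have hb : `|self_conv (N_ k) (a_ k) x - self_conv (N_ k) (a_ k) y| <= (2 + 2 * e 0%N) * `|x - y| `^ c.
    apply: (geometric_bound (fun k => self_conv (N_ k) (a_ k) x - self_conv (N_ k) (a_ k) y) e 2 _ 0%N _ eh e0') => //.
    + move=> j _; rewrite [X in `|X|](_ : _ = (self_conv (N_ j.+1) (a_ j.+1) x - self_conv (N_ j) (a_ j) x)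
        - (self_conv (N_ j.+1) (a_ j.+1) y - self_conv (N_ j) (a_ j) y)); last by ring.
      exact: (refine_conv_holder _ _ _ _ _ _ (ref j) x y).
    (* At stage [0] the self-convolution is the tent on [[0, 2]], with grid values at most [1]. *)
    + have [NK0 _ aN0] := st 0%N; have c01' : 0 <= c <= 1 by case/andP: c01 => p q; rewrite ltW.
      have N01 : (N_ 0%N)%:R = 1 :> R by rewrite N0E.
      have grid (n : int) : `|self_conv (N_ 0%N) (a_ 0%N) (n%:~R / (N_ 0%N)%:R)| <= 1.
        case: n => [[|m]|m].
        * by rewrite mul0r self_conv_le0// normr0.
        * rewrite self_conv_grid// N01 divr1 big_ord_recl big1 ?addr0 => [|i _]; last first.
            by rewrite a0E/= mul0r.
          by rewrite a0E/= mul1r; case: eqP; rewrite ?normr1// normr0.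
        * by rewrite self_conv_le0 ?normr0// NegzE mulrNz mulNr oppr_le0 divr_ge0.
      have := piecewise_affine_holder _ _ 1 c x y NK0 (piecewise_affine_self_conv _ (a_ 0%N) NK0) grid c01'.
      by rewrite N01 mul1r mulr1.
  have := hg k x; have := hg k y => h1 h2.
  rewrite [X in `|X|](_ : _ = (g x - self_conv (N_ k) (a_ k) x) - (g y - self_conv (N_ k) (a_ k) y)
     + (self_conv (N_ k) (a_ k) x - self_conv (N_ k) (a_ k) y)); last by ring.
  apply: le_trans (ler_normD _ _) _.
  have := ler_normB (g x - self_conv (N_ k) (a_ k) x) (g y - self_conv (N_ k) (a_ k) y).
  by move: h1 h2 hb; clear; lra.
- move=> x; apply: (le_of_geometric _ _ e 2 eh e0') => k.
  have : 0 <= self_conv (N_ k) (a_ k) x.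
    apply: stieltjes_sum_ge0 => [s _|u v uv]; first by have [_ h _] := st k.
    by rewrite lerN2; apply: homo; rewrite lerD2l lerN2.
  by have := hg k x; rewrite ler_norml => /andP[h1 h2]; lra.
- by move=> k; exact: (refine_count _ _ _ _ _ _ (ref k)).
- move=> k s sN as0; have [Nk0 _ aN] := st k.
  set x := s%:R / _; set y := s.+1%:R / _.
  have xy : x <= y by rewrite ler_wpM2r ?invr_ge0// ler_nat.
  (* A cell that is empty at stage [k] has mass zero at all later stages, by [refine_nested]. *)
  have gap j : (k <= j)%N -> cdf (N_ j) (a_ j) y = cdf (N_ j) (a_ j) x.
    move=> kj; rewrite -(subnKC kj); elim: (j - k)%N => [|m IH].
      by rewrite addn0 /x /y !cdf_grid// big_ord_recr/= as0 addr0.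
    rewrite addnS; have [c hc] := refine_nested _ _ _ _ _ _ (ref (k + m)%N).
    apply/eqP; rewrite eq_le; apply/andP; split; last exact: homo.
    rewrite -subr_le0.
    by apply: le_trans (hc _ _ xy) _; rewrite IH subrr mulr0.
  apply/eqP; rewrite -subr_eq0 -normr_le0.
  apply: (le_of_geometric _ _ (fun j => e (k + j)%N) 4) => [j|j|j]; rewrite ?addnS//.
  by have := hFB (k + j)%N x y; rewrite gap ?leq_addr// subrr subr0 add0r.
Qed.

End salem_limit.

(** * The measure with a given distribution function *)

Section stieltjes_measure.
Context {R : realType}.

(** This is the Lebesgue-Stieltjes measure of [F]. Its total mass is the limit of the masses of
    []-n, n]], hence [F 1]; the restriction to the whole line supplies the structure of a finite
    measure. *)
Lemma unit_cdf_measure (F : R -> R) : {homo F : x y / x <= y} -> continuous F ->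
  (forall x, x <= 0 -> F x = 0) -> (forall x, 1 <= x -> F x = F 1) ->
  exists mu : {finite_measure set R -> \bar R}, mu setT = (F 1)%:E /\
    forall a b, a <= b -> mu `]a, b]%classic = (F b - F a)%:E.
Proof.
move=> Fh Fc F0 F1.
have Frc : right_continuous F by exact: right_continuousW.
pose G : cumulative R R := HB.pack F (isCumulative.Build R _ R F Fh Frc).
pose mu0 : {measure set (measurableTypeR R) -> \bar R} := lebesgue_stieltjes_measure G.
have muE (a b : R) : a <= b -> mu0 `]a, b]%classic = (F b - F a)%:E.
  move=> ab; rewrite /mu0 /= /lebesgue_stieltjes_measure /measure_extension measurable_mu_extE/=; last exact: is_ocitv.
  by rewrite wlength_itv_bnd.
have muT : mu0 setT = (F 1)%:E.
  rewrite -(bigcup_itvT false false).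
  pose I n : set R := `]- (n%:R), n%:R]%classic.
  have h : (mu0 \o I) n @[n --> \oo] --> mu0 (\bigcup_n I n).
    apply: nondecreasing_cvg_mu; rewrite /I//; first exact: bigcup_measurable.
    by move=> *; apply/subsetPset/subset_itv; rewrite leBSide/= ?lerN2 ler_nat.
  apply: (cvg_unique _ h) => //; apply: cvg_near_cst.
  exists 1%N => // n /= n1; rewrite muE; last by rewrite (@le_trans _ _ 0)// oppr_le0.
  by rewrite F1 ?ler1n// (F0 (- _)) ?oppr_le0// subr0.
have fin : fin_num_fun mu0 by apply: lty_fin_num_fun; rewrite muT ltry.
pose nu : set R -> \bar R := mu0.
pose mu1 : {measure set R -> \bar R} := HB.pack nu
  (isMeasure.Build _ R R nu (measure0 mu0) (measure_ge0 mu0) (@measure_semi_sigma_additive _ _ _ mu0)).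
have muoo : (mu1 setT < +oo)%E by rewrite muT ltry.
exists (mfrestr measurableT muoo); split => [|a b ab]; rewrite /= /mfrestr /mrestr setIT//.
exact: muE.
Qed.

End stieltjes_measure.

(** * Integrals as sums over cells *)

Section cell_sums.
Context {R : realType} (F : R -> R) (mu : {finite_measure set R -> \bar R}).
Hypothesis Fh : {homo F : x y / x <= y}.
Hypothesis F0 : forall x, x <= 0 -> F x = 0.
Hypothesis muT : mu setT = (F 1)%:E.
Hypothesis muE : forall a b, a <= b -> mu `]a, b]%classic = (F b - F a)%:E.

Lemma cdf_measure_support : mu (~` `]0, 1]%classic) = 0%E.
Proof.
have F00 : F 0 = 0 by exact: F0.
rewrite -setTD measureD//=; last by rewrite muT ltry.
by rewrite setTI muE// F00 subr0 muT subee.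
Qed.

Lemma bounded_integrable (A : set R) (phi : R -> R) (M : R) : measurable A ->
  measurable_fun setT phi -> (forall x, `|phi x| <= M) ->
  mu.-integrable A (EFin \o phi).
Proof.
move=> mA mphi phiM; apply: measurable_bounded_integrable => //.
- by rewrite -ge0_fin_numE// fin_num_measure.
- exact: measurable_funTS.
- exists M; split => [|x Mx y _]; first exact: num_real.
  exact: le_trans (phiM y) (ltW Mx).
Qed.

Lemma Rintegral_cdf_unit (phi : R -> R) (M : R) : measurable_fun setT phi ->
  (forall x, `|phi x| <= M) ->
  Rintegral mu setT phi = Rintegral mu `]0, 1]%classic phi.
Proof.
move=> mphi phiM; rewrite -(setUv `]0, 1]%classic) Rintegral_setU//.
- rewrite [X in _ + X](_ : _ = 0) ?addr0//.
  rewrite /Rintegral (null_set_integral _ _ _)//.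
  + exact: measurableC.
  + by apply/measurable_EFinP; exact: measurable_funTS.
  + exact: cdf_measure_support.
- exact: measurableC.
- by rewrite setUv; exact: (bounded_integrable _ _ M).
- by apply/disj_setPCl.
Qed.

Lemma Rintegral_cell_approx (A : set R) (phi : R -> R) (M c w : R) : measurable A ->
  measurable_fun setT phi -> (forall x, `|phi x| <= M) ->
  (forall x, A x -> `|phi x - c| <= w) ->
  `|Rintegral mu A phi - c * fine (mu A)| <= w * fine (mu A).
Proof.
move=> mA mphi phiM phic.
have iphi := bounded_integrable A phi M mA mphi phiM.
have icst (d : R) : mu.-integrable A (EFin \o cst d).
  by apply: (bounded_integrable A (cst d) `|d|).
have mpc : measurable_fun setT (fun x => phi x - c).
  by apply: measurable_funB => //.
have ipc : mu.-integrable A (EFin \o (fun x => phi x - c)).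
  apply: (bounded_integrable A _ (M + `|c|) mA mpc) => x.
  by apply: le_trans (ler_normB _ _) _; rewrite lerD2r.
rewrite -(Rintegral_cst mu mA) -RintegralB//; last exact: icst.
apply: (le_trans (le_normr_Rintegral mA ipc)).
rewrite -(Rintegral_cst mu mA); apply: le_Rintegral => //; last exact: icst.
exact: integrable_norm ipc.
Qed.

(** [mu] lives on []0, 1]], the disjoint union of the half-open cells; on each of them [phi] is
    within [w] of its value at the left end, and the errors are weighted by masses that add up to
    [F 1]. *)
Lemma Rintegral_cells (N : nat) (phi : R -> R) (M w : R) : (0 < N)%N ->
  measurable_fun setT phi -> (forall x, `|phi x| <= M) ->
  (forall s, (s < N)%N -> forall x, s%:R / N%:R < x <= s.+1%:R / N%:R ->
     `|phi x - phi (s%:R / N%:R)| <= w) ->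
  `|Rintegral mu setT phi -
    \sum_(s < N) phi (s%:R / N%:R) * (F (s.+1%:R / N%:R) - F (s%:R / N%:R))| <= w * F 1.
Proof.
move=> N0 mphi phiM phiw; rewrite (Rintegral_cdf_unit phi M)//.
have Npos : 0 < N%:R :> R by rewrite ltr0n.
have F00 : F 0 = 0 by exact: F0.
suff H n : (n <= N)%N -> `|Rintegral mu `]0, n%:R / N%:R]%classic phi -
    \sum_(s < n) phi (s%:R / N%:R) * (F (s.+1%:R / N%:R) - F (s%:R / N%:R))| <= w * F (n%:R / N%:R).
  by have := H N (leqnn _); rewrite divff// gt_eqF.
elim: n => [_|n IH nN].
  by rewrite mul0r set_itvoc0 Rintegral_set0 big_ord0 subrr normr0 F00 mulr0.
have nn : n%:R / N%:R <= n.+1%:R / N%:R :> R by rewrite ler_wpM2r ?invr_ge0// ler_nat.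
have n0 : 0 <= n%:R / N%:R :> R by rewrite divr_ge0.
rewrite (@itv_bndbnd_setU _ _ (BRight 0) (BRight (n%:R / N%:R)) (BRight (n.+1%:R / N%:R)))//.
rewrite Rintegral_setU//; last 2 first.
  - by apply: (bounded_integrable _ _ M) => //; exact: measurableU.
  - apply/disj_setPLR => x /=; rewrite !in_itv/= => /andP[_ x1] /andP[x2 _].
    by move: x2; rewrite ltNge x1.
have := Rintegral_cell_approx `](n%:R / N%:R), (n.+1%:R / N%:R)]%classic phi M (phi (n%:R / N%:R)) w
  (measurable_itv _) mphi phiM.
rewrite muE//= => h1.
have {}h1 := h1 (fun x hx => phiw n nN x hx).
have h2 := IH (ltnW nN).
rewrite big_ord_recr/= opprD addrACA; apply: le_trans (ler_normD _ _) _.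
by apply: le_trans (lerD h2 h1) _; rewrite -mulrDr addrC subrK.
Qed.

End cell_sums.

(** * Weak convergence and Fourier decay *)

Section weak_limit.
Context {R : realType}.

Lemma holder_cont (f : R -> R) (C a : R) : 0 < a ->
  (forall x y, `|f x - f y| <= C * `|x - y| `^ a) -> continuous f.
Proof.
move=> a0 hf x; apply/cvgrPdist_lt => e e0.
have C0 : 0 <= C.
  by have := hf 1 0; rewrite subr0 normr1 powR1 mulr1; apply: le_trans.
pose d := (e / (C + 1)) `^ a^-1.
have c1 : 0 < C + 1 by rewrite ltr_wpDl.
have d0 : 0 < d by rewrite powR_gt0// divr_gt0.
apply/nbhs_ballP; exists d => //= y; rewrite /ball/= => xy.
apply: (le_lt_trans (hf x y)).
have h : `|x - y| `^ a <= e / (C + 1).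
  have -> : e / (C + 1) = d `^ a.
    by rewrite /d -powRrM mulVf ?gt_eqF// powRr1// divr_ge0// ltW.
  by rewrite ge0_ler_powR ?nnegrE ?(ltW a0) ?(ltW d0) ?(ltW xy).
apply: (le_lt_trans (ler_wpM2l C0 h)).
by rewrite mulrA ltr_pdivrMr// mulrC ltr_pM2l// ltrDl.
Qed.

Lemma le_of_inv_size (N_ : nat -> nat) K (x y c : R) : (forall k, (k < N_ k)%N) ->
  (forall k, (K <= k)%N -> x <= y + c / (N_ k)%:R) -> x <= y.
Proof.
move=> hN h; apply/ler_addgt0Pr => d d0.
pose k := maxn K (Num.truncn (`|c| / d)).
apply: (le_trans (h k (leq_maxl _ _))); rewrite lerD2l.
have Npos : 0 < (N_ k)%:R :> R by rewrite ltr0n (leq_ltn_trans _ (hN k)).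
rewrite ler_pdivrMr// mulrC -ler_pdivrMr//.
have : 0 <= `|c| / d by rewrite divr_ge0// ltW.
move=> /truncn_itv/andP[_ h1].
apply: (@le_trans _ _ (`|c| / d)); first by rewrite ler_wpM2r ?invr_ge0 ?(ltW d0)// ler_norm.
apply: (le_trans (ltW h1)); rewrite ler_nat; apply: leq_ltn_trans (hN k).
exact: leq_maxr.
Qed.

Variables (alpha : R) (N_ : nat -> nat) (a_ : nat -> nat -> R) (e : nat -> R) (F g : R -> R).
Hypothesis S : salem_limit alpha N_ a_ e F g.
Variable mu : {finite_measure set R -> \bar R}.
Hypothesis muT : mu setT = (F 1)%:E.
Hypothesis muE : forall a b, a <= b -> mu `]a, b]%classic = (F b - F a)%:E.

Let Npos k : 0 < (N_ k)%:R :> R.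
Proof. by have [h _ _] := lim_state _ _ _ _ _ _ S k; rewrite ltr0n. Qed.

Let N1 k : 1 <= (N_ k)%:R :> R.
Proof. by rewrite ler1n; have [h _ _] := lim_state _ _ _ _ _ _ S k. Qed.

Let eN k : e k <= (N_ k)%:R^-1 ^+ 2.
Proof.
by rewrite exprVn -div1r ler_pdivlMr ?exprn_gt0// (lim_e_N _ _ _ _ _ _ S).
Qed.

Lemma lim_cell k s : (s < N_ k)%N ->
  `|F (s.+1%:R / (N_ k)%:R) - F (s%:R / (N_ k)%:R) - a_ k s / (N_ k)%:R| <= 4 * e k.
Proof.
move=> sN; have [N0 a0 aN] := lim_state _ _ _ _ _ _ S k.
have -> : a_ k s / (N_ k)%:R = cdf (N_ k) (a_ k) (s.+1%:R / (N_ k)%:R) - cdf (N_ k) (a_ k) (s%:R / (N_ k)%:R).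
  by rewrite !cdf_grid// big_ord_recr/= -mulrBl addrAC subrr add0r.
have h1 := lim_cdf _ _ _ _ _ _ S k (s.+1%:R / (N_ k)%:R).
have h2 := lim_cdf _ _ _ _ _ _ S k (s%:R / (N_ k)%:R).
move: h1 h2; set x := F _; set y := F _; set u := cdf _ _ _; set v := cdf _ _ _ => h1 h2.
rewrite (_ : x - y - (u - v) = (x - u) - (y - v)); last by ring.
by apply: le_trans (ler_normB _ _) _; lra.
Qed.

Lemma lim_mass k : (\sum_(s < N_ k) a_ k s) / (N_ k)%:R <= F 1 + 2.
Proof.
have [N0 a0 aN] := lim_state _ _ _ _ _ _ S k.
rewrite -(cdf_ge1 _ _ _ N0 (lexx 1)).
have := lim_cdf _ _ _ _ _ _ S k 1; rewrite ler_norml => /andP[h _].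
have : e k <= 1 by apply: le_trans (eN k) _; rewrite expr_le1 ?invr_ge0 ?invf_le1.
lra.
Qed.

(** Three errors of order [1 / N_ k] add up: the oscillation of [phi] on a cell; the difference, at
    most [4 * e k], between the mass of a cell and [a_ k s / N_ k]; and the difference between the
    left value of [phi] and its mean over a cell, which by the mean value theorem for [psi] is also
    a value of [phi] there. *)
Lemma weak_approx (phi psi : R -> R) (Lam : R) k : 0 <= Lam -> (forall x, `|phi x| <= 1) ->
  (forall x y, `|phi x - phi y| <= Lam * `|x - y|) -> (forall x : R, is_derive x (1 : R) psi (phi x)) ->
  `|Rintegral mu setT phi - stieltjes_sum (N_ k) (a_ k) psi|
    <= (Lam * F 1 + 4 + Lam * (F 1 + 2)) / (N_ k)%:R.
Proof.
move=> Lam0 phi1 philip dpsi.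
have [N0 a0 aN] := lim_state _ _ _ _ _ _ S k.
have pn s := lim_cell k s.
have cphi : continuous phi.
  apply: (holder_cont phi Lam 1) => // x y; by rewrite powRr1.
have mphi : measurable_fun setT phi by exact: continuous_measurable_fun.
have F1 : 0 <= F 1 by exact: ltW (lim_F1_gt0 _ _ _ _ _ _ S).
set N := (N_ k)%:R in pn *; have NN : 0 < N := Npos k.
have step (s : nat) : s.+1%:R / N - s%:R / N = N^-1 by rewrite -mulrBl -natrB// subSnn mul1r.
have h1 := Rintegral_cells F mu (lim_F0 _ _ _ _ _ _ S) muT muE (N_ k) phi 1 (Lam / N) N0 mphi phi1.
have {}h1 : `|Rintegral mu setT phi - \sum_(s < N_ k) phi (s%:R / N) * (F (s.+1%:R / N) - F (s%:R / N))|
    <= Lam / N * F 1.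
  apply: h1 => s sN x /andP[x1 x2]; apply: (le_trans (philip _ _)); rewrite ler_wpM2l//.
  by rewrite ger0_norm ?subr_ge0 ?(ltW x1)//; move: (step s) x2; lra.
have h2 : `|\sum_(s < N_ k) phi (s%:R / N) * (F (s.+1%:R / N) - F (s%:R / N))
    - \sum_(s < N_ k) phi (s%:R / N) * (a_ k s / N)| <= 4 / N.
  rewrite -sumrB; apply: le_trans (ler_norm_sum _ _ _) _.
  apply: (@le_trans _ _ (\sum_(s < N_ k) 4 * e k)).
    apply: ler_sum => s _; rewrite -mulrBr normrM -[leRHS]mul1r ler_pM//.
    exact: pn.
  rewrite sumr_const card_ord -[leLHS]mulr_natr -/N -mulrA ler_wpM2l//.
  apply: (le_trans (ler_wpM2r (ltW NN) (eN k))).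
  by rewrite expr2 -mulrA mulVf ?mulr1 ?gt_eqF.
have h3 : `|\sum_(s < N_ k) phi (s%:R / N) * (a_ k s / N) - stieltjes_sum (N_ k) (a_ k) psi|
    <= Lam * (F 1 + 2) / N.
  rewrite -sumrB; apply: le_trans (ler_norm_sum _ _ _) _.
  apply: (@le_trans _ _ (\sum_(s < N_ k) (a_ k s / N) * (Lam / N))).
    apply: ler_sum => s _.
    have lt : s%:R / N < s.+1%:R / N by rewrite ltr_pM2r ?invr_gt0// ltr_nat.
    have [|c hc E] := @MVT R psi phi _ _ lt (fun x _ => dpsi x).
      apply: derivable_within_continuous => x _; exact: (@ex_derive _ _ _ _ _ _ _ (dpsi x)).
    rewrite E (step s) (_ : _ - _ = a_ k s / N * (phi (s%:R / N) - phi c)); last by ring.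
    rewrite normrM ger0_norm ?divr_ge0 ?(ltW NN)//.
    rewrite ler_wpM2l ?divr_ge0 ?(ltW NN)//; apply: (le_trans (philip _ _)).
    rewrite ler_wpM2l// distrC.
    move: hc; rewrite in_itv/= => /andP[c1 c2].
    by rewrite ger0_norm ?subr_ge0 ?(ltW c1)//; move: (step s) c2; lra.
  rewrite -mulr_suml -mulr_suml mulrC mulrAC ler_wpM2r ?invr_ge0 ?(ltW NN)//.
  by rewrite ler_wpM2l// lim_mass.
set A := Rintegral _ _ _ in h1 *; set B := \sum_(s < N_ k) _ in h1 h2 *.
set D := \sum_(s < N_ k) _ in h2 h3 *.
set E := stieltjes_sum _ _ _ in h3 *.
rewrite (_ : A - E = (A - B) + ((B - D) + (D - E))); last by ring.
apply: le_trans (ler_normD _ _) _.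
have := ler_normD (B - D) (D - E).
rewrite !mulrDl (mulrAC Lam (F 1)); move: h1 h2 h3; lra.
Qed.

(** For fixed [xi] the error of [weak_approx] tends to [0], although its constant grows with [xi];
    the bounds uniform in [k] therefore pass to the limit. At [xi = 0] the total mass [F 1] is used
    instead. *)
Lemma ft_abs_limit (b : R) : 0 <= b < alpha -> exists C : R, forall xi : R,
  ft_abs mu (fun=> 1) (fun=> 0) xi <= C * (1 + `|xi|) `^ (- (b / 2)).
Proof.
move=> bal; have [C [K hC]] := lim_fourier _ _ _ _ _ _ S b bal.
have F1 : 0 <= F 1 by exact: ltW (lim_F1_gt0 _ _ _ _ _ _ S).
exists (2 * `|C| + F 1) => xi.
have w0 : 0 <= (1 + `|xi|) `^ (- (b / 2)) := powR_ge0 _ _.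
have sqrt2 (x y z : R) : `|x| <= z -> `|y| <= z -> Num.sqrt (x ^+ 2 + y ^+ 2) <= 2 * z.
  move=> xz yz; have z0 : 0 <= z := le_trans (normr_ge0 _) xz.
  apply: sqrt_le_sqr; first by rewrite mulr_ge0.
  have sq (u : R) : `|u| <= z -> u ^+ 2 <= z ^+ 2.
    by move=> uz; rewrite -(real_normK (num_real u)) lerXn2r// nnegrE.
  rewrite exprMn; have := sq x xz; have := sq y yz; have := sqr_ge0 z; lra.
pose w := 2 * pi * xi.
have -> : ft_abs mu (fun=> 1) (fun=> 0) xi =
   Num.sqrt (Rintegral mu setT (fun y => cos (w * y)) ^+ 2 + Rintegral mu setT (fun y => - sin (w * y)) ^+ 2).
  rewrite /ft_abs; congr (Num.sqrt (_ ^+ 2 + _ ^+ 2)); apply: eq_Rintegral => y _.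
    by rewrite mul1r mul0r addr0.
  by rewrite mul1r mul0r sub0r.
have [xi00|xi0] := eqVneq xi 0.
  have w00 : w = 0 by rewrite /w xi00 mulr0.
  have -> : Rintegral mu setT (fun y => cos (w * y)) = F 1.
    under eq_Rintegral do rewrite w00 mul0r cos0.
    by rewrite Rintegral_cst// mul1r -[RHS](congr1 fine muT).
  have -> : Rintegral mu setT (fun y => - sin (w * y)) = 0.
    under eq_Rintegral do rewrite w00 mul0r sin0 oppr0.
    by rewrite Rintegral_cst// mul0r.
  rewrite expr0n addr0 sqrtr_sqr ger0_norm// xi00 normr0 addr0 powR1 mulr1.
  by rewrite lerDr mulr_ge0.
have w1 : w != 0 by rewrite /w !mulf_neq0// gt_eqF// pi_gt0.
pose c := `|w| * F 1 + 4 + `|w| * (F 1 + 2).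
have lip (f : R -> R) : (forall x y, `|f x - f y| <= `|x - y|) ->
    forall x y, `|f (w * x) - f (w * y)| <= `|w| * `|x - y|.
  by move=> fl x y; rewrite (le_trans (fl _ _))// -mulrBr normrM.
have lipN (f : R -> R) : (forall x y, `|f x - f y| <= `|x - y|) ->
    forall x y, `|- f x - - f y| <= `|x - y|.
  by move=> fl x y; rewrite -opprD normrN.
have dcomp (f df : R -> R) : (forall x : R, is_derive x (1 : R) f (df x)) ->
    forall x : R, is_derive x (1 : R) (fun x => f (w * x) / w) (df (w * x)).
  move=> hf x.
  have h := is_deriveZ w^-1 (is_derive1_comp (hf (w * x)) (is_deriveZ w (is_derive_id x (1 : R)))).
  rewrite (_ : (fun x => f (w * x) / w) = w^-1 \*: (f \o (w \*: id))); last first.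
    by apply/funext => y /=; rewrite mulrC.
  apply: is_derive_eq h _.
  by rewrite /GRing.scale/= mulr1 mulrC mulfK.
have dsin := dcomp sin cos (@is_derive_sin R).
have dcos := dcomp cos (fun x => - sin x) (@is_derive_cos R).
have hre : `|Rintegral mu setT (fun y => cos (w * y))| <= `|C| * (1 + `|xi|) `^ (- (b / 2)).
  apply: (le_of_inv_size N_ K _ _ c (lim_size _ _ _ _ _ _ S)) => k Kk.
  have := weak_approx (fun y => cos (w * y)) (fun x => sin (w * x) / w) `|w| k (normr_ge0 _) (fun x => cos_max _)
    (lip _ cos_lip) dsin.
  have [h _] := hC k Kk xi xi0; move: h; rewrite -/w => h1 h2.
  rewrite -(subrK (stieltjes_sum (N_ k) (a_ k) (fun x => sin (w * x) / w)) (Rintegral _ _ _)).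
  rewrite addrC; apply: le_trans (ler_normD _ _) _; apply: lerD => //.
  by apply: (le_trans h1); rewrite ler_wpM2r// ler_norm.
have him : `|Rintegral mu setT (fun y => - sin (w * y))| <= `|C| * (1 + `|xi|) `^ (- (b / 2)).
  apply: (le_of_inv_size N_ K _ _ c (lim_size _ _ _ _ _ _ S)) => k Kk.
  have sb x : `|- sin (w * x)| <= 1 by rewrite normrN sin_max.
  have := weak_approx (fun y => - sin (w * y)) (fun x => cos (w * x) / w) `|w| k (normr_ge0 _) sb
    (lip (fun x => - sin x) (lipN _ sin_lip)) dcos.
  have [_ h] := hC k Kk xi xi0; move: h; rewrite -/w => h1 h2.
  have h3 : `|stieltjes_sum (N_ k) (a_ k) (fun x => cos (w * x) / w)| <= C * (1 + `|xi|) `^ (- (b / 2)).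
    have -> : stieltjes_sum (N_ k) (a_ k) (fun x => cos (w * x) / w)
        = - stieltjes_sum (N_ k) (a_ k) (fun x => - cos (w * x) / w).
      by rewrite /stieltjes_sum -[RHS]sumrN; apply: eq_bigr => s _; ring.
    by rewrite normrN.
  rewrite -(subrK (stieltjes_sum (N_ k) (a_ k) (fun x => cos (w * x) / w)) (Rintegral _ _ _)).
  rewrite addrC; apply: le_trans (ler_normD _ _) _; apply: lerD => //.
  by apply: (le_trans h3); rewrite ler_wpM2r// ler_norm.
apply: (le_trans (sqrt2 _ _ _ hre him)).
by rewrite [leRHS]mulrDl -mulrA lerDl mulr_ge0.
Qed.

End weak_limit.

(** * Support and Hausdorff content *)

Section support_dimension.
Context {R : realType}.

(** A point outside the support lies in a null ball with rational centre and radius [1 / (m + 1)],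
    and there are countably many such balls. *)
Lemma msupport_conull (mu : {finite_measure set R -> \bar R}) : mu.-negligible (~` msupport mu).
Proof.
pose B (n : nat) : set R := match unpickle n : option (rat * nat) with
  | Some (q, m) => if `[< mu (ball (ratr q : R) m.+1%:R^-1) = 0%E >] then ball (ratr q : R) m.+1%:R^-1 else set0
  | None => set0 end.
apply: (@negligibleS _ _ _ _ (\bigcup_n B n)); last first.
  apply: negligible_bigcup => n; rewrite /B; case: unpickle => [[q m]|]; last exact: negligible_set0.
  case: asboolP => [h|_]; last exact: negligible_set0.
  by exists (ball (ratr q : R) m.+1%:R^-1); split => //; exact: measurable_ball.
move=> x /= /existsNP[r /not_implyP[r0 /negP]].
rewrite lt0e measure_ge0 andbT negbK => /eqP mu0.
pose m := Num.truncn (2 / r).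
have m1 : m.+1%:R^-1 < r / 2.
  have h : 0 < 2 / r by rewrite divr_gt0.
  have := truncn_itv (ltW h); rewrite -/m => /andP[_ h2].
  by rewrite -[r / 2]invrK ltf_pV2 ?posrE ?invr_gt0 ?divr_gt0// invf_div.
have mpos : 0 < m.+1%:R^-1 :> R by rewrite invr_gt0.
have [q] : exists q, ratr q \in `]x - m.+1%:R^-1, (x + m.+1%:R^-1)[.
  by apply: rat_in_itvoo; rewrite ltrBlDr -addrA ltrDl addr_gt0.
rewrite in_itv/= => /andP[q1 q2].
have xq : `|ratr q - x| < m.+1%:R^-1 by rewrite ltr_distl q1 q2.
have sub : ball (ratr q : R) m.+1%:R^-1 `<=` ball x r.
  move=> y; rewrite /ball/= => qy.
  rewrite -(subrK (ratr q) x) -addrA (le_lt_trans (ler_normD _ _))// distrC.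
  by rewrite [ltRHS]splitr ltrD// ?(lt_trans xq)// (lt_trans qy).
have [n hn] : exists n, unpickle n = Some (q, m) by exists (pickle (q, m)); exact: pickleK.
exists n; first by [].
rewrite /B hn.
case: asboolP => [_|[]].
  by rewrite /ball/=.
apply/eqP; rewrite eq_le measure_ge0 andbT -mu0.
by apply: le_measure; rewrite ?inE//; exact: measurable_ball.
Qed.

Lemma diam_ge0 (A : set R) : (0 <= diam A)%E.
Proof. by apply: ereal_sup_ubound; left. Qed.

(** The finite bound [d] excludes the diameter [+oo], for which [fine] returns [0]. *)
Lemma diam_dist (A : set R) (d x y : R) : (diam A <= d%:E)%E -> A x -> A y ->
  `|x - y| <= fine (diam A).
Proof.
move=> Ad Ax Ay; have h : ((`|x - y|)%:E <= diam A)%E.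
  by apply: ereal_sup_ubound; right; exists x => //; exists y.
rewrite -lee_fin fineK// ge0_fin_numE ?diam_ge0//.
exact: le_lt_trans Ad (ltry _).
Qed.

Lemma diam_le (A : set R) (d : R) : 0 <= d -> (forall x y, A x -> A y -> `|x - y| <= d) ->
  (diam A <= d%:E)%E.
Proof.
move=> d0 h; apply: ge_ereal_sup => _ [->|[x Ax [y Ay <-]]]; first by rewrite lee_fin.
by rewrite lee_fin h.
Qed.

Lemma hausdorff_content_ge0 (s d : R) (A : set R) : (0 <= hausdorff_content_delta s d A)%E.
Proof.
apply: le_ereal_inf_tmp => _ [U _ <-]; apply: nneseries_ge0 => n _ _.
by rewrite lee_fin powR_ge0.
Qed.

End support_dimension.

(** * Dimension of the support *)

Section limit_dimension.
Context {R : realType}.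
Variables (alpha : R) (N_ : nat -> nat) (a_ : nat -> nat -> R) (e : nat -> R) (F g : R -> R).
Hypothesis S : salem_limit alpha N_ a_ e F g.
Variable mu : {finite_measure set R -> \bar R}.
Hypothesis muT : mu setT = (F 1)%:E.
Hypothesis muE : forall a b, a <= b -> mu `]a, b]%classic = (F b - F a)%:E.

Lemma limit_ball (a : R) : 0 < a < alpha -> exists C : R, forall x r, 0 < r ->
  (mu (ball x r) <= (C * r `^ a)%:E)%E.
Proof.
move=> aal; have [C [C0 hC]] := lim_F_holder _ _ _ _ _ _ S a aal.
exists (C * 2 `^ a) => x r r0.
have xr : x - r <= x + r by lra.
apply: (@le_trans _ _ (mu `]x - r, x + r]%classic)).
  apply: le_measure; rewrite ?inE//; first exact: measurable_ball.
  by move=> y; rewrite /ball/= in_itv/= ltr_distl => /andP[h1 h2]; apply/andP; split; lra.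
rewrite muE// lee_fin; apply: (le_trans (hC _ _ xr)).
rewrite -mulrA ler_wpM2l// -powRM// ?(ltW r0)// (_ : x + r - (x - r) = 2 * r)//.
by ring.
Qed.

Lemma limit_set1 (x : R) : 0 < alpha -> mu [set x] = 0%E.
Proof.
move=> al0; have [C hC] := limit_ball (alpha / 2) ltac:(apply/andP; split; lra).
apply/eqP; rewrite eq_le measure_ge0 andbT; apply/lee_addgt0Pr => d d0; rewrite add0e.
pose r := (d / (`|C| + 1)) `^ (alpha / 2)^-1.
have c1 : 0 < `|C| + 1 by rewrite ltr_wpDl.
have r0 : 0 < r by rewrite powR_gt0// divr_gt0.
apply: (@le_trans _ _ (mu (ball x r))).
  apply: le_measure; rewrite ?inE//; first exact: measurable_ball.
  by move=> y /= ->; exact: ballxx.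
apply: (le_trans (hC x r r0)); rewrite lee_fin /r -powRrM mulVf ?gt_eqF ?divr_gt0//.
rewrite powRr1 ?divr_ge0 ?(ltW d0) ?(ltW c1)// mulrCA ger_pMr// ler_pdivrMr// mul1r.
by rewrite (le_trans (ler_norm _))// lerDl.
Qed.

(** Mass distribution principle: a covering set of diameter [d > 0] lies in a ball of radius
    [3 * d], whose mass is at most a multiple of [d ^ s]. As the support carries the whole mass
    [F 1], the sum of the [d ^ s] is bounded below. *)
Lemma limit_dim_ge (s : R) : 0 < s < alpha -> hausdorff_measure s (msupport mu) != 0%E.
Proof.
move=> sal; have /andP[s0 sal'] := sal; have al0 : 0 < alpha := lt_trans s0 sal'.
have [C hC] := limit_ball s sal.
pose C' := (`|C| + 1) * 3 `^ s.
have C'0 : 0 < C' by rewrite mulr_gt0 ?powR_gt0// ltr_wpDl.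
have F1 := lim_F1_gt0 _ _ _ _ _ _ S.
suff h : ((F 1 / C')%:E <= hausdorff_content_delta s 1 (msupport mu))%E.
  rewrite gt_eqF//; apply: (@lt_le_trans _ _ (hausdorff_content_delta s 1 (msupport mu))).
    by apply: lt_le_trans h; rewrite lte_fin divr_gt0.
  by apply: ereal_sup_ubound; exists 1 => /=.
apply: le_ereal_inf_tmp => _ [U [Usub Ud] <-].
(* The covering sets may fail to be measurable, hence the enclosing sets [K]: the empty set, a point
   (which is null) for diameter [0], and a ball otherwise. *)
have hK i : exists K : set R, [/\ measurable K, U i `<=` K &
    (mu K <= (C' * (fine (diam (U i))) `^ s)%:E)%E].
  have [Ui0|/set0P[x Ux]] := eqVneq (U i) set0.
    exists set0; rewrite Ui0; split => //; rewrite measure0 lee_fin mulr_ge0 ?powR_ge0//.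
    exact: ltW.
  set d := fine (diam (U i)); have d0 : 0 <= d by rewrite fine_ge0// diam_ge0.
  have hd y : U i y -> `|x - y| <= d by exact: diam_dist (Ud i) Ux.
  have [d00|dn0] := eqVneq d 0.
    exists [set x]; split => //.
      move=> y /hd; rewrite d00 normr_le0 subr_eq0 => /eqP -> //.
    by rewrite limit_set1// lee_fin mulr_ge0 ?powR_ge0// ltW.
  have dpos : 0 < d by rewrite lt_neqAle eq_sym dn0.
  exists (ball x (3 * d)); split.
  - exact: measurable_ball.
  - by move=> y /hd; rewrite /ball/= => h; lra.
  - apply: (le_trans (hC x (3 * d) _)); first by rewrite mulr_gt0.
    rewrite lee_fin powRM// /C' -mulrA ler_wpM2r ?mulr_ge0 ?powR_ge0//.
    by rewrite (le_trans (ler_norm _))// lerDl.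
have [K hK'] := choice hK.
have muK : ((F 1)%:E <= \sum_(0 <= i <oo) mu (K i))%E.
  have [Z [mZ Z0 subZ]] := msupport_conull mu.
  have sub : setT `<=` Z `|` \bigcup_i K i.
    move=> x _; have [xs|xs] := pselect (msupport mu x); last by left; exact: subZ.
    by right; have [i _ Ux] := Usub x xs; exists i => //; have [_ h _] := hK' i; exact: h.
  have mK : measurable (\bigcup_i K i) by apply: bigcup_measurable => i _; have [] := hK' i.
  rewrite -muT; apply: (@le_trans _ _ (mu (Z `|` \bigcup_i K i))).
    by apply: le_measure; rewrite ?inE//; exact: measurableU.
  apply: (@le_trans _ _ (mu Z + mu (\bigcup_i K i))%E).
    exact: measureU2.
  rewrite Z0 add0e.
  by apply: measure_sigma_subadditive => // i; have [] := hK' i.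
have le2 : (\sum_(0 <= i <oo) mu (K i) <= C'%:E * \sum_(0 <= i <oo) ((fine (diam (U i))) `^ s)%:E)%E.
  rewrite -nneseriesZl; last by move=> i _; rewrite lee_fin powR_ge0.
  by apply: lee_nneseries => [i _ _|i _]; [exact: measure_ge0|rewrite -EFinM; have [] := hK' i].
have := le_trans muK le2.
case: (\sum_(0 <= i <oo) _)%E => [r| |].
- by rewrite -EFinM !lee_fin ler_pdivrMr// mulrC.
- by rewrite leey.
- by rewrite mulrNy gtr0_sg// mul1e leeNy_eq.
Qed.

(** Closed cells make their finite union closed; the value [set0] beyond [n] turns the family into a
    countable cover. *)
Definition kept_cell (n : nat) (A : nat -> R) (i : nat) : set R :=
  if (i < n)%N && (A i != 0) then `[i%:R / n%:R, i.+1%:R / n%:R]%classic else set0.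

(** The complement of the kept cells is open and null, since deleted cells have mass zero by
    [lim_gap] and [mu] lives on []0, 1]]. A small ball about a support point has positive mass and
    cannot lie in it. *)
Lemma limit_support_cover k : msupport mu `<=` \bigcup_i kept_cell (N_ k) (a_ k) i.
Proof.
have [n0 A0 An] := lim_state _ _ _ _ _ _ S k.
set n := N_ k in n0 An *; set A := a_ k in A0 An *.
have npos : 0 < n%:R :> R by rewrite ltr0n.
pose V := ~` \big[setU/set0]_(i <- iota 0 n) kept_cell n A i.
have openV : open V.
  apply: closed_openC; apply: closed_bigsetU => i _; rewrite /kept_cell.
  by case: ifP => _; [exact: itv_closed|exact: closed0].
have F1 := lim_F1_gt0 _ _ _ _ _ _ S.
pose D (i : nat) : set R := if A i == 0 then `]i%:R / n%:R, i.+1%:R / n%:R]%classic else set0.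
have negV : mu.-negligible V.
  apply: (@negligibleS _ _ _ _ (~` `]0, 1]%classic `|` \big[setU/set0]_(i <- iota 0 n) D i)); last first.
    apply: negligibleU.
      by exists (~` `]0, 1]%classic); split => //; [exact: measurableC|
        exact: (cdf_measure_support F mu (lim_F0 _ _ _ _ _ _ S) muT muE)].
    rewrite big_seq; apply: negligible_bigsetU => i; rewrite mem_iota add0n => /andP[_ iN].
    rewrite /D; case: eqP => [Ai|_]; last exact: negligible_set0.
    exists `]i%:R / n%:R, i.+1%:R / n%:R]%classic; split => //.
    apply: etrans (muE _ _ _) _; first by rewrite ler_wpM2r ?invr_ge0 ?ler0n// ler_nat.
    by rewrite (lim_gap _ _ _ _ _ _ S k i iN Ai) subrr.
  move=> x Vx; have [x01|] := pselect (`]0, 1]%classic x); last by left.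
  right; move: x01; rewrite /= in_itv/= => /andP[x0 x1].
  have xn0 : 0 < x * n%:R by rewrite mulr_gt0.
  (* Rounding up, not down, finds the cell []j / n, (j + 1) / n]] that contains [x]. *)
  have [j jE] : exists j : nat, Num.ceil (x * n%:R) = j.+1%:Z.
    by move: xn0; rewrite -ceil_gt0; case: (Num.ceil _) => [[|j]|j]// _; exists j.
  have /andP[h1 h2] := ceil_itv (x * n%:R); rewrite jE in h1 h2.
  rewrite -addn1 PoszD addrK in h1.
  have {}h1 : j%:R < x * n%:R by exact: h1.
  have {}h2 : x * n%:R <= j.+1%:R by exact: h2.
  have jn : (j < n)%N.
    by rewrite -(ltr_nat R) (lt_le_trans h1)// ger_pMl.
  have hx1 : j%:R / n%:R < x by rewrite ltr_pdivrMr.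
  have hx2 : x <= j.+1%:R / n%:R by rewrite ler_pdivlMr.
  rewrite -bigcup_seq; exists j; first by rewrite /= mem_iota.
  rewrite /D; case: eqP => [_|/eqP Aj]; first by rewrite /= in_itv/= hx1 hx2.
  case: Vx; rewrite -bigcup_seq; exists j; first by rewrite /= mem_iota.
  by rewrite /kept_cell jn Aj/= in_itv/= (ltW hx1) hx2.
move=> x xs; have [xV|/contrapT xV] := pselect (V x); last first.
  move: xV; rewrite -bigcup_seq => -[i _ hi]; exists i => //.
have [r /= r0 rV] : nbhs_ball x V by apply/nbhs_ballP; exact: open_nbhs_nbhs.
have := xs r r0; rewrite measure_negligible ?ltxx//; first exact: measurable_ball.
exact: negligibleS rV negV.
Qed.

(** The kept cells, at most [4 * N ^ alpha] of diameter at most [1 / N], contribute at most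
    [4 * N ^ (alpha - s)], which tends to [0]. *)
Lemma limit_dim_le (s : R) : 0 < alpha < s -> hausdorff_measure s (msupport mu) = 0%E.
Proof.
move=> /andP[al0 sal]; have s0 : 0 < s := lt_trans al0 sal.
apply/eqP; rewrite eq_le; apply/andP; split; last first.
  apply: (@le_trans _ _ (hausdorff_content_delta s 1 (msupport mu))).
    exact: hausdorff_content_ge0.
  by apply: ereal_sup_ubound; exists 1 => /=.
apply: ge_ereal_sup => _ [d /= d0 <-]; apply/lee_addgt0Pr => eta eta0; rewrite add0e.
have [n1 hn1] := powR_unbounded (4 / eta) (s - alpha) ltac:(rewrite subr_gt0//).
pose k := maxn n1 (Num.truncn d^-1).
have [n0 A0 An] := lim_state _ _ _ _ _ _ S k.+1.
have count := lim_count _ _ _ _ _ _ S k.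
have kn := lim_size _ _ _ _ _ _ S k.+1.
set n := N_ k.+1 in n0 An count kn *; set A := a_ k.+1 in A0 An count *.
have npos : 0 < n%:R :> R by rewrite ltr0n.
have {}hn1 : 4 / eta <= n%:R `^ (s - alpha).
  by apply: hn1; rewrite (leq_trans (leq_maxl _ _) (ltnW (ltnW kn))).
have nd : n%:R^-1 <= d.
  rewrite -[d]invrK lef_pV2 ?posrE ?invr_gt0//.
  have := truncn_itv (_ : 0 <= d^-1); rewrite invr_ge0 (ltW d0) => /(_ isT)/andP[_ /ltW h].
  by apply: (le_trans h); rewrite ler_nat (leq_trans _ (ltnW kn))// ltnS leq_maxr.
have n1pos : 0 <= n%:R^-1 :> R by rewrite invr_ge0 ltW.
have dU i : (diam (kept_cell n A i) <= (n%:R^-1)%:E)%E.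
  apply: diam_le => // x y; rewrite /kept_cell; case: ifP => // _.
  rewrite /= !in_itv/= => /andP[x1 x2] /andP[y1 y2].
  have st : i.+1%:R / n%:R - i%:R / n%:R = n%:R^-1 :> R by rewrite -mulrBl -natrB// subSnn mul1r.
  by rewrite ler_norml; apply/andP; split; move: x1 x2 y1 y2 st; lra.
have fin i : diam (kept_cell n A i) \is a fin_num.
  by rewrite ge0_fin_numE ?diam_ge0// (le_lt_trans (dU i))// ltry.
have dfU i : fine (diam (kept_cell n A i)) <= n%:R^-1 by rewrite -lee_fin fineK.
apply: (@le_trans _ _ (\sum_(0 <= i <oo) ((fine (diam (kept_cell n A i))) `^ s)%:E)%E).
  apply: ereal_inf_lbound; exists (kept_cell n A) => //; split.
    exact: limit_support_cover.
  by move=> i; apply: (le_trans (dU i)); rewrite lee_fin.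
rewrite (nneseries_split 0 n); last by move=> i _; rewrite lee_fin powR_ge0.
rewrite add0n eseries0 ?adde0; last first.
  move=> i ni _; rewrite /kept_cell ltnNge ni/= (_ : diam set0 = 0%E) ?powR0 ?gt_eqF//.
  apply/eqP; rewrite eq_le diam_ge0 andbT; exact: diam_le.
rewrite sumEFin lee_fin big_mkord.
apply: (@le_trans _ _ (\sum_(i < n | A i != 0) n%:R^-1 `^ s)).
  rewrite [leRHS]big_mkcond; apply: ler_sum => i _; case: ifP => Ai.
    by rewrite ge0_ler_powR ?nnegrE ?(ltW s0)// fine_ge0// diam_ge0.
  rewrite /kept_cell Ai andbF (_ : diam set0 = 0%E) ?powR0 ?gt_eqF//.
  apply/eqP; rewrite eq_le diam_ge0 andbT; exact: diam_le.
rewrite sumr_const -[leLHS]mulr_natr.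
have -> : n%:R^-1 `^ s = n%:R `^ (- s) :> R by rewrite -(powR_inv1 (ltW npos)) -powRrM mulN1r.
apply: (le_trans (ler_wpM2l (powR_ge0 _ _) count)).
rewrite mulrCA -powRD ?(gt_eqF npos) ?implybT// (_ : - s + alpha = - (s - alpha)); last by ring.
rewrite powRN ler_pdivrMr ?powR_gt0// mulrC -ler_pdivrMr//.
Qed.

Lemma limit_dim : 0 < alpha -> hausdorff_dim (msupport mu) = alpha%:E.
Proof.
move=> al0; apply/eqP; rewrite eq_le; apply/andP; split.
  apply/lee_addgt0Pr => d d0; apply: ereal_inf_lbound; exists (alpha + d) => //=; split.
    by rewrite addr_gt0.
  by apply: limit_dim_le; rewrite al0 ltrDl.
apply: le_ereal_inf_tmp => _ [s /= [s0 hs] <-]; rewrite lee_fin leNgt; apply/negP => sal.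
by have := limit_dim_ge s; rewrite s0 sal hs eqxx => /(_ isT).
Qed.

End limit_dimension.

(** * Distribution function of the self-convolution *)

Section convolution_density.
Context {R : realType}.

Lemma le_of_inv_powR (N_ : nat -> nat) (x y c r : R) : 0 < r -> (forall k, (k < N_ k)%N) ->
  (forall k, x <= y + c * (N_ k)%:R `^ (- r)) -> x <= y.
Proof.
move=> r0 hN h; apply/ler_addgt0Pr => d d0.
have [n0 hn0] := powR_unbounded (`|c| / d) r r0.
have := hn0 (N_ n0) (ltnW (hN n0)) => h1.
apply: (le_trans (h n0)); rewrite lerD2l powRN.
have Npos : 0 < (N_ n0)%:R `^ r by rewrite powR_gt0// ltr0n (leq_ltn_trans _ (hN n0)).
rewrite ler_pdivrMr// (le_trans (ler_norm _))// mulrC -ler_pdivrMr//.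
Qed.

Variables (alpha : R) (N_ : nat -> nat) (a_ : nat -> nat -> R) (e : nat -> R) (F g : R -> R).
Hypothesis al01 : 0 < alpha < 1.
Hypothesis S : salem_limit alpha N_ a_ e F g.
Variable mu : {finite_measure set R -> \bar R}.
Hypothesis muT : mu setT = (F 1)%:E.
Hypothesis muE : forall a b, a <= b -> mu `]a, b]%classic = (F b - F a)%:E.

(** By Fubini this is the mass that [mu * mu] gives to the half-line up to [t]. *)
Definition conv_cdf (t : R) : R := Rintegral mu setT (fun y : R => F (t - y)).

Lemma lim_F_cont : continuous F.
Proof.
have al2 : 0 < alpha / 2 < alpha by case/andP: al01 => *; apply/andP; split; lra.
have [C [C0 hC]] := lim_F_holder _ _ _ _ _ _ S _ al2.
apply: (holder_cont F C (alpha / 2)); first by case/andP: al2.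
move=> x y; have Fh := lim_homo _ _ _ _ _ _ S.
case/orP: (le_total x y) => xy.
  by rewrite distrC (distrC x) !ger0_norm ?subr_ge0 ?Fh// hC.
by rewrite !ger0_norm ?subr_ge0 ?Fh// hC.
Qed.

Lemma lim_F_bound x : 0 <= F x <= F 1.
Proof.
have Fh := lim_homo _ _ _ _ _ _ S; have F0 := lim_F0 _ _ _ _ _ _ S.
have F1 := lim_F1 _ _ _ _ _ _ S.
case/orP: (le_total x 0) => x0; first by rewrite F0// lexx -(F0 0)// Fh.
by case/orP: (le_total x 1) => x1; [rewrite -{1}(F0 0)// !Fh|rewrite (F1 x)// lexx -{1}(F0 0)// Fh].
Qed.

Lemma conv_cdf_fun (t : R) : measurable_fun setT (fun y : R => F (t - y)) /\
  mu.-integrable setT (EFin \o (fun y : R => F (t - y))).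
Proof.
have m : measurable_fun setT (fun y : R => F (t - y)).
  apply: continuous_measurable_fun => x.
  apply: (@continuous_comp _ _ _ (fun y => t - y) F); last exact: lim_F_cont.
  by apply: cvgB; [exact: cvg_cst|exact: cvg_id].
split => //; apply: (bounded_integrable mu _ _ (F 1)) => // x.
by have /andP[h1 h2] := lim_F_bound (t - x); rewrite ger0_norm.
Qed.

Lemma conv_cdf_homo : {homo conv_cdf : s t / s <= t}.
Proof.
move=> s t st; apply: le_Rintegral => //; [exact: (conv_cdf_fun s).2|exact: (conv_cdf_fun t).2|].
by move=> y _; apply: (lim_homo _ _ _ _ _ _ S); rewrite lerD2r.
Qed.

Lemma conv_cdf_holder : exists C : R, 0 <= C /\ forall s t, s <= t ->
  conv_cdf t - conv_cdf s <= C * (t - s) `^ (alpha / 2).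
Proof.
have al2 : 0 < alpha / 2 < alpha by case/andP: al01 => *; apply/andP; split; lra.
have [C [C0 hC]] := lim_F_holder _ _ _ _ _ _ S _ al2.
have F1 : 0 <= F 1 by case/andP: (lim_F_bound 1).
exists (C * F 1); split; first by rewrite mulr_ge0.
move=> s t st; rewrite /conv_cdf -RintegralB//; [|exact: (conv_cdf_fun t).2|exact: (conv_cdf_fun s).2].
rewrite mulrAC -[X in _ <= _ * X](congr1 fine muT) -[leRHS](Rintegral_cst mu measurableT).
apply: le_Rintegral => //.
- rewrite (_ : EFin \o _ = ((EFin \o (fun y : R => F (t - y))) \- (EFin \o (fun y : R => F (s - y)))))%E//.
  by apply: integrableB => //; [exact: (conv_cdf_fun t).2|exact: (conv_cdf_fun s).2].
- by apply: (bounded_integrable mu _ (cst _) `|C * (t - s) `^ (alpha / 2)|).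
- move=> y _; have sty : s - y <= t - y by rewrite lerD2r.
  by apply: le_trans (hC _ _ sty) _; rewrite (_ : t - y - (s - y) = t - s)//; ring.
Qed.

(** At stage [k] the increment of the distribution function over a multiple of the mesh is a Riemann
    sum of [self_conv], which is close to [g] and hence, by Hoelder continuity, to [g a]. The
    discretization errors are multiples of [(N_ k) ^ (- rho)] and vanish as [k] grows. *)
Lemma conv_cdf_estimate : exists C gam : R, [/\ 0 <= C, 0 < gam,
  forall x y, `|g x - g y| <= C * `|x - y| `^ gam & forall a b, a <= b ->
  `|conv_cdf b - conv_cdf a - (b - a) * g a| <= C * (b - a) * (b - a) `^ gam].
Proof.
have [al0 al1] := andP al01.
have rho2 : 0 < alpha / 2 < alpha by apply/andP; split; lra.
set rho := alpha / 2 in rho2; have rho0 : 0 < rho by case/andP: rho2.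
have rho1 : rho <= 1 by rewrite /rho; lra.
have [CF [CF0 hCF]] := lim_F_holder _ _ _ _ _ _ S _ rho2.
have [CG [CG0 hCG]] := conv_cdf_holder.
have [gam [Cg [/andP[gam0 _] hg]]] := lim_g_holder _ _ _ _ _ _ S.
have F1 : 0 <= F 1 by case/andP: (lim_F_bound 1).
have Fh := lim_homo _ _ _ _ _ _ S.
exists `|Cg|, gam; split => //.
  by move=> x y; rewrite (le_trans (hg x y))// ler_wpM2r ?powR_ge0 ?ler_norm.
move=> a b ab; set h := b - a.
have h0 : 0 <= h by rewrite subr_ge0.
(* The summands are, in this order, the constants of the errors [T1], [T2], [T3], [T5], [T6] and
   [T7]. *)
pose c := 2 * CF * F 1 + 4 * F 1 + 4 * (F 1 + 2) + 2 * h + `|g a| + CG.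
apply: (le_of_inv_powR N_ _ _ c rho rho0 (lim_size _ _ _ _ _ _ S)) => k.
have [N0 A0 AN] := lim_state _ _ _ _ _ _ S k.
have cell := lim_cell _ _ _ _ _ _ S k.
have mass := lim_mass _ _ _ _ _ _ S k.
have ek0 := ltW (lim_e_gt0 _ _ _ _ _ _ S k).
have ekN := lim_e_N _ _ _ _ _ _ S k.
have hcdf := lim_cdf _ _ _ _ _ _ S k.
have hconv := lim_conv _ _ _ _ _ _ S k.
move: (N_ k) (a_ k) (e k) N0 A0 AN cell mass ek0 ekN hcdf hconv => N A ek N0 A0 AN cell mass ek0 ekN hcdf hconv.
have Npos : 0 < N%:R :> R by rewrite ltr0n.
have N1 : 1 <= N%:R :> R by rewrite ler1n.
set d := N%:R `^ (- rho); have d0 : 0 <= d by exact: powR_ge0.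
have nd : N%:R^-1 <= d.
  by rewrite -(powR_inv1 (ltW Npos)) ler_powR// lerN2.
have dE : N%:R^-1 `^ rho = d by rewrite -(powR_inv1 (ltW Npos)) -powRrM mulN1r.
have ekN' : ek * N%:R <= N%:R^-1.
  by rewrite -[leRHS]mul1r ler_pdivlMr// -mulrA -expr2.
have ek1 : ek <= N%:R^-1.
  by apply: le_trans ekN'; rewrite ler_peMr.
(* [b'] will be the last point up to [b] whose distance from [a] is a multiple of the mesh; [a]
   itself can lie anywhere. *)
pose m := Num.truncn (h * N%:R).
have /andP[m1 m2] := truncn_itv (mulr_ge0 h0 (ltW Npos)); rewrite -/m in m1 m2.
pose b' := a + m%:R / N%:R.
have mh : m%:R / N%:R <= h by rewrite ler_pdivrMr.
have hm : h - m%:R / N%:R <= N%:R^-1.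
  rewrite -(ler_pM2r Npos) mulVf ?gt_eqF// mulrBl divfK ?gt_eqF//.
  by move: m2; rewrite -natr1; lra.
have b'b : b' <= b by rewrite /b'; move: mh; rewrite /h; lra.
have ab' : a <= b' by rewrite /b' lerDl divr_ge0.
pose phi (y : R) := F (b' - y) - F (a - y).
pose phik (y : R) := cdf N A (b' - y) - cdf N A (a - y).
have phi01 y : 0 <= phi y <= F 1.
  have /andP[p1 p2] := lim_F_bound (b' - y); have /andP[p3 p4] := lim_F_bound (a - y).
  by rewrite /phi subr_ge0 Fh ?lerD2r//=; lra.
have T0 : Rintegral mu setT phi = conv_cdf b' - conv_cdf a.
  by rewrite -RintegralB//; [exact: (conv_cdf_fun b').2|exact: (conv_cdf_fun a).2].
have T1 : `|Rintegral mu setT phi - \sum_(s < N) phi (s%:R / N%:R) *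
    (F (s.+1%:R / N%:R) - F (s%:R / N%:R))| <= 2 * CF * d * F 1.
  apply: (Rintegral_cells F mu (lim_F0 _ _ _ _ _ _ S) muT muE N phi (F 1)) => //.
  - by apply: measurable_funB; [exact: (conv_cdf_fun b').1|exact: (conv_cdf_fun a).1].
  - by move=> x; have /andP[p1 p2] := phi01 x; rewrite ger0_norm.
  - move=> s sN x /andP[x1 x2].
    have st : s.+1%:R / N%:R - s%:R / N%:R = N%:R^-1 :> R by rewrite -mulrBl -natrB// subSnn mul1r.
    have hx t : 0 <= F (t - s%:R / N%:R) - F (t - x) <= CF * d.
      have le1 : t - x <= t - s%:R / N%:R by rewrite lerD2l lerN2 ltW.
      rewrite subr_ge0 Fh//=; apply: (le_trans (hCF _ _ le1)); rewrite ler_wpM2l// -dE.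
      rewrite (_ : t - s%:R / N%:R - (t - x) = x - s%:R / N%:R); last by ring.
      rewrite ge0_ler_powR ?nnegrE ?(ltW rho0) ?subr_ge0 ?invr_ge0 ?(ltW x1) ?(ltW Npos)//.
      by move: st x2; lra.
    have /andP[p1 p2] := hx b'; have /andP[p3 p4] := hx a.
    by rewrite /phi ler_norml; apply/andP; split; lra.
have T2 : `|\sum_(s < N) phi (s%:R / N%:R) * (F (s.+1%:R / N%:R) - F (s%:R / N%:R))
    - \sum_(s < N) phi (s%:R / N%:R) * (A s / N%:R)| <= 4 * F 1 * d.
  rewrite -sumrB; apply: le_trans (ler_norm_sum _ _ _) _.
  apply: (@le_trans _ _ (\sum_(s < N) F 1 * (4 * ek))).
    apply: ler_sum => s _; rewrite -mulrBr normrM ler_pM//; last exact: (cell s (ltn_ord s)).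
    by have /andP[p1 p2] := phi01 (s%:R / N%:R); rewrite ger0_norm.
  rewrite sumr_const card_ord -[leLHS]mulr_natr.
  rewrite (_ : F 1 * (4 * ek) * N%:R = 4 * F 1 * (ek * N%:R)); last by ring.
  by rewrite ler_wpM2l ?mulr_ge0// (le_trans ekN').
have sA0 : 0 <= (\sum_(s < N) A s) / N%:R by rewrite divr_ge0// sumr_ge0.
have T3 : `|\sum_(s < N) phi (s%:R / N%:R) * (A s / N%:R)
    - \sum_(s < N) phik (s%:R / N%:R) * (A s / N%:R)| <= 4 * (F 1 + 2) * d.
  rewrite -sumrB; apply: le_trans (ler_norm_sum _ _ _) _.
  apply: (@le_trans _ _ (\sum_(s < N) 4 * ek * (A s / N%:R))).
    apply: ler_sum => s _; rewrite -mulrBl normrM [`|A s / _|]ger0_norm ?divr_ge0//.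
    rewrite ler_wpM2r ?divr_ge0//.
    rewrite /phi /phik; have := hcdf (b' - s%:R / N%:R); have := hcdf (a - s%:R / N%:R).
    move: (F (b' - _)) (F (a - _)) (cdf N A (b' - _)) (cdf N A (a - _)) => u v u' v' q1 q2.
    rewrite (_ : u - v - (u' - v') = (u - u') - (v - v')); last by ring.
    by apply: le_trans (ler_normB _ _) _; lra.
  rewrite -mulr_sumr -mulr_suml.
  rewrite (_ : 4 * (F 1 + 2) * d = 4 * d * (F 1 + 2)); last by ring.
  by rewrite ler_pM// ?mulr_ge0// ler_wpM2l// (le_trans ek1).
(* [self_conv] is a weighted sum of increments of [cdf] over one mesh step; adding it up over [m]
   consecutive steps telescopes. *)
have T4 : \sum_(s < N) phik (s%:R / N%:R) * (A s / N%:R)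
    = N%:R^-1 * \sum_(n < m) self_conv N A (a + n.+1%:R / N%:R).
  rewrite /self_conv /stieltjes_sum exchange_big/= mulr_sumr; apply: eq_bigr => s _.
  pose u n := cdf N A (a + n%:R / N%:R - s%:R / N%:R).
  have -> : phik (s%:R / N%:R) = u m - u 0%N by rewrite /phik /u /b' mul0r addr0.
  rewrite -(telescope_sumr u (leq0n m)) big_mkord -mulr_sumr mulrC -[LHS]mulrA mulrCA.
  congr (_ * (_ * _)); apply: eq_bigr => n _.
  rewrite /u opprK [RHS]addrC; congr (_ - cdf N A _).
  by rewrite -!natr1; ring.
have T5 : `|N%:R^-1 * (\sum_(n < m) self_conv N A (a + n.+1%:R / N%:R)) - m%:R / N%:R * g a|
    <= `|Cg| * h * h `^ gam + 2 * h * d.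
  have -> : m%:R / N%:R * g a = N%:R^-1 * \sum_(n < m) g a.
    by rewrite sumr_const card_ord -mulr_natr; ring.
  rewrite -mulrBr -sumrB normrM (ger0_norm (_ : 0 <= N%:R^-1)) ?invr_ge0 ?(ltW Npos)//.
  have key : \sum_(n < m) `|self_conv N A (a + n.+1%:R / N%:R) - g a| <=
      m%:R * (`|Cg| * h `^ gam + 2 * d).
    apply: (@le_trans _ _ (\sum_(n < m) (`|Cg| * h `^ gam + 2 * d))); last first.
      by rewrite sumr_const card_ord -[leLHS]mulr_natl.
    apply: ler_sum => n _.
    have h1 := hconv (a + n.+1%:R / N%:R).
    have h2 := hg (a + n.+1%:R / N%:R) a.
    have nh : n.+1%:R / N%:R <= h.
      by apply: le_trans mh; rewrite ler_wpM2r ?invr_ge0 ?(ltW Npos)// ler_nat.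
    rewrite -(subrK (g (a + n.+1%:R / N%:R)) (self_conv _ _ _)) -addrA addrC.
    apply: le_trans (ler_normD _ _) _; apply: lerD; last first.
      by rewrite distrC (le_trans h1)// ler_wpM2l// (le_trans ek1).
    apply: (le_trans h2); rewrite addrAC subrr add0r.
    apply: (@le_trans _ _ (`|Cg| * `|n.+1%:R / N%:R| `^ gam)).
      by rewrite ler_wpM2r ?powR_ge0 ?ler_norm.
    rewrite ler_wpM2l// ge0_ler_powR ?nnegrE ?(ltW gam0)//.
    by rewrite ger0_norm// divr_ge0.
  apply: (@le_trans _ _ (N%:R^-1 * (m%:R * (`|Cg| * h `^ gam + 2 * d)))).
    rewrite ler_wpM2l ?invr_ge0 ?(ltW Npos)//; exact: le_trans (ler_norm_sum _ _ _) key.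
  rewrite mulrA (mulrC _ m%:R).
  rewrite (_ : `|Cg| * h * h `^ gam + 2 * h * d = h * (`|Cg| * h `^ gam + 2 * d)); last by ring.
  by rewrite ler_wpM2r// addr_ge0 ?mulr_ge0 ?powR_ge0.
have T6 : `|m%:R / N%:R * g a - h * g a| <= `|g a| * d.
  rewrite -mulrBl normrM mulrC ler_wpM2l// distrC ger0_norm ?subr_ge0//.
  exact: le_trans hm nd.
have T7 : `|conv_cdf b' - conv_cdf b| <= CG * d.
  rewrite distrC ger0_norm ?subr_ge0 ?conv_cdf_homo//.
  apply: (le_trans (hCG _ _ b'b)); rewrite ler_wpM2l// -dE.
  rewrite ge0_ler_powR ?nnegrE ?(ltW rho0) ?subr_ge0 ?invr_ge0 ?(ltW Npos)//.
  by rewrite /b' opprD addrA.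
rewrite T4 in T3.
move: T1 T2 T3 T5 T6 T7; rewrite T0.
set x1 := conv_cdf b'; set x2 := conv_cdf b; set x0 := conv_cdf a.
set s1 := \sum_(s < N) _; set s2 := \sum_(s < N) _; set s3 := N%:R^-1 * _; set s4 := m%:R / N%:R * _.
set hg' := h * g a; set big := `|Cg| * h * _ => T1 T2 T3 T5 T6 T7.
rewrite (_ : x2 - x0 - hg' = (x1 - x0 - s1) + ((s1 - s2) + ((s2 - s3) + ((s3 - s4) + ((s4 - hg') - (x1 - x2)))))); last by ring.
do 4 (apply: le_trans (ler_normD _ _) _; rewrite -lerBrDl).
rewrite /c; have := ler_normB (s4 - hg') (x1 - x2).
move: T1 T2 T3 T5 T6 T7.
lra.
Qed.

End convolution_density.

(** * Density of the self-convolution *)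

Section convolution_density_measure.
Context {R : realType}.

Lemma is_derive_powR_estimate (f : R -> R) (x l C r : R) : 0 < r ->
  (forall h, `|f (x + h) - f x - h * l| <= C * `|h| * `|h| `^ r) -> is_derive x 1 f l.
Proof.
move=> r0 hf.
have cv : h^-1 *: (f (h *: (1 : R) + x) - f x) @[h --> (0 : R)^'] --> l.
  apply/cvgrPdist_lt => /= eps eps0.
  have [dd [dd0 hdd]] : exists dd : R, 0 < dd /\ `|C| * dd `^ r < eps.
    exists ((eps / (`|C| + 1)) `^ r^-1); split.
      by apply: powR_gt0; apply: divr_gt0 => //; apply: ltr_wpDl.
    rewrite -powRrM mulVf ?gt_eqF// powRr1 ?divr_ge0 ?addr_ge0// ?(ltW eps0)//.
    by rewrite mulrA ltr_pdivrMr ?ltr_wpDl// mulrC ltr_pM2l// ltrDl.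
  near=> h.
  have h0 : h != 0 by near: h; exact: nbhs_dnbhs_neq.
  have hdel : `|h| < dd.
    near: h; apply: dnbhs0_lt => //.
  rewrite /GRing.scale/= mulr1 (addrC h).
  rewrite (_ : l - h^-1 * (f (x + h) - f x) = - (h^-1 * (f (x + h) - f x - h * l))); last by field.
  rewrite normrN normrM normfV ltr_pdivrMl ?normr_gt0//.
  apply: le_lt_trans (hf h) _.
  rewrite (mulrC C) -mulrA ltr_pM2l ?normr_gt0//.
  apply: le_lt_trans hdd; apply: (@le_trans _ _ (`|C| * `|h| `^ r)).
    by rewrite ler_wpM2r ?powR_ge0// ler_norm.
  by rewrite ler_wpM2l// ge0_ler_powR ?nnegrE ?(ltW r0) ?(ltW hdel) ?(ltW dd0)//; exact: ltW (le_lt_trans (normr_ge0 h) hdel).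
have dv : derivable f x 1 by apply/cvg_ex; exists l.
apply: DeriveDef => //.
exact: cvg_lim cv.
Unshelve. all: by end_near.
Qed.

Variables (alpha : R) (N_ : nat -> nat) (a_ : nat -> nat -> R) (e : nat -> R) (F g : R -> R).
Hypothesis al01 : 0 < alpha < 1.
Hypothesis S : salem_limit alpha N_ a_ e F g.
Variable mu : {finite_measure set R -> \bar R}.
Hypothesis muT : mu setT = (F 1)%:E.
Hypothesis muE : forall a b, a <= b -> mu `]a, b]%classic = (F b - F a)%:E.

Let G := conv_cdf F mu.

Lemma lim_g_cont : continuous g.
Proof.
have [gam [C [/andP[g0 _] hg]]] := lim_g_holder _ _ _ _ _ _ S.
exact: (holder_cont g C gam).
Qed.

(** For [h < 0] the estimate is based at [x + h]; the Hoelder continuity of [g] moves it to [x],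
    which doubles the constant. *)
Lemma conv_cdf_derive (x : R) : is_derive x (1 : R) G (g x).
Proof.
have [C [r [C0 r0 hg hC]]] := conv_cdf_estimate alpha N_ a_ e F g al01 S mu muT muE.
apply: (is_derive_powR_estimate G x (g x) (2 * C) r) => // h.
case/orP: (le_total 0 h) => h0.
  have xh : x <= x + h by rewrite lerDl.
  have := hC _ _ xh; rewrite (_ : x + h - x = h); last by ring.
  rewrite (ger0_norm h0) => h1.
  by apply: (le_trans h1); rewrite -!mulrA; apply: ler_peMl; rewrite ?ler1n// !mulr_ge0 ?powR_ge0.
have xh : x + h <= x by rewrite gerDl.
have := hC _ _ xh; have := hg x (x + h).
rewrite (_ : x - (x + h) = - h); last by ring.
rewrite normrN (ler0_norm h0) => h2 h1.
rewrite (_ : G (x + h) - G x - h * g x = - h * (g x - g (x + h)) - (G x - G (x + h) - - h * g (x + h))); last by ring.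
apply: le_trans (ler_normB _ _) _.
have -> : 2 * C * - h * (- h) `^ r = - h * (C * (- h) `^ r) + C * - h * (- h) `^ r by ring.
apply: lerD => //; rewrite normrM (ger0_norm (_ : 0 <= - h)) ?oppr_ge0// ler_wpM2l ?oppr_ge0//.
Qed.

Lemma conv_cdf_cont : continuous G.
Proof.
by move=> x; have [/derivable1_diffP d _] := conv_cdf_derive x; exact: differentiable_continuous.
Qed.

Lemma conv_cdf_integral a b : a <= b ->
  (\int[lebesgue_measure]_(x in `]a, b]) (g x)%:E = (G b - G a)%:E)%E.
Proof.
rewrite le_eqVlt => /orP[/eqP->|ab].
  by rewrite subrr set_itv_ge ?bnd_simp ?ltxx// integral_set0.
have mg : measurable_fun setT g by exact: continuous_measurable_fun lim_g_cont.
rewrite integral_itv_obnd_cbnd; last by apply/measurable_EFinP; exact: measurable_funTS.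
rewrite (@continuous_FTC2 R g G a b)//.
- by apply: continuous_subspaceT => x; exact: lim_g_cont.
- split.
  + by move=> x _; have [] := conv_cdf_derive x.
  + by apply: cvg_at_right_filter; exact: conv_cdf_cont.
  + by apply: cvg_at_left_filter; exact: conv_cdf_cont.
- by move=> x _; rewrite derive1E; have [] := conv_cdf_derive x.
Qed.

Lemma measurable_add_preimage (A : set R) : measurable A ->
  measurable [set z : R * R | A (z.1 + z.2)].
Proof.
move=> mA.
have m : measurable_fun setT (fun z : R * R => z.1 + z.2).
  by apply: measurable_funD; [exact: measurable_fst|exact: measurable_snd].
by rewrite -[X in measurable X]setTI; exact: m.
Qed.

Lemma conv_itv a b : a <= b ->
  ((mu \x mu) [set z : R * R | a < z.1 + z.2 <= b]%R = (G b - G a)%:E)%E.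
Proof.
move=> ab; rewrite /product_measure1/=.
transitivity (\int[mu]_x ((fun x => F (b - x)) x - F (a - x))%:E)%E.
  apply: eq_integral => x _ /=.
  rewrite (_ : xsection _ x = `]a - x, b - x]%classic) ?muE ?lerD2r//.
  apply/seteqP; split => y; rewrite /xsection/= in_setE /= in_itv/= ltrBlDl lerBrDl//.
have [m1 i1] := conv_cdf_fun alpha N_ a_ e F g al01 S mu a.
have [m2 i2] := conv_cdf_fun alpha N_ a_ e F g al01 S mu b.
rewrite /G /conv_cdf -RintegralB// /Rintegral fineK//.
apply: integrable_fin_num => //.
exact: (@integrableB _ _ _ mu setT measurableT _ _ i2 i1).
Qed.

Lemma stieltjes_measure_unique (H : R -> R) (m1 m2 : {measure set R -> \bar R}) :
  {homo H : x y / x <= y} -> continuous H ->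
  (forall a b, a <= b -> m1 `]a, b]%classic = (H b - H a)%:E) ->
  (forall a b, a <= b -> m2 `]a, b]%classic = (H b - H a)%:E) ->
  forall A, measurable A -> m1 A = m2 A.
Proof.
move=> Hh Hc h1 h2 A mA.
have Hrc : right_continuous H by exact: right_continuousW.
pose K : cumulative R R := HB.pack H (isCumulative.Build R _ R H Hh Hrc).
have key (m : {measure set R -> \bar R}) :
    (forall a b, a <= b -> m `]a, b]%classic = (H b - H a)%:E) ->
    lebesgue_stieltjes_measure K A = m A.
  move=> hm; pose f : set R -> \bar R := m.
  pose m' : {measure set (measurableTypeR R) -> \bar R} := HB.pack f
    (isMeasure.Build _ (measurableTypeR R) R f (measure0 m) (measure_ge0 m) (@measure_semi_sigma_additive _ _ _ m)).
  transitivity (m' A) => //.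
  apply: (@lebesgue_stieltjes_measure_unique R K m') => // I [[a b]]/= _ <-.
  rewrite /lebesgue_stieltjes_measure /measure_extension measurable_mu_extE/=; last exact: is_ocitv.
  have [ab|ba] := ltP a b; last first.
    by rewrite set_itv_ge ?wlength0 ?measure0// bnd_simp -leNgt.
  rewrite wlength_itv_bnd ?(ltW ab)//; apply: esym; exact: (hm a b (ltW ab)).
by rewrite -(key m1 h1) (key m2 h2).
Qed.

(** Both sides are measures in [A]. On []a, b]] each is the increment of [conv_cdf]: the left one by
    its definition as an iterated integral, the right one by the fundamental theorem of calculus. *)
Lemma conv_density (A : set R) : measurable A ->
  ((mu \x mu) [set z : R * R | A (z.1 + z.2)%R] =
    \int[lebesgue_measure]_(x in A) (g x)%:E)%E.
Proof.
move=> mA.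
have g0 := lim_g_ge0 _ _ _ _ _ _ S.
have mg : measurable_fun setT (EFin \o g).
  by apply/measurable_EFinP; exact: continuous_measurable_fun lim_g_cont.
pose f1 (B : set R) := (mu \x mu)%E [set z : R * R | B (z.1 + z.2)].
pose f2 (B : set R) := (\int[lebesgue_measure]_(x in B) (g x)%:E)%E.
have f10 : f1 set0 = 0%E by rewrite /f1 (_ : [set z | _] = set0) ?measure0//.
have f20 : f2 set0 = 0%E by rewrite /f2 integral_set0.
have f1ge B : (0 <= f1 B)%E by exact: measure_ge0.
have f2ge B : (0 <= f2 B)%E by apply: integral_ge0 => x _; rewrite lee_fin.
have f1s : semi_sigma_additive f1.
  move=> B mB tB mUB; rewrite /f1.
  rewrite (_ : [set z | _] = \bigcup_i [set z : R * R | B i (z.1 + z.2)]); last first.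
    by apply/seteqP; split => z.
  apply: measure_semi_sigma_additive => //.
  - by move=> i; exact: measurable_add_preimage.
  - move=> i j _ _ [z [z1 z2]]; apply: tB => //; by exists (z.1 + z.2).
  - by apply: bigcup_measurable => i _; exact: measurable_add_preimage.
have f2s : semi_sigma_additive f2.
  have gE (x : R) : (0 <= (EFin \o g) x)%E by rewrite lee_fin.
  exact: (@semi_sigma_additive_nng_induced _ _ _ lebesgue_measure (EFin \o g) mg gE).
pose m1 : {measure set R -> \bar R} := HB.pack f1 (isMeasure.Build _ R R f1 f10 f1ge f1s).
pose m2 : {measure set R -> \bar R} := HB.pack f2 (isMeasure.Build _ R R f2 f20 f2ge f2s).
apply: (stieltjes_measure_unique G m1 m2) => //.
- exact: (conv_cdf_homo alpha N_ a_ e F g al01 S mu).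
- exact: conv_cdf_cont.
- by move=> a b ab; rewrite -conv_itv.
- by move=> a b ab; rewrite -conv_cdf_integral.
Qed.

End convolution_density_measure.

(** * Linearity and the Cauchy-Schwarz inequality *)

Section finite_Rintegral.
Context {R : realType} {d : measure_display} {T : measurableType d}.
Variable mu : {measure set T -> \bar R}.

Lemma Rintegral_comb (a b : R) (f1 f2 : T -> R) :
  mu.-integrable setT (EFin \o f1) -> mu.-integrable setT (EFin \o f2) ->
  mu.-integrable setT (EFin \o (fun x => a * f1 x + b * f2 x)) /\
  Rintegral mu setT (fun x => a * f1 x + b * f2 x) =
    a * Rintegral mu setT f1 + b * Rintegral mu setT f2.
Proof.
move=> i1 i2.
have j1 : mu.-integrable setT (EFin \o (fun x => a * f1 x)) by exact: (integrableZl measurableT _ i1).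
have j2 : mu.-integrable setT (EFin \o (fun x => b * f2 x)) by exact: (integrableZl measurableT _ i2).
split; first exact: (integrableD measurableT j1 j2).
by rewrite RintegralD// !RintegralZl.
Qed.

Lemma Rintegral_sum (f : nat -> T -> R) (n : nat) :
  (forall j, mu.-integrable setT (EFin \o f j)) ->
  mu.-integrable setT (EFin \o (fun x => \sum_(j < n) f j x)) /\
  Rintegral mu setT (fun x => \sum_(j < n) f j x) = \sum_(j < n) Rintegral mu setT (f j).
Proof.
move=> hf; elim: n => [|n [IH1 IH2]].
  have -> : (fun x => \sum_(j < 0) f j x) = cst 0 by apply/funext => x; rewrite big_ord0.
  by rewrite big_ord0 Rintegral_cst// mul0r; split => //; exact: integrable0.
have -> : (fun x => \sum_(j < n.+1) f j x) = (fun x => \sum_(j < n) f j x + f n x).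
  by apply/funext => x; rewrite big_ord_recr.
by rewrite big_ord_recr/= RintegralD// IH2; split => //; exact: (integrableD measurableT IH1 (hf n)).
Qed.

Definition sqint (a : T -> R) := measurable_fun setT a /\
  mu.-integrable setT (EFin \o (fun x => a x ^+ 2)).

Lemma sqint_mul (a b : T -> R) : sqint a -> sqint b ->
  mu.-integrable setT (EFin \o (fun x => a x * b x)).
Proof.
move=> [ma ia] [mb ib].
apply: (le_integrable measurableT _ _ (integrableD measurableT ia ib)).
  by apply/measurable_EFinP; exact: measurable_funM.
move=> x _; rewrite /= lee_fin [leRHS]ger0_norm ?addr_ge0 ?sqr_ge0//.
rewrite normrM -(real_normK (num_real (a x))) -(real_normK (num_real (b x))).
by have := sqr_ge0 (`|a x| - `|b x|); have := sqr_ge0 (`|a x| + `|b x|); lra.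
Qed.

Lemma quadratic_discriminant (A B C : R) : 0 <= A -> 0 <= C ->
  (forall t, 0 <= A * t ^+ 2 - 2 * t * B + C) -> B ^+ 2 <= A * C.
Proof.
move=> A0 C0 h; have [A00|An] := eqVneq A 0.
  move: h; rewrite A00 => h.
  have [->|Bn] := eqVneq B 0; first by rewrite expr0n mul0r.
  have := h ((C + 1) / (2 * B)).
  have -> : 0 * ((C + 1) / (2 * B)) ^+ 2 - 2 * ((C + 1) / (2 * B)) * B + C = - 1 by field.
  lra.
have Ap : 0 < A by rewrite lt_neqAle eq_sym An.
have := h (B / A).
have -> : A * (B / A) ^+ 2 - 2 * (B / A) * B + C = C - B ^+ 2 / A by field.
by rewrite subr_ge0 ler_pdivrMr// mulrC.
Qed.

(** A pair stands for the real and imaginary part of a complex function, and the left side for the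
    real part of an inner product. The inequality is the discriminant condition for the integral of
    [|t a - b| ^ 2]. *)
Lemma cauchy_schwarz2 (a1 a2 b1 b2 : T -> R) : sqint a1 -> sqint a2 -> sqint b1 -> sqint b2 ->
  Rintegral mu setT (fun x => a1 x * b1 x + a2 x * b2 x) ^+ 2 <=
  Rintegral mu setT (fun x => a1 x ^+ 2 + a2 x ^+ 2) *
  Rintegral mu setT (fun x => b1 x ^+ 2 + b2 x ^+ 2).
Proof.
move=> s1 s2 t1 t2.
have i1 := integrableD measurableT s1.2 s2.2.
have i2 := integrableD measurableT t1.2 t2.2.
have i3 := integrableD measurableT (sqint_mul _ _ s1 t1) (sqint_mul _ _ s2 t2).
apply: quadratic_discriminant.
- by apply: Rintegral_ge0 => x _; rewrite addr_ge0 ?sqr_ge0.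
- by apply: Rintegral_ge0 => x _; rewrite addr_ge0 ?sqr_ge0.
move=> t.
have [j1 E1] := Rintegral_comb (t ^+ 2) (- (2 * t)) _ _ i1 i3.
have [j2 E2] := Rintegral_comb 1 1 _ _ j1 i2.
move: E2; rewrite !mul1r E1 => E2.
rewrite (_ : _ - _ + _ = Rintegral mu setT (fun x => 1 * (t ^+ 2 * (a1 x ^+ 2 + a2 x ^+ 2) + - (2 * t) * (a1 x * b1 x + a2 x * b2 x)) + 1 * (b1 x ^+ 2 + b2 x ^+ 2))); last first.
  by rewrite E2 mulNr mulrC.
apply: Rintegral_ge0 => x _.
rewrite (_ : _ + _ = (t * a1 x - b1 x) ^+ 2 + (t * a2 x - b2 x) ^+ 2); last by ring.
by rewrite addr_ge0 ?sqr_ge0.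
Qed.

End finite_Rintegral.

(** * Orthogonality of the characters on [[0, 2]] *)

Section trig_orthogonality.
Context {R : realType}.

(** Encodes that [f] has integral [v] over [[0, 2]]; sums are handled by adding primitives. *)
Definition has_primitive (f : R -> R) (v : R) := exists Phi : R -> R,
  (forall u : R, is_derive u (1 : R) Phi (f u)) /\ Phi 2 - Phi 0 = v.

Lemma has_primitiveD f1 v1 f2 v2 : has_primitive f1 v1 -> has_primitive f2 v2 ->
  has_primitive (fun u => f1 u + f2 u) (v1 + v2).
Proof.
move=> [P1 [d1 e1]] [P2 [d2 e2]]; exists (fun u => P1 u + P2 u); split.
  by move=> u; exact: is_deriveD.
by rewrite -e1 -e2; ring.
Qed.

Lemma has_primitive_trig (w a b : R) : w != 0 -> cos (w * 2) = 1 -> sin (w * 2) = 0 ->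
  has_primitive (fun u => a * cos (w * u) + b * sin (w * u)) 0.
Proof.
move=> w0 h1 h2; exists (fun u => a / w * sin (w * u) - b / w * cos (w * u)); split.
  move=> u; apply: is_derive_eq.
  by rewrite /GRing.scale/= !mulr1; field.
by rewrite h1 h2 !mulr0 cos0 sin0; ring.
Qed.

Lemma has_primitive_cst c : has_primitive (fun=> c) (2 * c).
Proof.
exists (fun u => c * u); split; last by ring.
by move=> u; apply: is_derive_eq; rewrite /GRing.scale/= mulr1 ?mulr0 ?addr0.
Qed.

Variables (s : R) (p q : nat -> R).

(** [wave_re] and [wave_im] below are the real and imaginary part of
    [(p j + i q j) * exp (i * freq j * u)], the character of frequency [s + j / 2] with a complex
    coefficient. *)
Definition freq (j : nat) : R := 2 * pi * (s + j%:R / 2).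
Definition wave_re j (u : R) := p j * cos (freq j * u) - q j * sin (freq j * u).
Definition wave_im j (u : R) := q j * cos (freq j * u) + p j * sin (freq j * u).

(** Two frequencies differ by a nonzero multiple of [pi], so that each cross term has period [2] and
    mean [0]. *)
Lemma has_primitive_cross n k : (k <= n)%N ->
  has_primitive (fun u => 2 * (\sum_(j < k) (wave_re j u * wave_re n u + wave_im j u * wave_im n u))) 0.
Proof.
elim: k => [_|k IH kn].
  have := has_primitive_cst 0; rewrite mulr0.
  by rewrite (_ : (fun=> _) = (fun=> (0 : R)))//; apply/funext => u; rewrite big_ord0 mulr0.
pose w := pi * (n%:R - k%:R) : R.
have w0 : w != 0 by rewrite mulf_neq0 ?gt_eqF ?pi_gt0// subr_gt0 ltr_nat.
have wE : w * 2 = 0 + ((n - k)%N : int)%:~R * (2 * pi).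
  by rewrite /w -pmulrn natrB ?(ltnW kn)//; ring.
have := has_primitiveD _ _ _ _ (IH (ltnW kn)) (has_primitive_trig w
  (2 * (p k * p n + q k * q n)) (2 * (p k * q n - q k * p n) *-1) w0 _ _).
rewrite wE cos_periodz sin_periodz cos0 sin0 addr0 => /(_ erefl erefl).
congr (has_primitive _ _); apply/funext => u.
rewrite big_ord_recr/= [RHS]mulrDr; congr (_ + _).
have -> : w * u = freq n * u - freq k * u by rewrite /w /freq; field.
by rewrite cosB sinB /wave_re /wave_im; ring.
Qed.

Lemma has_primitive_square n : has_primitive
  (fun u => (\sum_(j < n) wave_re j u) ^+ 2 + (\sum_(j < n) wave_im j u) ^+ 2)
  (2 * \sum_(j < n) (p j ^+ 2 + q j ^+ 2)).
Proof.
elim: n => [|n IH].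
  have := has_primitive_cst 0; rewrite big_ord0 mulr0.
  by rewrite (_ : (fun=> _) = (fun=> (0 : R)))//; apply/funext => u; rewrite !big_ord0; ring.
have := has_primitiveD _ _ _ _ (has_primitiveD _ _ _ _ IH (has_primitive_cst (p n ^+ 2 + q n ^+ 2)))
  (has_primitive_cross n n (leqnn n)).
rewrite addr0 -mulrDr big_ord_recr/=.
congr (has_primitive _ _); apply/funext => u.
rewrite !big_ord_recr/=.
have -> : \sum_(j < n) (wave_re j u * wave_re n u + wave_im j u * wave_im n u) =
    (\sum_(j < n) wave_re j u) * wave_re n u + (\sum_(j < n) wave_im j u) * wave_im n u.
  by rewrite !mulr_suml -big_split.
have : wave_re n u ^+ 2 + wave_im n u ^+ 2 = p n ^+ 2 + q n ^+ 2.
  rewrite -[RHS]mulr1 -(cos2Dsin2 (freq n * u)) /wave_re /wave_im; ring.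
by move=> <-; ring.
Qed.

End trig_orthogonality.

(** * Duality for the transform along an arithmetic progression *)

Section discrete_restriction.
Context {R : realType} (mu : {finite_measure set R -> \bar R}).
Variables (fr fi : R -> R).
Hypothesis sr : sqint mu fr.
Hypothesis si : sqint mu fi.
Variable s : R.

Lemma sqint_bounded (w : R -> R) (M : R) : measurable_fun setT w -> (forall x, `|w x| <= M) -> sqint mu w.
Proof.
move=> mw wM; split => //.
apply: (bounded_integrable mu setT (fun x => w x ^+ 2) (M ^+ 2)) => //.
  exact: measurable_funX.
by move=> x; rewrite normrX lerXn2r// nnegrE// (le_trans _ (wM x)).
Qed.

Lemma measurable_cos_linear (c d : R) : measurable_fun setT (fun x : R => cos (c * x + d)).
Proof.
apply: measurableT_comp; first by apply: continuous_measurable_fun; exact: continuous_cos.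
by apply: measurable_funD => //; exact: measurable_funM.
Qed.

Lemma measurable_sin_linear (c d : R) : measurable_fun setT (fun x : R => sin (c * x + d)).
Proof.
apply: measurableT_comp; first by apply: continuous_measurable_fun; exact: continuous_sin.
by apply: measurable_funD => //; exact: measurable_funM.
Qed.

Lemma sqint_cos (c : R) : sqint mu (fun x => cos (c * x)).
Proof.
apply: (sqint_bounded _ 1) => [|x]; last exact: cos_max.
by have := measurable_cos_linear c 0; under eq_fun do rewrite addr0.
Qed.

Lemma sqint_sin (c : R) : sqint mu (fun x => sin (c * x)).
Proof.
apply: (sqint_bounded _ 1) => [|x]; last exact: sin_max.
by have := measurable_sin_linear c 0; under eq_fun do rewrite addr0.
Qed.

Let X j := ft_re mu fr fi (s + j%:R / 2).
Let Y j := ft_im mu fr fi (s + j%:R / 2).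
Let xf (j : nat) y := fr y * cos (freq s j * y) + fi y * sin (freq s j * y).
Let yf (j : nat) y := fi y * cos (freq s j * y) - fr y * sin (freq s j * y).

Let ixf j : mu.-integrable setT (EFin \o xf j).
Proof. exact: (integrableD measurableT (sqint_mul _ _ _ sr (sqint_cos _)) (sqint_mul _ _ _ si (sqint_sin _))). Qed.

Let iyf j : mu.-integrable setT (EFin \o yf j).
Proof. exact: (integrableB measurableT (sqint_mul _ _ _ si (sqint_cos _)) (sqint_mul _ _ _ sr (sqint_sin _))). Qed.

Variables (p q : nat -> R).

(** Put [f = fr + i fi], [F_j = X j + i Y j], and let [W_j] be the wave. Since [W_j] is
    multiplicative under translation, integrating [f x * conj (W_j (x + y))] in [x] gives
    [conj (W_j y) * F_j]. *)
Lemma wave_transform j y :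
  [/\ mu.-integrable setT (EFin \o (fun x => fr x * wave_re s p q j (x + y) + fi x * wave_im s p q j (x + y))),
   Rintegral mu setT (fun x => fr x * wave_re s p q j (x + y) + fi x * wave_im s p q j (x + y))
     = wave_re s p q j y * X j + wave_im s p q j y * Y j,
   mu.-integrable setT (EFin \o (fun x => fi x * wave_re s p q j (x + y) - fr x * wave_im s p q j (x + y))) &
   Rintegral mu setT (fun x => fi x * wave_re s p q j (x + y) - fr x * wave_im s p q j (x + y))
     = wave_re s p q j y * Y j - wave_im s p q j y * X j].
Proof.
have [i1 e1] := Rintegral_comb mu (wave_re s p q j y) (wave_im s p q j y) _ _ (ixf j) (iyf j).
have [i2 e2] := Rintegral_comb mu (wave_re s p q j y) (- wave_im s p q j y) _ _ (iyf j) (ixf j).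
have E1 : (fun x => fr x * wave_re s p q j (x + y) + fi x * wave_im s p q j (x + y)) =
    (fun x => wave_re s p q j y * xf j x + wave_im s p q j y * yf j x).
  by apply/funext => x; rewrite /wave_re /wave_im /xf /yf (mulrDr (freq s j)) cosD sinD; ring.
have E2 : (fun x => fi x * wave_re s p q j (x + y) - fr x * wave_im s p q j (x + y)) =
    (fun x => wave_re s p q j y * yf j x + - wave_im s p q j y * xf j x).
  by apply/funext => x; rewrite /wave_re /wave_im /xf /yf (mulrDr (freq s j)) cosD sinD; ring.
by rewrite E1 E2; split => //; rewrite e2 mulNr.
Qed.

Variable n : nat.

Let A u := \sum_(j < n) wave_re s p q j u.
Let B u := \sum_(j < n) wave_im s p q j u.
Let I1 y := \sum_(j < n) (wave_re s p q j y * X j + wave_im s p q j y * Y j).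
Let I2 y := \sum_(j < n) (wave_re s p q j y * Y j - wave_im s p q j y * X j).

Lemma wave_sum_transform y :
  Rintegral mu setT (fun x => fr x * A (x + y) + fi x * B (x + y)) = I1 y /\
  Rintegral mu setT (fun x => fi x * A (x + y) - fr x * B (x + y)) = I2 y.
Proof.
split.
  have [_ h] := Rintegral_sum mu (fun j x => fr x * wave_re s p q j (x + y) + fi x * wave_im s p q j (x + y)) n
     (fun j => let: And4 h _ _ _ := wave_transform j y in h).
  transitivity (\sum_(j < n) Rintegral mu setT (fun x => fr x * wave_re s p q j (x + y) + fi x * wave_im s p q j (x + y))).
    by rewrite -h; apply: eq_Rintegral => x _; rewrite /A /B !mulr_sumr -big_split.
  by apply: eq_bigr => j _; have [] := wave_transform j y.
have [_ h] := Rintegral_sum mu (fun j x => fi x * wave_re s p q j (x + y) - fr x * wave_im s p q j (x + y)) n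
     (fun j => let: And4 _ _ h _ := wave_transform j y in h).
transitivity (\sum_(j < n) Rintegral mu setT (fun x => fi x * wave_re s p q j (x + y) - fr x * wave_im s p q j (x + y))).
  by rewrite -h; apply: eq_Rintegral => x _; rewrite /A /B !mulr_sumr -sumrB.
by apply: eq_bigr => j _; have [] := wave_transform j y.
Qed.

(** A second integration against [f] turns [conj (W_j y) * F_j] into [conj (p j + i q j) * F_j ^ 2],
    and real parts are taken. It is [wave_transform] at the translation [0], where the wave equals
    its coefficient. *)
Lemma wave_sum_pairing :
  Rintegral mu setT (fun y => fr y * I1 y - fi y * I2 y) =
    \sum_(j < n) (p j * (X j ^+ 2 - Y j ^+ 2) + q j * (2 * X j * Y j)).
Proof.
have w0 j : wave_re s p q j 0 = p j /\ wave_im s p q j 0 = q j.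
  by rewrite /wave_re /wave_im mulr0 cos0 sin0; split; ring.
pose u j x := fr x * wave_re s p q j (x + 0) + fi x * wave_im s p q j (x + 0).
pose v j x := fi x * wave_re s p q j (x + 0) - fr x * wave_im s p q j (x + 0).
have H j : mu.-integrable setT (EFin \o (fun x => X j * u j x + - Y j * v j x)) /\
    Rintegral mu setT (fun x => X j * u j x + - Y j * v j x) =
      p j * (X j ^+ 2 - Y j ^+ 2) + q j * (2 * X j * Y j).
  have [i1 e1 i2 e2] := wave_transform j 0; have [w1 w2] := w0 j.
  have [i e] := Rintegral_comb mu (X j) (- Y j) _ _ i1 i2.
  by split => //; rewrite /u /v e e1 e2 w1 w2; ring.
have [_ h] := Rintegral_sum mu (fun j x => X j * u j x + - Y j * v j x) n (fun j => (H j).1).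
transitivity (\sum_(j < n) Rintegral mu setT (fun x => X j * u j x + - Y j * v j x)).
  rewrite -h; apply: eq_Rintegral => y _; rewrite /I1 /I2 !mulr_sumr -sumrB.
  by apply: eq_bigr => j _; rewrite /u /v addr0; ring.
by apply: eq_bigr => j _; exact: (H j).2.
Qed.

Let mwave j : measurable_fun setT (wave_re s p q j) /\ measurable_fun setT (wave_im s p q j).
Proof.
have h1 := (sqint_cos (freq s j)).1; have h2 := (sqint_sin (freq s j)).1.
split; first by apply: measurable_funB; apply: measurable_funM.
by apply: measurable_funD; apply: measurable_funM.
Qed.

Let wave_bound j u : `|wave_re s p q j u| <= `|p j| + `|q j| /\ `|wave_im s p q j u| <= `|p j| + `|q j|.
Proof.
have c := cos_max (freq s j * u); have d := sin_max (freq s j * u).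
split; rewrite /wave_re /wave_im.
  apply: (le_trans (ler_normB _ _)); rewrite !normrM lerD//; exact: ler_piMr.
by apply: (le_trans (ler_normD _ _)); rewrite !normrM addrC lerD//; exact: ler_piMr.
Qed.

Let sAB y : sqint mu (fun x => A (x + y)) /\ sqint mu (fun x => B (x + y)).
Proof.
pose M := \sum_(j < n) (`|p j| + `|q j|).
have m : measurable_fun setT (fun x : R => x + y) by exact: measurable_funD.
split; apply: (sqint_bounded _ M).
- apply: measurable_sum => j; apply: measurableT_comp => //; exact: (mwave j).1.
- by move=> x; apply: le_trans (ler_norm_sum _ _ _) _; apply: ler_sum => j _; exact: (wave_bound j _).1.
- apply: measurable_sum => j; apply: measurableT_comp => //; exact: (mwave j).2.
- by move=> x; apply: le_trans (ler_norm_sum _ _ _) _; apply: ler_sum => j _; exact: (wave_bound j _).2.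
Qed.

Let sI : sqint mu I1 /\ sqint mu I2.
Proof.
pose M := \sum_(j < n) ((`|p j| + `|q j|) * `|X j| + (`|p j| + `|q j|) * `|Y j|).
split; apply: (sqint_bounded _ M).
- apply: measurable_sum => j; apply: measurable_funD; apply: measurable_funM => //; [exact: (mwave j).1|exact: (mwave j).2].
- move=> y; apply: le_trans (ler_norm_sum _ _ _) _; apply: ler_sum => j _.
  have [h1 h2] := wave_bound j y.
  by apply: (le_trans (ler_normD _ _)); rewrite !normrM lerD// ler_wpM2r.
- apply: measurable_sum => j; apply: measurable_funB; apply: measurable_funM => //; [exact: (mwave j).1|exact: (mwave j).2].
- move=> y; apply: le_trans (ler_norm_sum _ _ _) _; apply: ler_sum => j _.
  have [h1 h2] := wave_bound j y.
  by apply: (le_trans (ler_normB _ _)); rewrite !normrM addrC lerD// ler_wpM2r.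
Qed.

(** Cauchy-Schwarz in [y], then in [x] for each [y]. The factor [2] comes from estimating [I1] and
    [I2] separately; [H] bounds the square of the wave sum integrated against [mu * mu]. *)
Lemma wave_sum_duality (H : R) :
  (\int[mu]_y \int[mu]_x (A (x + y) ^+ 2 + B (x + y) ^+ 2)%:E <= H%:E)%E ->
  (\sum_(j < n) (p j * (X j ^+ 2 - Y j ^+ 2) + q j * (2 * X j * Y j))) ^+ 2 <=
    2 * Rintegral mu setT (fun x => fr x ^+ 2 + fi x ^+ 2) ^+ 2 * H.
Proof.
move=> HH; set n2 := Rintegral _ _ _.
have n20 : 0 <= n2 by apply: Rintegral_ge0 => x _; rewrite addr_ge0 ?sqr_ge0.
have [s1 s2] := sI.
have snI2 : sqint mu (fun y => - I2 y).
  split; first by apply: measurableT_comp => //; exact: s2.1.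
  by rewrite (_ : (fun x => _) = (fun x => I2 x ^+ 2)); [exact: s2.2|apply/funext => x; rewrite sqrrN].
rewrite -wave_sum_pairing.
have := cauchy_schwarz2 mu fr fi I1 (fun y => - I2 y) sr si s1 snI2.
rewrite -/n2.
rewrite (_ : (fun x => fr x * I1 x + fi x * - I2 x) = (fun y => fr y * I1 y - fi y * I2 y)); last first.
  by apply/funext => x; rewrite mulrN.
rewrite (_ : (fun x => I1 x ^+ 2 + _) = (fun x => I1 x ^+ 2 + I2 x ^+ 2)); last first.
  by apply/funext => x; rewrite sqrrN.
move/le_trans; apply.
rewrite (_ : 2 * n2 ^+ 2 * H = n2 * (2 * n2 * H)); last by ring.
rewrite ler_wpM2l//.
have iI : mu.-integrable setT (EFin \o (fun x => I1 x ^+ 2 + I2 x ^+ 2)).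
  exact: (integrableD measurableT s1.2 s2.2).
rewrite -lee_fin /Rintegral fineK; last exact: integrable_fin_num.
have AB y : 0 <= Rintegral mu setT (fun x => A (x + y) ^+ 2 + B (x + y) ^+ 2).
  by apply: Rintegral_ge0 => x _; rewrite addr_ge0 ?sqr_ge0.
have iAB y : mu.-integrable setT (EFin \o (fun x => A (x + y) ^+ 2 + B (x + y) ^+ 2)).
  by have [t1 t2] := sAB y; exact: (integrableD measurableT t1.2 t2.2).
have key y : I1 y ^+ 2 + I2 y ^+ 2 <= 2 * n2 * Rintegral mu setT (fun x => A (x + y) ^+ 2 + B (x + y) ^+ 2).
  have [t1 t2] := sAB y; have [<- <-] := wave_sum_transform y.
  have c1 := cauchy_schwarz2 mu fr fi _ _ sr si t1 t2.
  have tn : sqint mu (fun x => - B (x + y)).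
    split; first by apply: measurableT_comp => //; exact: t2.1.
    by rewrite (_ : (fun x => _) = (fun x => B (x + y) ^+ 2)); [exact: t2.2|apply/funext => x; rewrite sqrrN].
  have := cauchy_schwarz2 mu fi fr _ _ si sr t1 tn.
  rewrite (_ : (fun x => fi x * A (x + y) + _) = (fun x => fi x * A (x + y) - fr x * B (x + y))); last first.
    by apply/funext => x; rewrite mulrN.
  rewrite (_ : (fun x => A (x + y) ^+ 2 + (- _) ^+ 2) = (fun x => A (x + y) ^+ 2 + B (x + y) ^+ 2)); last first.
    by apply/funext => x; rewrite sqrrN.
  rewrite (_ : (fun x => fi x ^+ 2 + _) = (fun x => fr x ^+ 2 + fi x ^+ 2)); last first.
    by apply/funext => x; rewrite addrC.
  move: c1; rewrite -/n2; set a := Rintegral _ _ _; set b := Rintegral _ _ _.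
  by rewrite -mulrA mulrDl mul1r; exact: lerD.
have mF : measurable_fun setT (fun y => \int[mu]_x (A (x + y) ^+ 2 + B (x + y) ^+ 2)%:E)%E.
  have mA : measurable_fun setT (fun z : R * R => (A (z.2 + z.1) ^+ 2 + B (z.2 + z.1) ^+ 2)%:E).
    apply/measurable_EFinP.
    have m : measurable_fun setT (fun z : R * R => z.2 + z.1).
      by apply: measurable_funD; [exact: measurable_snd|exact: measurable_fst].
    apply: measurable_funD; apply: measurable_funX; apply: measurable_sum => j; apply: measurableT_comp => //;
      [exact: (mwave j).1|exact: (mwave j).2].
  have A0 (z : R * R) : (0 <= (A (z.2 + z.1) ^+ 2 + B (z.2 + z.1) ^+ 2)%:E)%E.
    by rewrite lee_fin addr_ge0 ?sqr_ge0.
  exact: (@measurable_fun_fubini_tonelli_F _ _ _ _ R mu _ mA A0).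
apply: (@le_trans _ _ (\int[mu]_y ((2 * n2)%:E * \int[mu]_x (A (x + y) ^+ 2 + B (x + y) ^+ 2)%:E))%E).
  apply: ge0_le_integral => //.
  - by move=> y _; rewrite lee_fin addr_ge0 ?sqr_ge0.
  - by have /integrableP[] := iI.
  - by apply: measurable_funeM.
  - move=> y _; have := key y; rewrite -lee_fin /= => /le_trans; apply.
    by rewrite EFinM /Rintegral fineK//; exact: (integrable_fin_num measurableT (iAB y)).
rewrite ge0_integralZl//; last 2 first.
- by move=> y _; apply: integral_ge0 => x _; rewrite lee_fin addr_ge0 ?sqr_ge0.
- by rewrite lee_fin mulr_ge0.
by rewrite [leRHS]EFinM lee_wpmul2l// lee_fin mulr_ge0.
Qed.

End discrete_restriction.

(** * Measurability of the Fourier transform *)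

Section fourier_measurability.
Context {R : realType} (mu : {finite_measure set R -> \bar R}).

(** Tonelli applies to the positive and negative parts of [k]; their difference and then [fine]
    preserve measurability, whether or not the sections of [k] are integrable. *)
Lemma measurable_Rintegral_param (k : R * R -> R) : measurable_fun setT k ->
  measurable_fun setT (fun x => Rintegral mu setT (fun y => k (x, y))).
Proof.
move=> mk; have mK : measurable_fun setT (EFin \o k) by exact/measurable_EFinP.
have mp := @measurable_fun_fubini_tonelli_F _ _ _ _ R mu _ (measurable_funepos mK) (funepos_ge0 _).
have mn := @measurable_fun_fubini_tonelli_F _ _ _ _ R mu _ (measurable_funeneg mK) (funeneg_ge0 _).
apply: measurableT_comp; first exact: fine_measurable.
rewrite (_ : (fun x => _) = (fun x => fubini_F mu (EFin \o k)^\+ x - fubini_F mu (EFin \o k)^\- x)%E).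
  by apply: emeasurable_funB; [exact: mp|exact: mn].
by apply/funext => x; rewrite integralE /fubini_F; congr (_ - _)%E; apply: eq_integral => y _; rewrite ?funeposE ?funenegE.
Qed.

Lemma measurable_ft_abs (fr fi : R -> R) : measurable_fun setT fr -> measurable_fun setT fi ->
  measurable_fun setT (ft_abs mu fr fi).
Proof.
move=> mr mi.
have m1 : measurable_fun setT (fun z : R * R => 2 * pi * z.1 * z.2).
  by apply: measurable_funM; [apply: measurable_funM => //; exact: measurable_fst|exact: measurable_snd].
have mc : measurable_fun setT (fun z : R * R => cos (2 * pi * z.1 * z.2)).
  by apply: measurableT_comp => //; apply: continuous_measurable_fun; exact: continuous_cos.
have ms : measurable_fun setT (fun z : R * R => sin (2 * pi * z.1 * z.2)).
  by apply: measurableT_comp => //; apply: continuous_measurable_fun; exact: continuous_sin.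
have mr2 : measurable_fun setT (fun z : R * R => fr z.2) by apply: measurableT_comp => //; exact: measurable_snd.
have mi2 : measurable_fun setT (fun z : R * R => fi z.2) by apply: measurableT_comp => //; exact: measurable_snd.
apply: measurableT_comp; first by apply: continuous_measurable_fun; exact: sqrt_continuous.
apply: measurable_funD; apply: measurable_funX.
  apply: (measurable_Rintegral_param (fun z => fr z.2 * cos (2 * pi * z.1 * z.2) + fi z.2 * sin (2 * pi * z.1 * z.2))).
  by apply: measurable_funD; exact: measurable_funM.
apply: (measurable_Rintegral_param (fun z => fi z.2 * cos (2 * pi * z.1 * z.2) - fr z.2 * sin (2 * pi * z.1 * z.2))).
by apply: measurable_funB; exact: measurable_funM.
Qed.

End fourier_measurability.

(** * Integration over translates *)

Section translates.
Context {R : realType}.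

Lemma lebesgue_measure_shift (c : R) (A : set R) : measurable A ->
  pushforward lebesgue_measure (+%R c : _ -> measurableTypeR R) A = lebesgue_measure A.
Proof.
move=> mA; apply/esym/lebesgue_measure_unique => //= [|_ _ [[a b]] _ <-]; first exact: measurable_funD.
rewrite /pushforward (_ : _ @^-1` _ = `]a - c, b - c]%classic).
  by rewrite !lebesgue_measure_itv/= !lte_fin ltrD2r -!EFinD (_ : b - c - (a - c) = b - a)//; ring.
by apply/seteqP; split => x /=; rewrite !in_itv/= ltrBlDl lerBrDl.
Qed.

Lemma integral_itv_shift (c a b : R) (phi : R -> R) : measurable_fun setT phi -> (forall x, 0 <= phi x) ->
  (\int[lebesgue_measure]_(x in (`](c + a)%R, (c + b)%R]%classic : set R)) (phi x)%:E =
   \int[lebesgue_measure]_(x in (`]a, b]%classic : set R)) (phi (c + x)%R)%:E)%E.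
Proof.
move=> mphi phi0.
have E : (`]a, b]%classic : set R) = (+%R c : _ -> measurableTypeR R) @^-1` (`]c + a, c + b]%classic).
  by apply/seteqP; split => x /=; rewrite !in_itv/= ltrD2l lerD2l.
have m : measurable_fun setT (+%R c : R -> measurableTypeR R) by exact: measurable_funD.
rewrite E.
have PF := @ge0_integral_pushforward _ _ (measurableTypeR R) (measurableTypeR R) R _ m lebesgue_measure
   (`]c + a, c + b]%classic : set R) (EFin \o phi).
rewrite -PF//; last 2 first.
- by apply/measurable_EFinP; exact: measurable_funTS.
- by move=> x _; rewrite lee_fin.
by apply: eq_measure_integral => //= A mA AS; exact/esym/lebesgue_measure_shift.
Qed.

(** The interval []-n, n]] consists of [4 n] translates of []0, 1 / 2]], so its integral is that of
    a sum of [4 n] translates of [phi] over []0, 1 / 2]], which is at most [K / 2]. *)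
Lemma integral_periodization (phi : R -> R) (K : R) : measurable_fun setT phi -> (forall x, 0 <= phi x) ->
  (forall s n, \sum_(j < n) phi (s + j%:R / 2) <= K) ->
  (\int[lebesgue_measure]_x (phi x)%:E <= (K / 2)%:E)%E.
Proof.
move=> mphi phi0 hK.
have step (a : R) (k : nat) : (\int[lebesgue_measure]_(x in (`]a, (a + k%:R / 2)%R]%classic : set R)) (phi x)%:E =
    \int[lebesgue_measure]_(x in (`]0%R, (1 / 2)%R]%classic : set R)) (\sum_(j < k) phi (a + x + j%:R / 2))%R%:E)%E.
  elim: k => [|k IH].
    rewrite mul0r addr0 set_itv_ge ?bnd_simp ?ltxx// integral_set0.
    by under eq_integral do rewrite big_ord0; rewrite integral0.
  under [RHS]eq_integral do rewrite big_ord_recr/= EFinD.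
  rewrite ge0_integralD//; last 4 first.
  - by move=> x _; rewrite lee_fin sumr_ge0.
  - apply: measurable_funTS; apply/measurable_EFinP; apply: measurable_sum => j.
    apply: measurableT_comp => //; apply: measurable_funD => //; exact: measurable_funD.
  - by move=> x _; rewrite lee_fin.
  - apply: measurable_funTS; apply/measurable_EFinP.
    apply: measurableT_comp => //; apply: measurable_funD => //; exact: measurable_funD.
  rewrite -IH.
  under [X in (_ + X)%E]eq_integral do rewrite addrAC.
  rewrite -integral_itv_shift// addr0.
  have -> : a + k%:R / 2 + 1 / 2 = a + k.+1%:R / 2 by rewrite -[k.+1%:R]natr1; field.
  rewrite -ge0_integral_setU//; last 3 first.
  - by apply: measurable_funTS; exact/measurable_EFinP.
  - by move=> x _; rewrite lee_fin.
  - rewrite disj_set2E; apply/eqP/seteqP; split => x //=; rewrite !in_itv/= => -[/andP[_ x1] /andP[x2 _]].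
    by move: x2; rewrite ltNge x1.
  congr integral; rewrite -itv_bndbnd_setU ?bnd_simp//.
  - by rewrite lerDl divr_ge0.
  - by rewrite lerD2l ler_wpM2r// ler_nat.
pose I n : set R := `]- (n%:R), n%:R]%classic.
have cvI : (\int[lebesgue_measure]_(x in I n) (phi x)%:E)%E @[n --> \oo] -->
    (\int[lebesgue_measure]_(x in \bigcup_n I n) (phi x)%:E)%E.
  apply: ge0_nondecreasing_set_cvg_integral => //.
  - by move=> n m nm; apply/subsetPset/subset_itv; rewrite leBSide/= ?lerN2 ler_nat.
  - by move=> n; apply: measurable_itv.
  - by move=> n; apply: measurable_funTS; exact/measurable_EFinP.
  - by move=> n x _; rewrite lee_fin.
have IT : \bigcup_n I n = setT by exact: bigcup_itvT.
rewrite IT in cvI.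
rewrite -(cvg_lim _ cvI)//; apply: lime_le; first by apply/cvg_ex; eexists; exact: cvI.
apply: nearW => n.
have -> : I n = `](- n%:R), (- n%:R + (4 * n)%:R / 2)]%classic.
  by rewrite /I (_ : - n%:R + (4 * n)%:R / 2 = n%:R)// natrM; field.
rewrite step.
apply: (@le_trans _ _ (\int[lebesgue_measure]_(x in (`]0%R, (1 / 2)%R]%classic : set R)) K%:E)%E).
  apply: ge0_le_integral => //.
  - by move=> x _; rewrite lee_fin sumr_ge0.
  - apply: measurable_funTS; apply/measurable_EFinP; apply: measurable_sum => j.
    apply: measurableT_comp => //; apply: measurable_funD => //; exact: measurable_funD.
  - by move=> x _; rewrite lee_fin.
rewrite integral_cst//= lebesgue_measure_itv/= lte_fin ifT; last by lra.
by rewrite -EFinD -EFinM lee_fin; lra.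
Qed.

End translates.

(** * Dyadic scales *)

Section dyadic_scales.
Context {R : realType}.

(** A geometric series dominated by its largest term, the first scale below [Y]. The induction
    passes from [T] to [T / 2] and carries a second bound by [T ^ r], which serves when [T <= Y]. *)
Lemma sum_dyadic_powR (r T Y : R) n : 0 < r -> 0 < T -> 0 <= Y ->
  \sum_(i < n) (if T / 2 ^+ i <= Y then (T / 2 ^+ i) `^ r else 0) <= (1 - 2 `^ (- r))^-1 * Y `^ r.
Proof.
move=> r0 T0 Y0; set c := (_ - _)^-1.
have h2 : 2 `^ (- r) < 1 :> R.
  rewrite powRN invf_lt1 ?powR_gt0//.
  by have := @gt0_ltr_powR R r r0 1 2; rewrite powR1 !nnegrE => -> //; rewrite ltr1n.
have c0 : 0 < c by rewrite invr_gt0 subr_gt0.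
have cE : 1 + c * 2 `^ (- r) = c.
  by rewrite /c; field; rewrite subr_eq0 gt_eqF.
suff : \sum_(i < n) (if T / 2 ^+ i <= Y then (T / 2 ^+ i) `^ r else 0) <= c * Y `^ r /\
       \sum_(i < n) (if T / 2 ^+ i <= Y then (T / 2 ^+ i) `^ r else 0) <= c * T `^ r by case.
elim: n T T0 => [|n IH] T T0.
  by rewrite big_ord0 !mulr_ge0 ?powR_ge0// ltW.
rewrite big_ord_recl/= expr0 divr1.
have eS (i : nat) : T / 2 ^+ i.+1 = T / 2 / 2 ^+ i by rewrite exprS invfM mulrA.
under eq_bigr => i _ do rewrite /bump/= add1n eS.
have T2 : 0 < T / 2 by rewrite divr_gt0.
have [h1 h3] := IH _ T2; set S := \sum_(i < n) _ in h1 h3 *.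
have TE : c * (T / 2) `^ r = T `^ r * (c * 2 `^ (- r)).
  by rewrite powRM ?(ltW T0) ?invr_ge0// powRN -powR_inv1// -powRrM mulN1r powRN mulrCA.
have hT : (if T <= Y then T `^ r else 0) + S <= c * T `^ r.
  apply: (@le_trans _ _ (T `^ r + T `^ r * (c * 2 `^ (- r)))).
    by apply: lerD; [case: ifP => // _; exact: powR_ge0|rewrite -TE].
  by rewrite -{1}[T `^ r]mulr1 -mulrDr cE mulrC.
split => //; have [TY|YT] := leP T Y; last by rewrite add0r.
move: hT; rewrite TY => /le_trans; apply.
by rewrite ler_wpM2l ?(ltW c0)// ge0_ler_powR ?nnegrE ?(ltW r0) ?(ltW T0).
Qed.

Lemma dyadic_scale (x T : R) : 0 < x <= T -> exists i : nat, T / 2 ^+ i / 2 < x <= T / 2 ^+ i.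
Proof.
move=> /andP[x0 xT]; have T0 : 0 < T := lt_le_trans x0 xT.
have ex : exists i, T / 2 ^+ i / 2 < x.
  exists (Num.truncn (T / x)).
  have h : 0 <= T / x by rewrite divr_ge0 ?ltW.
  have /andP[_ h1] := truncn_itv h.
  rewrite -mulrA -invfM -exprSr ltr_pdivrMr ?exprn_gt0// mulrC -ltr_pdivrMr//.
  apply: (lt_trans h1); rewrite -natrX ltr_nat; exact: ltn_expl.
pose i := ex_minn ex; exists i; rewrite /i; case: ex_minnP => -[|k] -> kmin /=.
  by rewrite expr0 divr1.
rewrite exprSr invfM mulrA; have [h|//] := ltP (T / 2 ^+ k / 2) x.
by have := kmin _ h; rewrite ltnn.
Qed.

End dyadic_scales.

(** * Stability of the Fourier transform *)

Section fourier_perturbation.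
Context {R : realType} (mu : {finite_measure set R -> \bar R}).

Lemma hypot_triangle (a b c d : R) :
  Num.sqrt ((a + c) ^+ 2 + (b + d) ^+ 2) <= Num.sqrt (a ^+ 2 + b ^+ 2) + (`|c| + `|d|).
Proof.
set s := Num.sqrt (a ^+ 2 + b ^+ 2); have s0 : 0 <= s := sqrtr_ge0 _.
have sE : s ^+ 2 = a ^+ 2 + b ^+ 2 by rewrite sqr_sqrtr// addr_ge0 ?sqr_ge0.
have as_ : `|a| <= s by rewrite -sqrtr_sqr ler_wsqrtr// lerDl sqr_ge0.
have bs : `|b| <= s by rewrite -sqrtr_sqr ler_wsqrtr// lerDr sqr_ge0.
apply: sqrt_le_sqr; first by rewrite !addr_ge0.
have h1 : a * c <= s * `|c| by apply: (le_trans (ler_norm _)); rewrite normrM ler_wpM2r.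
have h2 : b * d <= s * `|d| by apply: (le_trans (ler_norm _)); rewrite normrM ler_wpM2r.
have h3 : 0 <= `|c| * `|d| by rewrite mulr_ge0.
rewrite [leRHS](_ : _ = s ^+ 2 + 2 * (s * `|c|) + 2 * (s * `|d|) + `|c| ^+ 2 + `|d| ^+ 2 + 2 * (`|c| * `|d|)); last by ring.
rewrite sE !real_normK ?num_real//.
rewrite [leLHS](_ : _ = a ^+ 2 + b ^+ 2 + 2 * (a * c) + 2 * (b * d) + c ^+ 2 + d ^+ 2); last by ring.
lra.
Qed.

Lemma rotation_le (a b t : R) : `|a * cos t + b * sin t| <= Num.sqrt (a ^+ 2 + b ^+ 2).
Proof.
rewrite -sqrtr_sqr ler_wsqrtr// -[leRHS]mulr1 -(cos2Dsin2 t) -subr_ge0.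
by rewrite [leRHS](_ : _ = (a * sin t - b * cos t) ^+ 2) ?sqr_ge0//; ring.
Qed.

Lemma integrable_mul_bounded (f w : R -> R) : mu.-integrable setT (EFin \o f) ->
  measurable_fun setT w -> (forall x, `|w x| <= 1) -> mu.-integrable setT (EFin \o (fun x => f x * w x)).
Proof.
move=> fi mw w1; have mf : measurable_fun setT f by have /integrableP[/measurable_EFinP] := fi.
apply: (le_integrable measurableT _ _ fi) => [|x _].
  by apply/measurable_EFinP; exact: measurable_funM.
by rewrite /= lee_fin normrM ler_piMr.
Qed.

Lemma integrable_trig (f : R -> R) (c : R) : mu.-integrable setT (EFin \o f) ->
  mu.-integrable setT (EFin \o (fun x => f x * cos (c * x))) /\
  mu.-integrable setT (EFin \o (fun x => f x * sin (c * x))).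
Proof.
move=> fi; split; apply: integrable_mul_bounded => //.
- exact: (sqint_cos mu c).1.
- by move=> x; exact: cos_max.
- exact: (sqint_sin mu c).1.
- by move=> x; exact: sin_max.
Qed.

(** The real and the imaginary part each change by at most the [L^1] norm of the difference; adding
    the two gives the factor [2]. *)
Lemma ft_abs_perturb (fr fi gr gi : R -> R) (xi : R) :
  mu.-integrable setT (EFin \o fr) -> mu.-integrable setT (EFin \o fi) ->
  mu.-integrable setT (EFin \o gr) -> mu.-integrable setT (EFin \o gi) ->
  mu.-integrable setT (EFin \o (fun y => Num.sqrt ((fr y - gr y) ^+ 2 + (fi y - gi y) ^+ 2))) ->
  ft_abs mu fr fi xi <= ft_abs mu gr gi xi +
    2 * Rintegral mu setT (fun y => Num.sqrt ((fr y - gr y) ^+ 2 + (fi y - gi y) ^+ 2)).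
Proof.
move=> ifr ifi igr igi im; pose w := 2 * pi * xi.
set D := Rintegral _ _ _.
have [frc frs] := integrable_trig fr w ifr; have [fic fis] := integrable_trig fi w ifi.
have [grc grs] := integrable_trig gr w igr; have [gic gis] := integrable_trig gi w igi.
have ir (a b : R -> R) : mu.-integrable setT (EFin \o (fun x => a x * cos (w * x))) ->
   mu.-integrable setT (EFin \o (fun x => b x * sin (w * x))) ->
   mu.-integrable setT (EFin \o (fun x => a x * cos (w * x) + b x * sin (w * x))) /\
   mu.-integrable setT (EFin \o (fun x => a x * cos (w * x) - b x * sin (w * x))).
  by move=> h1 h2; split; [exact: (integrableD measurableT h1 h2)|exact: (integrableB measurableT h1 h2)].
have [f1 _] := ir _ _ frc fis; have [_ f2] := ir _ _ fic frs.
have [g1 _] := ir _ _ grc gis; have [_ g2] := ir _ _ gic grs.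
have bound (h k : R -> R) : mu.-integrable setT (EFin \o h) -> mu.-integrable setT (EFin \o k) ->
    (forall y, `|h y - k y| <= Num.sqrt ((fr y - gr y) ^+ 2 + (fi y - gi y) ^+ 2)) ->
    `|Rintegral mu setT h - Rintegral mu setT k| <= D.
  move=> ih ik hk; rewrite -RintegralB//.
  have ihk : mu.-integrable setT (EFin \o (fun x => h x - k x)) by exact: (integrableB measurableT ih ik).
  apply: (le_trans (le_normr_Rintegral measurableT ihk)).
  by apply: le_Rintegral => //; exact: (integrable_abse ihk).
have b1 : `|ft_re mu fr fi xi - ft_re mu gr gi xi| <= D.
  apply: (bound _ _ f1 g1) => y; rewrite -/w.
  rewrite (_ : _ - _ = (fr y - gr y) * cos (w * y) + (fi y - gi y) * sin (w * y)); last by ring.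
  exact: rotation_le.
have b2 : `|ft_im mu fr fi xi - ft_im mu gr gi xi| <= D.
  apply: (bound _ _ f2 g2) => y; rewrite -/w.
  rewrite (_ : _ - _ = (fi y - gi y) * cos (w * y) + - (fr y - gr y) * sin (w * y)); last by ring.
  by apply: (le_trans (rotation_le _ _ _)); rewrite sqrrN addrC.
rewrite /ft_abs.
have := hypot_triangle (ft_re mu gr gi xi) (ft_im mu gr gi xi)
  (ft_re mu fr fi xi - ft_re mu gr gi xi) (ft_im mu fr fi xi - ft_im mu gr gi xi).
rewrite ![_ gr gi xi + _]addrC !subrK => /le_trans; apply; rewrite lerD2l; lra.
Qed.

End fourier_perturbation.

(** * Truncation of the function at a level of its transform *)

Section truncation.
Context {R : realType} (mu : {finite_measure set R -> \bar R}) (p A : R) (fr fi : R -> R).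
Hypothesis p4 : 4 < p.
Hypothesis A0 : 0 < A.
Hypothesis mfr : measurable_fun setT fr.
Hypothesis mfi : measurable_fun setT fi.

Let q := p / (p - 2).
Let kap := 2 / (p - 2).
Let r := p - 4.
Let m (y : R) := Num.sqrt (fr y ^+ 2 + fi y ^+ 2).

Hypothesis mA : (\int[mu]_y (m y `^ q)%:E <= A%:E)%E.

Let p2 : 0 < p - 2. Proof. by move: p4; lra. Qed.
Let kap0 : 0 < kap. Proof. by rewrite divr_gt0. Qed.
Let kap1 : kap < 1. Proof. by rewrite ltr_pdivrMr// mul1r; move: p4; lra. Qed.
Let qE : q = 1 + kap. Proof. by rewrite /q /kap; field; rewrite gt_eqF. Qed.
Let m0 y : 0 <= m y. Proof. exact: sqrtr_ge0. Qed.

Let mm : measurable_fun setT m.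
Proof.
apply: measurableT_comp; first by apply: continuous_measurable_fun; exact: sqrt_continuous.
by apply: measurable_funD; apply: measurable_funX.
Qed.

Let mpow (s : R) : measurable_fun setT (fun y => m y `^ s).
Proof. exact: (measurableT_comp (measurable_powR s) mm). Qed.

Let iq : mu.-integrable setT (EFin \o (fun y => m y `^ q)).
Proof.
apply/integrableP; split; first by apply/measurable_EFinP; exact: mpow.
apply: le_lt_trans (ltry A); apply: le_trans mA; rewrite le_eqVlt; apply/orP; left; apply/eqP.
by apply: eq_integral => y _; rewrite /= ger0_norm// powR_ge0.
Qed.

Let Rq : Rintegral mu setT (fun y => m y `^ q) <= A.
Proof.
rewrite -lee_fin /Rintegral fineK//; exact: (integrable_fin_num measurableT iq).
Qed.

Let im : mu.-integrable setT (EFin \o m).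
Proof.
have i1 : mu.-integrable setT (EFin \o (cst 1 : R -> R)).
  by apply: (bounded_integrable mu setT (cst 1) 1) => // x; rewrite normr1.
apply: (le_integrable measurableT _ _ (integrableD measurableT i1 iq)).
  exact/measurable_EFinP.
move=> y _; rewrite /= lee_fin ger0_norm// ger0_norm; last by rewrite addr_ge0 ?powR_ge0.
have [m1|m1] := leP (m y) 1; first by rewrite (le_trans m1)// lerDl powR_ge0.
rewrite -[leLHS]add0r lerD// -[leLHS]powRr1//.
by rewrite ler_powR ?(ltW m1)// qE lerDl ltW.
Qed.

Let fm y : `|fr y| <= m y /\ `|fi y| <= m y.
Proof. by rewrite -!sqrtr_sqr; split; rewrite ler_wsqrtr// ?lerDl ?lerDr sqr_ge0. Qed.

Let ifri : mu.-integrable setT (EFin \o fr) /\ mu.-integrable setT (EFin \o fi).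
Proof.
split; apply: (le_integrable measurableT _ _ im) => [|y _]; try exact/measurable_EFinP.
  by rewrite /= lee_fin (ger0_norm (m0 y)); exact: (fm y).1.
by rewrite /= lee_fin (ger0_norm (m0 y)); exact: (fm y).2.
Qed.

Lemma ft_abs_le_norm1 xi : ft_abs mu fr fi xi <= 2 * Rintegral mu setT m.
Proof.
have i0 : mu.-integrable setT (EFin \o (cst 0 : R -> R)) by exact: integrable0.
have := ft_abs_perturb mu fr fi (cst 0) (cst 0) xi ifri.1 ifri.2 i0 i0.
rewrite (_ : (fun y => Num.sqrt _) = m); last by apply/funext => y; rewrite !subr0.
move=> /(_ im); rewrite [X in _ <= X + _ -> _](_ : _ = 0) ?add0r//.
rewrite /ft_abs /ft_re /ft_im.
rewrite (_ : (fun y => _ + _) = cst 0); last by apply/funext => y; rewrite /= !mul0r addr0.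
rewrite (_ : (fun y => _ - _) = cst 0); last by apply/funext => y; rewrite /= !mul0r subr0.
by rewrite Rintegral_cst// mul0r expr0n addr0 sqrtr0.
Qed.

(** Let [m] be the modulus of the function and [q = p / (p - 2)]. As [q - 1 = 2 / (p - 2)], the
    failure of the condition means [m < t / (8 A) * m ^ q]; the part cut off has [L^1] norm at most
    [t / 8] and moves the transform by at most [t / 4]. *)
Definition low_set (t : R) : set R := [set y | t * Num.sqrt (fr y ^+ 2 + fi y ^+ 2) `^ (2 / (p - 2)) <= 8 * A].
Definition truncate (t : R) (h : R -> R) (y : R) := h y * \1_(low_set t) y.

Let mlow t : measurable (low_set t).
Proof.
have mh : measurable_fun setT (fun y => t * m y `^ kap) by exact: measurable_funM.
rewrite (_ : low_set t = setT `&` (fun y => t * m y `^ kap) @^-1` `]-oo, 8 * A]).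
  by apply: mh => //; exact: measurable_itv.
by rewrite setTI; apply/seteqP; split => y; rewrite /= in_itv.
Qed.

Let mtr t h : measurable_fun setT h -> measurable_fun setT (truncate t h).
Proof. by move=> mh; apply: measurable_funM. Qed.

Let low_bound t y : 0 < t -> low_set t y -> m y <= (8 * A / t) `^ kap^-1.
Proof.
move=> t0; rewrite /low_set/= -/(m y) -/kap => h.
have -> : m y = (m y `^ kap) `^ kap^-1 by rewrite -powRrM divff ?gt_eqF// powRr1.
rewrite ge0_ler_powR ?nnegrE ?powR_ge0//.
- by rewrite invr_ge0 ltW.
- by rewrite divr_ge0 ?mulr_ge0 ?(ltW A0) ?(ltW t0).
- by rewrite ler_pdivlMr// mulrC.
Qed.

Lemma sqint_truncate t : 0 < t -> sqint mu (truncate t fr) /\ sqint mu (truncate t fi).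
Proof.
move=> t0.
have b (h : R -> R) y : `|h y| <= m y -> `|truncate t h y| <= (8 * A / t) `^ kap^-1.
  move=> hm; rewrite /truncate indicE; case: (boolP (y \in _)) => [|_]; last first.
    by rewrite mulr0 normr0 powR_ge0.
  by rewrite inE mulr1 => hy; apply: (le_trans hm); exact: low_bound.
split; apply: (sqint_bounded mu _ ((8 * A / t) `^ kap^-1)) => [|y]; try exact: mtr.
  exact: b (fm y).1.
exact: b (fm y).2.
Qed.

Lemma ft_abs_truncate t xi : 0 < t ->
  ft_abs mu fr fi xi <= ft_abs mu (truncate t fr) (truncate t fi) xi + t / 4.
Proof.
move=> t0; have [s1 s2] := sqint_truncate t t0.
have itr (h : R -> R) : mu.-integrable setT (EFin \o h) -> measurable_fun setT h ->
    mu.-integrable setT (EFin \o truncate t h).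
  move=> ih mh; apply: (le_integrable measurableT _ _ ih); first by apply/measurable_EFinP; exact: mtr.
  move=> y _; rewrite /= lee_fin /truncate normrM ler_piMr// indicE.
  by case: (_ \in _); rewrite ?normr1 ?normr0.
have E y : Num.sqrt ((fr y - truncate t fr y) ^+ 2 + (fi y - truncate t fi y) ^+ 2) = m y * (1 - \1_(low_set t) y).
  rewrite /truncate indicE; case: (y \in _) => /=.
    by rewrite !mulr1 !subrr !expr0n addr0 sqrtr0 mulr0.
  by rewrite !mulr0 !subr0 mulr1.
have id : mu.-integrable setT (EFin \o (fun y => Num.sqrt ((fr y - truncate t fr y) ^+ 2 + (fi y - truncate t fi y) ^+ 2))).
  apply: (le_integrable measurableT _ _ im).
    under [_ \o _]eq_fun do rewrite /= E.
    apply/measurable_EFinP; apply: measurable_funM => //; exact: measurable_funB.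
  move=> y _; rewrite /= E lee_fin normrM ler_piMr// indicE.
  by case: (_ \in _); rewrite ?subrr ?subr0 ?normr1 ?normr0.
apply: (le_trans (ft_abs_perturb mu fr fi _ _ xi ifri.1 ifri.2 (itr _ ifri.1 mfr) (itr _ ifri.2 mfi) id)).
rewrite lerD2l.
suff h : Rintegral mu setT (fun y => Num.sqrt ((fr y - truncate t fr y) ^+ 2 + (fi y - truncate t fi y) ^+ 2)) <= t / 8.
  by move: h; set D := Rintegral _ _ _; lra.
have iq' : mu.-integrable setT (EFin \o (fun y => t / (8 * A) * m y `^ q)).
  exact: (integrableZl measurableT _ iq).
apply: (@le_trans _ _ (Rintegral mu setT (fun y => t / (8 * A) * m y `^ q))).
  apply: le_Rintegral => // y _; rewrite E indicE.
  case: (boolP (y \in _)) => [_|]; first by rewrite subrr mulr0 mulr_ge0 ?powR_ge0// divr_ge0 ?mulr_ge0 ?ltW.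
  rewrite notin_setE /low_set/= -/(m y) -/kap => /negP; rewrite -ltNge => h.
  rewrite subr0 mulr1 mulrAC ler_pdivlMr ?mulr_gt0// qE.
  have -> : m y `^ (1 + kap) = m y * m y `^ kap.
    by rewrite powRD ?powRr1// gt_eqF// addr_gt0.
  by rewrite [leRHS]mulrCA ler_wpM2l// ltW.
rewrite RintegralZl//; apply: (@le_trans _ _ (t / (8 * A) * A)).
  by rewrite ler_wpM2l// divr_ge0 ?mulr_ge0 ?ltW.
by rewrite le_eqVlt; apply/orP; left; apply/eqP; field; rewrite gt_eqF.
Qed.

Let w t y := truncate t (fun y => m y `^ (4 - q)) y.

Let iw t : 0 < t -> mu.-integrable setT (EFin \o w t).
Proof.
move=> t0; apply: (bounded_integrable mu setT (w t) (((8 * A / t) `^ kap^-1) `^ (4 - q))) => //.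
  exact: mtr.
move=> y; rewrite /w /truncate indicE; case: (boolP (y \in _)) => [|_]; last first.
  by rewrite mulr0 normr0 powR_ge0.
rewrite inE mulr1 ger0_norm ?powR_ge0// => hy.
rewrite ge0_ler_powR ?nnegrE ?powR_ge0 ?low_bound//.
by rewrite qE; move: kap1; lra.
Qed.

(* Cauchy-Schwarz for [m ^ 2 = m ^ (q / 2) * m ^ (2 - q / 2)]. *)
Lemma truncate_square_le t : 0 < t ->
  Rintegral mu setT (fun y => truncate t fr y ^+ 2 + truncate t fi y ^+ 2) ^+ 2 <=
    A * Rintegral mu setT (truncate t (fun y => m y `^ (4 - p / (p - 2)))).
Proof.
move=> t0.
have I2 y : (\1_(low_set t) y : R) ^+ 2 = \1_(low_set t) y.
  by rewrite indicE; case: (_ \in _); rewrite ?expr1n ?expr0n.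
have q0 : q != 0 by rewrite qE gt_eqF// addr_gt0.
have s1 : sqint mu (fun y => m y `^ (q / 2)).
  split; first exact: mpow.
  rewrite (_ : (fun x => _) = (fun y => m y `^ q)) //; apply/funext => y.
  by rewrite -powR_mulrn ?powR_ge0// -powRrM divfK.
have s2 : sqint mu (truncate t (fun y => m y `^ (2 - q / 2))).
  split; first exact: mtr.
  rewrite (_ : (fun x => truncate _ _ x ^+ 2) = w t); first exact: iw t0.
  apply/funext => y; rewrite /w /truncate exprMn I2 -powR_mulrn ?powR_ge0// -powRrM.
  by congr (_ `^ _ * _); field.
have s0 : sqint mu (cst 0).
  by apply: (sqint_bounded mu (cst 0) 0) => // x; rewrite normr0.
have := cauchy_schwarz2 mu _ _ _ _ s1 s0 s2 s0.
rewrite (_ : (fun x => _ * _ + _ * _) = (fun y => truncate t fr y ^+ 2 + truncate t fi y ^+ 2)); last first.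
  apply/funext => y; rewrite /truncate mulr0 addr0 mulrA !exprMn I2 -mulrDl; congr (_ * _).
  have q4 : q / 2 + (2 - q / 2) = 2 by ring.
  by rewrite -powRD q4 ?pnatr_eq0// powR_mulrn// sqr_sqrtr// addr_ge0 ?sqr_ge0.
rewrite (_ : (fun x => (_ `^ _) ^+ 2 + _) = (fun y => m y `^ q)); last first.
  by apply/funext => y; rewrite expr0n addr0 -powR_mulrn ?powR_ge0// -powRrM divfK.
rewrite (_ : (fun x => _ ^+ 2 + (cst 0 x) ^+ 2) = w t); last first.
  apply/funext => y; rewrite expr0n addr0 /w /truncate exprMn I2 -powR_mulrn ?powR_ge0// -powRrM.
  by congr (_ `^ _ * _); field.
move/le_trans; apply; apply: ler_wpM2r => //.
by apply: Rintegral_ge0 => y _; rewrite mulr_ge0 ?powR_ge0// indicE.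
Qed.

(** Sum and integral are exchanged. At a fixed point only the scales up to [8 * A / m ^ kap] count,
    and their geometric sum is a multiple of [(8 * A) ^ r * m ^ (- kap * r)]. Since
    [4 - q - kap * r = q], what remains is the integral of [m ^ q]. *)
Lemma truncate_sum_le T n : 0 < T ->
  \sum_(i < n) (T / 2 ^+ i) `^ (p - 4) *
      Rintegral mu setT (truncate (T / 2 ^+ i) (fun y => m y `^ (4 - p / (p - 2)))) <=
    (1 - 2 `^ (- (p - 4)))^-1 * 8 `^ (p - 4) * A `^ (p - 3).
Proof.
move=> T0; have r0 : 0 < r by rewrite subr_gt0.
set c := (1 - 2 `^ _)^-1.
have ti (i : nat) : 0 < T / 2 ^+ i by rewrite divr_gt0// exprn_gt0.
have iiw (i : nat) : mu.-integrable setT (EFin \o (fun y => (T / 2 ^+ i) `^ r * w (T / 2 ^+ i) y)).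
  exact: (integrableZl measurableT _ (iw _ (ti i))).
have [isum E] := Rintegral_sum mu (fun i y => (T / 2 ^+ i) `^ r * w (T / 2 ^+ i) y) n iiw.
have -> : \sum_(i < n) (T / 2 ^+ i) `^ (p - 4) *
      Rintegral mu setT (truncate (T / 2 ^+ i) (fun y => m y `^ (4 - p / (p - 2)))) =
   Rintegral mu setT (fun y => \sum_(i < n) (T / 2 ^+ i) `^ r * w (T / 2 ^+ i) y).
  by rewrite E; apply: eq_bigr => i _; rewrite RintegralZl//; exact: iw.
have ib : mu.-integrable setT (EFin \o (fun y => c * (8 * A) `^ r * m y `^ q)).
  exact: (integrableZl measurableT _ iq).
have c0 : 0 <= c * (8 * A) `^ r.
  rewrite mulr_ge0 ?powR_ge0// /c invr_ge0 subr_ge0 powRN invf_le1 ?powR_gt0//.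
  by rewrite -[leLHS](powRr0 2) ler_powR ?ler1n// ltW.
apply: (@le_trans _ _ (Rintegral mu setT (fun y => c * (8 * A) `^ r * m y `^ q))).
  apply: le_Rintegral => // y _.
  have [my|my] := eqVneq (m y) 0.
    rewrite big1 => [|i _]; first by apply: mulr_ge0 => //; exact: powR_ge0.
    rewrite /w /truncate my powR0 ?mul0r ?mulr0//.
    by rewrite gt_eqF// qE; move: kap1; lra.
  have my0 : 0 < m y by rewrite lt_neqAle eq_sym my m0.
  have k0 : 0 < m y `^ kap by rewrite powR_gt0.
  have Y0 : 0 <= 8 * A / m y `^ kap by rewrite divr_ge0 ?mulr_ge0 ?(ltW A0) ?(ltW k0).
  have -> : \sum_(i < n) (T / 2 ^+ i) `^ r * w (T / 2 ^+ i) y =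
      (\sum_(i < n) (if T / 2 ^+ i <= 8 * A / m y `^ kap then (T / 2 ^+ i) `^ r else 0)) * m y `^ (4 - q).
    rewrite mulr_suml; apply: eq_bigr => i _; rewrite /w /truncate indicE.
    rewrite (_ : (y \in _) = (T / 2 ^+ i <= 8 * A / m y `^ kap)); last first.
      by rewrite ler_pdivlMr//; apply/idP/idP; rewrite inE.
    by case: ifP => _; rewrite ?mulr1 ?mulr0 ?mul0r.
  apply: (le_trans (ler_wpM2r (powR_ge0 _ _) (sum_dyadic_powR r T _ n r0 T0 Y0))).
  rewrite powRM ?mulr_ge0 ?(ltW A0) ?invr_ge0 ?(ltW k0)// -/c -!mulrA.
  rewrite le_eqVlt; apply/orP; left; apply/eqP; congr (_ * (_ * _)).
  rewrite -powR_inv1 ?powR_ge0// -!powRrM -powRD; last by rewrite my implybT.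
  by congr (_ `^ _); rewrite /q /kap /r; field; rewrite gt_eqF.
rewrite RintegralZl//; apply: (le_trans (ler_wpM2l c0 Rq)).
rewrite powRM ?(ltW A0)// -!mulrA -{2}[A]powRr1 ?(ltW A0)// -powRD; last by rewrite (gt_eqF A0) implybT.
by rewrite (_ : r + 1 = p - 3)// /r; ring.
Qed.

End truncation.

(** * Restriction estimates *)

Section bounded_self_convolution.
Context {R : realType} (mu : {finite_measure set R -> \bar R}) (g : R -> R) (G : R).
Hypothesis mu01 : mu (~` `]0, 1]%classic) = 0%E.
Hypothesis gG : forall x, 0 <= g x <= G.
Hypothesis mg : measurable_fun setT g.
Hypothesis dens : forall A : set R, measurable A ->
  ((mu \x mu) [set z : R * R | A (z.1 + z.2)%R] =
    \int[lebesgue_measure]_(x in A) (g x)%:E)%E.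

Let plus (z : R * R) : R := z.1 + z.2.

Let mplus : measurable_fun setT plus.
Proof. by apply: measurable_funD; [exact: measurable_fst|exact: measurable_snd]. Qed.

Let G0 : 0 <= G.
Proof. by have /andP[h1 h2] := gG 0; exact: le_trans h2. Qed.

(** The law of [x + y] under the product measure has the density [g <= G], and it lives on []0, 2]]
    because [mu] lives on []0, 1]]. *)
Lemma integral_sum_le (h : R -> R) : measurable_fun setT h -> (forall x, 0 <= h x) ->
  (\int[mu]_x \int[mu]_y (h (x + y))%:E <=
     G%:E * \int[lebesgue_measure]_(x in (`]0%R, 2%R]%classic : set R)) (h x)%:E)%E.
Proof.
move=> mh h0.
have mf : measurable_fun setT (fun z : R * R => (h (plus z))%:E).
  by apply/measurable_EFinP; exact: measurableT_comp.
have f0 (z : R * R) : (0 <= (h (plus z))%:E)%E by rewrite lee_fin.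
have FT := @fubini_tonelli1 _ _ _ _ R mu mu _ mf f0; rewrite /fubini_F/= in FT; rewrite -FT {FT}.
have mI : measurable (`]0, 2]%classic : set R) by exact: measurable_itv.
have mC : measurable (~` (`]0, 2]%classic : set R)) by exact: measurableC.
have mP : measurable (plus @^-1` (`]0, 2]%classic : set R)).
  by rewrite -[X in measurable X]setTI; exact: mplus.
have mPC : measurable (plus @^-1` (~` (`]0, 2]%classic : set R))).
  by rewrite -[X in measurable X]setTI; exact: mplus.
have null : (mu \x mu)%E (plus @^-1` (~` (`]0, 2]%classic : set R))) = 0%E.
  pose I1 : set R := `]0, 1]%classic.
  have m1 : measurable (~` I1) by apply: measurableC; exact: measurable_itv.
  apply/eqP; rewrite eq_le measure_ge0 andbT.
  apply: (@le_trans _ _ ((mu \x mu)%E ((~` I1) `*` setT `|` setT `*` (~` I1)))).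
    apply: le_measure; rewrite ?inE//.
      by apply: measurableU; exact: measurableX.
    move=> [x y]; rewrite /plus/= !in_itv/= => hxy.
    rewrite /I1/= !in_itv/=.
    have [hx|hx] := boolP (0 < x <= 1); last by left; split => //; exact/negP.
    have [hy|hy] := boolP (0 < y <= 1); last by right; split => //; exact/negP.
    case: hxy; move/andP: hx => [? ?]; move/andP: hy => [? ?]; apply/andP; split; lra.
  apply: (le_trans (measureU2 _ _ _)); [exact: measurableX|exact: measurableX|].
  have e1 : (mu \x mu)%E ((~` I1) `*` setT) = 0%E.
    by apply: etrans (product_measure1E _ _ m1 measurableT) _; rewrite /= mu01 mul0e.
  have e2 : (mu \x mu)%E (setT `*` (~` I1)) = 0%E.
    by apply: etrans (product_measure1E _ _ measurableT m1) _; rewrite /= mu01 mule0.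
  by rewrite [X in (X + _)%E]e1 [X in (_ + X)%E]e2 adde0.
rewrite -(setUv (plus @^-1` (`]0, 2]%classic : set R))) ge0_integral_setU//; last 2 first.
- by move/measurable_funS: mf; apply.
- by rewrite disj_set2E setICr.
rewrite [X in (_ + X)%E](_ : _ = 0%E) ?adde0; last first.
  by apply: null_set_integral => //; exact: measurable_funTS.
have PF := @ge0_integral_pushforward _ _ _ (measurableTypeR R) R plus mplus (mu \x mu)%E (`]0, 2]%classic : set R) (EFin \o h).
rewrite -PF//; last 2 first.
- by apply/measurable_EFinP; exact: measurable_funTS.
- by move=> x _; rewrite lee_fin.
pose k : {nonneg R} := NngNum G0.
rewrite (_ : G = k%:num)//.
rewrite -ge0_integral_mscale//; last 2 first.
- by apply/measurable_EFinP; exact: measurable_funTS.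
- by move=> x _; rewrite lee_fin.
apply: ge0_le_measure_integral => //.
- move=> A mA.
  apply: (@le_trans _ _ (\int[lebesgue_measure]_(x in A) (g x)%:E)%E).
    by rewrite le_eqVlt; apply/orP; left; apply/eqP; exact: (dens A).
  apply: (@le_trans _ _ (k%:num%:E * lebesgue_measure A)%E) => //.
  rewrite -integral_cst//; apply: ge0_le_integral => //.
  + by move=> x _; rewrite lee_fin; case/andP: (gG x).
  + by apply/measurable_EFinP; exact: measurable_funTS.
  + by move=> x _; rewrite lee_fin; case/andP: (gG x).
by apply/measurable_EFinP.
Qed.

(** The coefficients of the waves are the squares of the transform [F_j]. The pairing is then the
    sum [S] of the [|F_j| ^ 4], the wave sum has square integral [2 * S] by orthogonality, and
    duality reads [S ^ 2 <= 4 * G * n2 ^ 2 * S]. *)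
Lemma discrete_fourth_moment (fr fi : R -> R) (s : R) (n : nat) : sqint mu fr -> sqint mu fi ->
  \sum_(j < n) ft_abs mu fr fi (s + j%:R / 2) ^+ 4 <=
    4 * G * Rintegral mu setT (fun x => fr x ^+ 2 + fi x ^+ 2) ^+ 2.
Proof.
move=> sr si.
pose X (j : nat) := ft_re mu fr fi (s + j%:R / 2); pose Y (j : nat) := ft_im mu fr fi (s + j%:R / 2).
pose p j := X j ^+ 2 - Y j ^+ 2; pose q j := 2 * X j * Y j.
pose S := \sum_(j < n) (p j ^+ 2 + q j ^+ 2).
have -> : \sum_(j < n) ft_abs mu fr fi (s + j%:R / 2) ^+ 4 = S.
  apply: eq_bigr => j _; rewrite (exprM _ 2 2) sqr_sqrtr ?addr_ge0 ?sqr_ge0//.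
  by rewrite -/(X j) -/(Y j) /p /q; ring.
have S0 : 0 <= S by apply: sumr_ge0 => j _; rewrite addr_ge0 ?sqr_ge0.
set n2 := Rintegral _ _ _.
pose h u := (\sum_(j < n) wave_re s p q j u) ^+ 2 + (\sum_(j < n) wave_im s p q j u) ^+ 2.
have h0 u : 0 <= h u by rewrite addr_ge0 ?sqr_ge0.
have cwave j : continuous (wave_re s p q j) /\ continuous (wave_im s p q j).
  have c1 : continuous (fun u : R => cos (freq s j * u)).
    by move=> u; apply: continuous_comp; [exact: mulrl_continuous|exact: continuous_cos].
  have c2 : continuous (fun u : R => sin (freq s j * u)).
    by move=> u; apply: continuous_comp; [exact: mulrl_continuous|exact: continuous_sin].
  split => u.
    by apply: cvgB; apply: cvgMr; [exact: c1|exact: c2].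
  by apply: cvgD; apply: cvgMr; [exact: c1|exact: c2].
have csum (f : nat -> R -> R) : (forall j, continuous (f j)) -> continuous (fun u => \sum_(j < n) f j u).
  move=> cf u; rewrite /continuous_at; elim: (n) => [|m IH].
    by under eq_fun do rewrite big_ord0; rewrite big_ord0; exact: cvg_cst.
  under eq_fun do rewrite big_ord_recr/=; rewrite big_ord_recr/=; apply: cvgD => //; exact: cf.
have ch : continuous h.
  by move=> u; apply: cvgD; apply: cvgM; apply: csum => j; have [] := cwave j.
have int_h : (\int[lebesgue_measure]_(x in (`]0%R, 2%R]%classic : set R)) (h x)%:E = (2 * S)%:E)%E.
  have [Phi [dPhi PhiE]] := has_primitive_square s p q n.
  have cPhi : continuous Phi.
    by move=> x; have [/derivable1_diffP d _] := dPhi x; exact: differentiable_continuous.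
  rewrite integral_itv_obnd_cbnd; last first.
    by apply/measurable_EFinP; apply: measurable_funTS; exact: continuous_measurable_fun.
  rewrite (@continuous_FTC2 R h Phi 0 2)//.
  - by rewrite -EFinB PhiE.
  - by apply: continuous_subspaceT => x; exact: ch.
  - split.
    + by move=> x _; have [] := dPhi x.
    + by apply: cvg_at_right_filter; exact: cPhi.
    + by apply: cvg_at_left_filter; exact: cPhi.
  - by move=> x _; rewrite derive1E; have [] := dPhi x.
have HH : (\int[mu]_y \int[mu]_x (h (x + y))%:E <= (G * (2 * S))%:E)%E.
  have := integral_sum_le h (continuous_measurable_fun ch) h0; rewrite int_h -EFinM.
  apply: le_trans; rewrite le_eqVlt; apply/orP; left; apply/eqP.
  by apply: eq_integral => y _; apply: eq_integral => x _; rewrite addrC.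
have := wave_sum_duality mu fr fi sr si s p q n (G * (2 * S)) HH.
rewrite -/n2.
have -> : \sum_(j < n) (p j * (ft_re mu fr fi (s + j%:R / 2) ^+ 2 - ft_im mu fr fi (s + j%:R / 2) ^+ 2) +
    q j * (2 * ft_re mu fr fi (s + j%:R / 2) * ft_im mu fr fi (s + j%:R / 2))) = S.
  by apply: eq_bigr => j _; rewrite -/(X j) -/(Y j) -/(p j) -/(q j) -!expr2.
have [->|Sn] := eqVneq S 0.
  by move=> _; rewrite mulr_ge0 ?sqr_ge0// mulr_ge0.
have Sp : 0 < S by rewrite lt_neqAle eq_sym Sn.
rewrite (_ : 2 * n2 ^+ 2 * (G * (2 * S)) = 4 * G * n2 ^+ 2 * S); last by ring.
by rewrite expr2 ler_pM2r.
Qed.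

Lemma fourth_moment (fr fi : R -> R) : sqint mu fr -> sqint mu fi ->
  (\int[lebesgue_measure]_x (ft_abs mu fr fi x ^+ 4)%:E <=
    (2 * G * Rintegral mu setT (fun x => fr x ^+ 2 + fi x ^+ 2) ^+ 2)%:E)%E.
Proof.
move=> sr si; set n2 := Rintegral _ _ _.
rewrite (_ : 2 * G * n2 ^+ 2 = (4 * G * n2 ^+ 2) / 2); last by field.
apply: integral_periodization => [|x|s n].
- by apply: measurable_funX; apply: measurable_ft_abs; [exact: sr.1|exact: si.1].
- by rewrite exprn_ge0// sqrtr_ge0.
- exact: discrete_fourth_moment.
Qed.

(** With [q = p / (p - 2)], the identity [q * (p - 2) = p] makes [A ^ (p - 2)] the [p]-th power of
    the [L^q] norm when [A] is the integral itself. *)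
Lemma restriction_endpoint_gt4 (p : R) : 4 < p -> exists C : R, 0 < C /\ forall (fr fi : R -> R) (A : R),
  measurable_fun setT fr -> measurable_fun setT fi -> 0 < A ->
  (\int[mu]_y (Num.sqrt (fr y ^+ 2 + fi y ^+ 2) `^ (p / (p - 2)))%:E <= A%:E)%E ->
  (\int[lebesgue_measure]_x (ft_abs mu fr fi x `^ p)%:E <= (C * A `^ (p - 2))%:E)%E.
Proof.
move=> p4; pose r := p - 4; have r0 : 0 < r by rewrite subr_gt0.
pose c : R := (1 - 2 `^ (- (p - 4)))^-1 * 8 `^ (p - 4).
have c0 : 0 <= c.
  rewrite mulr_ge0 ?powR_ge0// invr_ge0 subr_ge0 powRN invf_le1 ?powR_gt0//.
  by rewrite -[leLHS](powRr0 2) ler_powR ?ler1n// ltW.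
have GG := G0.
have K0 : 0 <= 512 * G * c := mulr_ge0 (mulr_ge0 (ler0n _ 512) GG) c0.
exists (512 * G * c + 1); split; first exact: ltr_wpDl.
move=> fr fi A mfr mfi A0 mA.
(* A bound of the transform; the summand [1] keeps it positive when the function vanishes. *)
pose T := 2 * Rintegral mu setT (fun y => Num.sqrt (fr y ^+ 2 + fi y ^+ 2)) + 1.
have T0 : 0 < T.
  by rewrite ltr_wpDl// mulr_ge0//; apply: Rintegral_ge0 => y _; exact: sqrtr_ge0.
pose t (i : nat) := T / 2 ^+ i; have t0 i : 0 < t i by rewrite divr_gt0// exprn_gt0.
pose F i x := ft_abs mu (truncate p A fr fi (t i) fr) (truncate p A fr fi (t i) fi) x.
have F0 i x : 0 <= F i x := sqrtr_ge0 _.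
have st i := sqint_truncate mu p A fr fi p4 A0 mfr mfi (t i) (t0 i).
have mF i : measurable_fun setT (F i).
  by have [s1 s2] := st i; apply: measurable_ft_abs; [exact: s1.1|exact: s2.1].
(* Here [256 = 4 ^ 4]: where the transform lies between [t i / 2] and [t i], the truncated one is at
   least [t i / 4]. *)
pose u (i : nat) x : \bar R := (256 * t i `^ r * F i x ^+ 4)%:E.
have k0 i : 0 <= 256 * t i `^ r := mulr_ge0 (ler0n _ 256) (powR_ge0 _ _).
have u0 i x : (0 <= u i x)%E by rewrite lee_fin; apply: mulr_ge0 (k0 i) _; exact: exprn_ge0.
have mu_ i : measurable_fun setT (u i).
  by apply/measurable_EFinP; apply: measurable_funM => //; exact: measurable_funX.
have pointwise x : ((ft_abs mu fr fi x `^ p)%:E <= \sum_(0 <= i <oo) u i x)%E.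
  have f0 : 0 <= ft_abs mu fr fi x := sqrtr_ge0 _.
  have [->|fn] := eqVneq (ft_abs mu fr fi x) 0.
    by rewrite powR0 ?gt_eqF ?(lt_trans _ p4)//; apply: nneseries_ge0 => i _ _; exact: u0.
  have fT : 0 < ft_abs mu fr fi x <= T.
    rewrite lt_neqAle eq_sym fn f0/=.
    apply: (le_trans (ft_abs_le_norm1 mu p A fr fi p4 mfr mfi mA x)).
    by rewrite lerDl.
  have [i /andP[i1 i2]] := dyadic_scale _ _ fT.
  rewrite -/(t i) in i1 i2.
  have h := ft_abs_truncate mu p A fr fi p4 A0 mfr mfi mA (t i) x (t0 i).
  have tF : t i <= 4 * F i x by move: h i1; rewrite -/(F i x); lra.
  apply: (@le_trans _ _ (\sum_(0 <= j < i.+1) u j x)%E); last first.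
    by apply: nneseries_lim_ge => j _ _; exact: u0.
  rewrite big_nat_recr//=; apply: (@le_trans _ _ (u i x)); last first.
    by rewrite leeDr// sume_ge0.
  rewrite lee_fin; apply: (@le_trans _ _ (t i `^ p)).
    by rewrite ge0_ler_powR ?nnegrE ?(ltW (t0 i))// ltW// (lt_trans _ p4).
  have -> : t i `^ p = t i `^ r * t i ^+ 4.
    rewrite -powR_mulrn ?(ltW (t0 i))// -powRD ?(gt_eqF (t0 i)) ?implybT//.
    by congr (_ `^ _); rewrite /r; ring.
  rewrite (_ : 256 * t i `^ r * F i x ^+ 4 = t i `^ r * (4 * F i x) ^+ 4); last by rewrite exprMn; ring.
  by rewrite ler_wpM2l ?powR_ge0// lerXn2r ?nnegrE ?(ltW (t0 i)) ?(le_trans (ltW (t0 i)) tF).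
apply: (@le_trans _ _ (\int[lebesgue_measure]_x \sum_(0 <= i <oo) u i x)%E).
  apply: ge0_le_integral => //.
  - by move=> x _; rewrite lee_fin powR_ge0.
  - apply/measurable_EFinP.
    exact: (measurableT_comp (measurable_powR p) (measurable_ft_abs mu fr fi mfr mfi)).
  - apply: ge0_emeasurable_sum => // i _; exact: mu_.
rewrite integral_nneseries//.
apply: lime_le.
  by apply: is_cvg_nneseries => i _ _; exact: integral_ge0.
apply: nearW => n.
have ui (i : nat) : (\int[lebesgue_measure]_x u i x <= (512 * G * A *
    (t i `^ r * Rintegral mu setT (truncate p A fr fi (t i) (fun y => Num.sqrt (fr y ^+ 2 + fi y ^+ 2) `^ (4 - p / (p - 2))))))%:E)%E.
  have [s1 s2] := st i.
  rewrite /u; under eq_integral do rewrite EFinM.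
  rewrite ge0_integralZl; last 4 first.
  - exact: measurableT.
  - by apply/measurable_EFinP; apply: measurable_funX; exact: mF.
  - by move=> x _; rewrite lee_fin exprn_ge0.
  - by rewrite lee_fin; exact: k0.
  have h1 := fourth_moment _ _ s1 s2.
  apply: (le_trans (lee_wpmul2l _ h1)); first by rewrite lee_fin; exact: k0.
  rewrite -EFinM lee_fin.
  have := truncate_square_le mu p A fr fi p4 A0 mfr mfi mA (t i) (t0 i).
  set n2 := Rintegral _ _ _; set W := Rintegral _ _ _ => h2.
  rewrite [leLHS](_ : _ = 512 * G * t i `^ r * n2 ^+ 2); last by ring.
  rewrite [leRHS](_ : _ = 512 * G * t i `^ r * (A * W)); last by ring.
  apply: ler_wpM2l h2; exact: mulr_ge0 (mulr_ge0 (ler0n _ 512) GG) (powR_ge0 _ _).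
apply: (@le_trans _ _ (\sum_(0 <= i < n) (512 * G * A *
    (t i `^ r * Rintegral mu setT (truncate p A fr fi (t i) (fun y => Num.sqrt (fr y ^+ 2 + fi y ^+ 2) `^ (4 - p / (p - 2))))))%:E)%E).
  by apply: lee_sum => i _.
rewrite sumEFin lee_fin -mulr_sumr big_mkord.
have := truncate_sum_le mu p A fr fi p4 A0 mfr mfi mA T n T0.
rewrite -/c => h.
apply: (le_trans (ler_wpM2l _ h)); first exact: mulr_ge0 (mulr_ge0 (ler0n _ 512) GG) (ltW A0).
have -> : A `^ (p - 2) = A * A `^ (p - 3).
  by rewrite -{2}[A]powRr1 ?(ltW A0)// -powRD ?(gt_eqF A0) ?implybT//; congr (_ `^ _); ring.
have := powR_ge0 A (p - 3); set a := A `^ _ => a0.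
have Aa0 : 0 <= A * a by rewrite mulr_ge0// ltW.
rewrite [leLHS](_ : _ = 512 * G * c * (A * a)); last by rewrite /c; ring.
by apply: ler_wpM2r => //; rewrite lerDl.
Qed.

(** At [p = 4] the dyadic weights [t ^ (p - 4)] no longer decay and the geometric series is lost;
    there [q = 2], and the fourth moment bound applies without truncation. *)
Lemma restriction_endpoint (p : R) : 4 <= p -> exists C : R, 0 < C /\ forall (fr fi : R -> R) (A : R),
  measurable_fun setT fr -> measurable_fun setT fi -> 0 < A ->
  (\int[mu]_y (Num.sqrt (fr y ^+ 2 + fi y ^+ 2) `^ (p / (p - 2)))%:E <= A%:E)%E ->
  (\int[lebesgue_measure]_x (ft_abs mu fr fi x `^ p)%:E <= (C * A `^ (p - 2))%:E)%E.
Proof.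
rewrite le_eqVlt => /orP[/eqP <-|]; last exact: restriction_endpoint_gt4.
have GG := G0.
have -> : 4 - 2 = 2 :> R by ring.
have -> : 4 / 2 = 2 :> R by field.
exists (2 * G + 1); split; first by rewrite ltr_wpDl// mulr_ge0.
move=> fr fi A mfr mfi A0 mA.
have E y : Num.sqrt (fr y ^+ 2 + fi y ^+ 2) `^ 2 = fr y ^+ 2 + fi y ^+ 2.
  by rewrite powR_mulrn ?sqrtr_ge0// sqr_sqrtr// addr_ge0 ?sqr_ge0.
have iE : mu.-integrable setT (EFin \o (fun y => fr y ^+ 2 + fi y ^+ 2)).
  apply/integrableP; split.
    by apply/measurable_EFinP; apply: measurable_funD; exact: measurable_funX.
  apply: le_lt_trans (ltry A); apply: le_trans mA; rewrite le_eqVlt; apply/orP; left; apply/eqP.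
  by apply: eq_integral => y _; rewrite /= E ger0_norm// addr_ge0 ?sqr_ge0.
have sq (h : R -> R) : measurable_fun setT h -> (forall y, h y ^+ 2 <= fr y ^+ 2 + fi y ^+ 2) -> sqint mu h.
  move=> mh hle; split => //; apply: (le_integrable measurableT _ _ iE).
    by apply/measurable_EFinP; exact: measurable_funX.
  by move=> y _; rewrite /= lee_fin ger0_norm ?sqr_ge0// ger0_norm// addr_ge0 ?sqr_ge0.
have sr : sqint mu fr by apply: sq => // y; rewrite lerDl sqr_ge0.
have si : sqint mu fi by apply: sq => // y; rewrite lerDr sqr_ge0.
have nA : Rintegral mu setT (fun x => fr x ^+ 2 + fi x ^+ 2) <= A.
  rewrite -lee_fin /Rintegral fineK; last exact: (integrable_fin_num measurableT iE).
  apply: le_trans mA; rewrite le_eqVlt; apply/orP; left; apply/eqP.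
  by apply: eq_integral => y _; rewrite E.
have n0 : 0 <= Rintegral mu setT (fun x => fr x ^+ 2 + fi x ^+ 2).
  by apply: Rintegral_ge0 => x _; rewrite addr_ge0 ?sqr_ge0.
apply: (@le_trans _ _ (\int[lebesgue_measure]_x (ft_abs mu fr fi x ^+ 4)%:E)%E).
  rewrite le_eqVlt; apply/orP; left; apply/eqP; apply: eq_integral => x _.
  by rewrite powR_mulrn// sqrtr_ge0.
apply: (le_trans (fourth_moment _ _ sr si)); rewrite lee_fin powR_mulrn ?(ltW A0)//.
apply: ler_pM; rewrite ?mulr_ge0 ?sqr_ge0//; first by rewrite lerDl.
by rewrite lerXn2r// nnegrE ltW.
Qed.

(** [mu] is finite, so the norm with exponent [q] dominates the one with the endpoint exponent
    [q0]. *)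
Lemma restriction_estimate (p q : R) : 4 <= p -> p / (p - 2) <= q -> exists C : R, forall fr fi : R -> R,
  measurable_fun setT fr -> measurable_fun setT fi ->
  ('N[lebesgue_measure]_(p%:E)[ (fun xi => (ft_abs mu fr fi xi)%:E) ]
   <= C%:E * 'N[mu]_(q%:E)[ (fun y => (Num.sqrt (fr y ^+ 2 + fi y ^+ 2))%:E) ])%E.
Proof.
move=> p4 q0q; have [C1 [C10 hC1]] := restriction_endpoint p p4.
have p0 : 0 < p by exact: lt_le_trans p4.
have p2 : 0 < p - 2 by move: p4; lra.
set q0 := p / (p - 2) in q0q hC1.
have q00 : 0 < q0 by rewrite divr_gt0.
have qpos : 0 < q := lt_le_trans q00 q0q.
pose M := fine (mu setT).
have M0 : 0 <= M by exact: fine_ge0.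
have ME : mu setT = M%:E by rewrite fineK// fin_num_measure.
have M1 : 0 < M + 1 by rewrite ltr_wpDl.
pose D := (C1 * (M + 1) `^ (p - 2)) `^ p^-1.
have D0 : 0 < D by rewrite powR_gt0// mulr_gt0// powR_gt0.
exists D => fr fi mfr mfi.
pose m y := Num.sqrt (fr y ^+ 2 + fi y ^+ 2).
have m0 y : 0 <= m y := sqrtr_ge0 _.
have mm : measurable_fun setT m.
  apply: measurableT_comp; first by apply: continuous_measurable_fun; exact: sqrt_continuous.
  by apply: measurable_funD; apply: measurable_funX.
have mpow (s : R) : measurable_fun setT (fun y => m y `^ s).
  exact: (measurableT_comp (measurable_powR s) mm).
(* [N] is any positive number not below the norm of exponent [q]. Working with [N] rather than the
   norm covers a vanishing norm, by adding a small positive number. *)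
have key (N : R) : 0 < N -> (\int[mu]_y (m y `^ q)%:E <= (N `^ q)%:E)%E ->
    ('N[lebesgue_measure]_(p%:E)[ (fun xi => (ft_abs mu fr fi xi)%:E) ] <= (D * N)%:E)%E.
  move=> N0 hN; pose A := N `^ q0 * (M + 1).
  have A0 : 0 < A by rewrite mulr_gt0// powR_gt0.
  have hA : (\int[mu]_y (m y `^ q0)%:E <= A%:E)%E.
    (* In place of Hoelder's inequality: [m ^ q0 <= N ^ q0] where [m <= N], and
       [m ^ q0 <= N ^ (q0 - q) * m ^ q] elsewhere. The integrals add up to at most
       [N ^ q0 * (M + 1)]. *)
    apply: (@le_trans _ _ (\int[mu]_y ((N `^ q0)%:E + (N `^ (q0 - q))%:E * (m y `^ q)%:E))%E).
      apply: ge0_le_integral => //.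
      - by move=> y _; rewrite lee_fin powR_ge0.
      - exact/measurable_EFinP.
      - apply: emeasurable_funD => //; apply: measurable_funeM; exact/measurable_EFinP.
      move=> y _; rewrite -EFinM -EFinD lee_fin.
      have [mN|Nm] := leP (m y) N.
        apply: (@le_trans _ _ (N `^ q0)); last by rewrite lerDl mulr_ge0 ?powR_ge0.
        by rewrite ge0_ler_powR ?nnegrE ?(ltW q00) ?(ltW N0).
      have my : 0 < m y by exact: lt_trans Nm.
      rewrite -[leLHS]add0r lerD ?powR_ge0//.
      have -> : m y `^ q0 = m y `^ (q0 - q) * m y `^ q.
        by rewrite -powRD ?subrK// (gt_eqF my) implybT.
      rewrite ler_wpM2r ?powR_ge0// -(opprB q q0) !powRN lef_pV2 ?posrE ?powR_gt0//.
      by rewrite ge0_ler_powR ?nnegrE ?subr_ge0 ?(ltW N0) ?(ltW Nm).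
    rewrite ge0_integralD//; last 3 first.
    - by move=> y _; rewrite lee_fin powR_ge0.
    - by move=> y _; rewrite -EFinM lee_fin mulr_ge0 ?powR_ge0.
    - by apply: measurable_funeM; exact/measurable_EFinP.
    rewrite integral_cst// ge0_integralZl; last 4 first.
    - exact: measurableT.
    - exact/measurable_EFinP.
    - by move=> y _; rewrite lee_fin powR_ge0.
    - by rewrite lee_fin powR_ge0.
    rewrite [X in (_ * X + _)%E]ME.
    apply: (@le_trans _ _ ((N `^ q0)%:E * M%:E + (N `^ (q0 - q))%:E * (N `^ q)%:E)%E).
      by rewrite leeD2l// lee_wpmul2l// lee_fin powR_ge0.
    rewrite -!EFinM -EFinD lee_fin -powRD; last by rewrite (gt_eqF N0) implybT.
    by rewrite subrK /A mulrDr mulr1.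
  have := hC1 fr fi A mfr mfi A0 hA => h.
  rewrite unlock.
  have -> : (\int[lebesgue_measure]_x (`|(ft_abs mu fr fi x)%:E| `^ p) =
     \int[lebesgue_measure]_x (ft_abs mu fr fi x `^ p)%:E)%E.
    by apply: eq_integral => x _; rewrite /= ger0_norm// sqrtr_ge0.
  have -> : D * N = (C1 * A `^ (p - 2)) `^ p^-1.
    rewrite /A [(N `^ q0 * _) `^ _]powRM ?powR_ge0 ?(ltW M1)//.
    rewrite -powRrM divfK ?(gt_eqF p2)//.
    rewrite mulrCA mulrC [RHS]powRM ?powR_ge0//; last by rewrite mulr_ge0 ?powR_ge0 ?(ltW C10).
    by rewrite -powRrM divff ?(gt_eqF p0)// powRr1// ltW.
  rewrite -poweR_EFin gt0_ler_poweR//.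
  - by rewrite invr_ge0 ltW.
  - by rewrite in_itv/= leey andbT; apply: integral_ge0 => x _; rewrite lee_fin powR_ge0.
  - by rewrite in_itv/= leey andbT lee_fin mulr_ge0 ?powR_ge0 ?(ltW C10).
set LN := 'N[mu]_(q%:E)[_]%E.
have LN0 : (0 <= LN)%E by exact: Lnorm_ge0.
have LNE : (LN `^ q = \int[mu]_y (m y `^ q)%:E)%E.
  rewrite /LN poweR_Lnorm ?gt_eqF//; apply: eq_integral => y _.
  by rewrite /= ger0_norm.
case E : LN LN0 LNE => [N| |]//= LN0 LNE; last by rewrite gt0_muley ?leey// lte_fin.
rewrite lee_fin in LN0.
apply/lee_addgt0Pr => e e0.
apply: (le_trans (key (N + e / D) _ _)).
- by rewrite ltr_wpDl// divr_gt0.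
- rewrite -LNE lee_fin ge0_ler_powR ?nnegrE ?(ltW qpos)//.
  + by rewrite addr_ge0// divr_ge0 ?ltW.
  + by rewrite lerDl divr_ge0 ?ltW.
- by rewrite -EFinM -EFinD lee_fin mulrDr mulrCA divff ?gt_eqF// mulr1.
Qed.

End bounded_self_convolution.

(** * Boundedness of the density, and conclusion *)

(** The self-convolution of stage [0] is at most its density bound [B] times its mass [B / N], and
    [g] differs from it by at most [2 * e 0]. *)
Lemma lim_g_bounded {R : realType} (alpha : R) (N_ : nat -> nat) (a_ : nat -> nat -> R) (e : nat -> R)
  (F g : R -> R) : salem_limit alpha N_ a_ e F g -> exists G, forall x, 0 <= g x <= G.
Proof.
move=> S; have [N0 a0 aN] := lim_state _ _ _ _ _ _ S 0%N.
set N := N_ 0%N in N0 aN; set a := a_ 0%N in a0 aN.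
pose B := \sum_(s < N) a s.
have aB s : (s < N)%N -> `|a s| <= B.
  by move=> sN; rewrite ger0_norm// /B (bigD1 (Ordinal sN))//= lerDl sumr_ge0.
have hom x : {homo (fun y => - cdf N a (x - y)) : u v / u <= v}.
  by move=> u v uv; rewrite lerN2; apply: cdf_homo => [s _//|]; rewrite lerD2l lerN2.
have B0 : 0 <= B by apply: sumr_ge0.
exists (B * (B / N%:R) + 2 * e 0%N) => x; rewrite (lim_g_ge0 _ _ _ _ _ _ S)/=.
have h1 := norm_stieltjes_sum N a B _ N0 aB (hom x).
have h2 := lim_conv _ _ _ _ _ _ S 0%N x.
rewrite -[leLHS](subrK (self_conv N a x)) addrC lerD//; last exact: le_trans (ler_norm _) h2.
apply: (le_trans (ler_norm _)); apply: (le_trans h1); rewrite ler_wpM2l// opprK subr0 addrC.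
have c0 : 0 <= cdf N a (x - 1) by apply: stieltjes_sum_ge0 => // u v uv; rewrite /Num.min; do 2 case: ifPn; rewrite -?leNgt => *; lra.
apply: (@le_trans _ _ (cdf N a x)); first by rewrite gerBl.
rewrite -(cdf_ge1 N a (Num.max 1 x))// ?le_max ?lexx//.
by apply: cdf_homo => [s _//|]; rewrite le_max lexx orbT.
Qed.

Theorem theorem14p4 (R : realType) (alpha0 : R) :
  1 / 2 < alpha0 < 1 ->
  exists mu : {finite_measure set R -> \bar R},
    strong_salem mu /\
    hausdorff_dim (msupport mu) = alpha0%:E /\
    (exists g : R -> R, holder_continuous g /\
       forall A : set R, measurable A ->
         ((mu \x mu) [set z : R * R | A (z.1 + z.2)%R] =
          \int[lebesgue_measure]_(x in A) (g x)%:E)%E) /\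
    (forall p q : R, 4 <= p -> p / (p - 2) <= q ->
       exists C : R, forall fr fi : R -> R,
         measurable_fun setT fr -> measurable_fun setT fi ->
         ('N[lebesgue_measure]_(p%:E)[ (fun xi => (ft_abs mu fr fi xi)%:E) ]
          <= C%:E * 'N[mu]_(q%:E)[ (fun y => (Num.sqrt (fr y ^+ 2 + fi y ^+ 2))%:E) ])%E).
Proof.
move=> al; have /andP[al1 al2] := al.
have al0 : 0 < alpha0 by rewrite (lt_trans _ al1).
have al01 : 0 < alpha0 < 1 by rewrite al0.
have [N_ [a_ [e [F [g S]]]]] := salem_limit_exists alpha0 al.
have cF : continuous F by exact: (lim_F_cont alpha0 N_ a_ e F g al01 S).
have [mu [muT muE]] := unit_cdf_measure F (lim_homo _ _ _ _ _ _ S) cF (lim_F0 _ _ _ _ _ _ S) (lim_F1 _ _ _ _ _ _ S).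
have mu01 := cdf_measure_support F mu (lim_F0 _ _ _ _ _ _ S) muT muE.
have dim := limit_dim alpha0 N_ a_ e F g S mu muT muE al0.
have dens := conv_density alpha0 N_ a_ e F g al01 S mu muT muE.
have [G gG] := lim_g_bounded alpha0 N_ a_ e F g S.
have mg : measurable_fun setT g by apply: continuous_measurable_fun; exact: (lim_g_cont alpha0 N_ a_ e F g S).
exists mu; split; [|split => //; split].
- exists alpha0; split => // a b aal bal.
  have [C1 h1] := limit_ball alpha0 N_ a_ e F g S mu muE a aal.
  have [C2 h2] := ft_abs_limit alpha0 N_ a_ e F g S mu muT muE b bal.
  exists (Num.max C1 C2); split => [x r r0|xi].
    apply: (le_trans (h1 x r r0)); rewrite lee_fin ler_wpM2r ?powR_ge0//.
    by rewrite le_max lexx.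
  apply: (le_trans (h2 xi)); rewrite ler_wpM2r ?powR_ge0//.
  by rewrite le_max lexx orbT.
- by exists g; split => //; exact: (lim_g_holder _ _ _ _ _ _ S).
- by move=> p q p4 pq; exact: (restriction_estimate mu g G mu01 gG mg dens p q p4 pq).
Qed.
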